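(* Assume $G_1,\dots,G_m$ satisfy (H1)–(H6), and let $d_i:=\deg R_i=\mathrm{wt}(G_i)$ and $R_i^h\in\mathbb F_q[X_0,\dots,X_r]$ the homogenization of $R_i$. Then $\mathrm{pcl}(V)=V(R_1^h,\dots,R_m^h)\subset\mathbb P^r$, and $\mathrm{pcl}(V)$ is a normal complete intersection (in particular absolutely irreducible) of dimension $r-m$ and degree $\prod_{i=1}^m d_i$.
   Context: Setup. Let $q$ be a prime power, $\mathbb F_q$ the field with $q$ elements, $\overline{\mathbb F}_q$ an algebraic closure. Let $m<r$ be positive integers and fix $k$ with $0\le k\le r-1$. Let $A_{r-1},\dots,A_0$ be indeterminates and let $\mathbb F_q[\boldsymbol A_k]$ denote the polynomial ring over $\mathbb F_q$ in the $r-1$ variables $A_j$, $j\neq k$. Identify a monic polynomial $f_{\boldsymbol a}=T^r+a_{r-1}T^{r-1}+\dots+a_0\in\overline{\mathbb F}_q[T]$ with $\boldsymbol a=(a_{r-1},\dots,a_0)\in\overline{\mathbb F}_q^{\,r}$. Let $G_1,\dots,G_m\in\mathbb F_q[\boldsymbol A_k]$ (viewed as functions on $\overline{\mathbb F}_q^{\,r}$ not depending on the coordinate $a_k$), let $W:=\{\boldsymbol a\in\overline{\mathbb F}_q^{\,r}:G_1(\boldsymbol a)=\dots=G_m(\boldsymbol a)=0\}$. Define the weight $\mathrm{wt}(A_j):=r-j$, extended additively to monomials; $\mathrm{wt}(G)$ is the maximal weight of a monomial of $G$ and $G^{\mathrm{wt}}$ is the sum of the terms of $G$ of weight $\mathrm{wt}(G)$.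 For $\mathcal B\subset\overline{\mathbb F}_q^{\,r}$, the discriminant locus is $\mathcal D(\mathcal B):=\{\boldsymbol a\in\mathcal B:\mathrm{Disc}(f_{\boldsymbol a})=0\}$, where $\mathrm{Disc}(f)=\mathrm{Res}(f,f')$, and the first subdiscriminant locus is $\mathcal S_1(\mathcal B):=\{\boldsymbol a\in\mathcal D(\mathcal B):\mathrm{Subdisc}(f_{\boldsymbol a})=0\}$, where $\mathrm{Subdisc}(f)$ is the first subresultant of $f$ and $f'$. Hypotheses: (H1) $G_1,\dots,G_m$ form a regular sequence in $\mathbb F_q[\boldsymbol A_k]$. (H2) The Jacobian matrix $(\partial G_i/\partial A_j)_{1\le i\le m,\ j\ne k}$ has rank $m$ at every point of $W$. (H3) $G_1^{\mathrm{wt}},\dots,G_m^{\mathrm{wt}}$ satisfy (H1) and (H2) (with $W$ replaced by $V(G_1^{\mathrm{wt}},\dots,G_m^{\mathrm{wt}})$). (H4) $\mathcal D(W)$ has codimension at least one in $W$. (H5) The set $\{\boldsymbol a\in\mathcal D(W):a_0=0\}\cup\mathcal S_1(W)$ has codimension at least one in $\mathcal D(W)$. (H6) $\mathcal D(V(G_1^{\mathrm{wt}},\dots,G_m^{\mathrm{wt}}))$ has codimension at least one in $V(G_1^{\mathrm{wt}},\dots,G_m^{\mathrm{wt}})\subset\overline{\mathbb F}_q^{\,r}$. Symmetric lift. Let $X_1,\dots,X_r$ be indeterminates and $\Pi_1,\dots,\Pi_r$ the elementary symmetric polynomials in them. $R_i\in\mathbb F_q[X_1,\dots,X_r]$ ($1\le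 i\le m$) is obtained from $G_i$ by substituting $A_j\mapsto(-1)^{r-j}\Pi_{r-j}(X_1,\dots,X_r)$ for every $j\ne k$; $V:=\{R_1=\dots=R_m=0\}\subset\overline{\mathbb F}_q^{\,r}$. $\mathrm{pcl}(V)\subset\mathbb P^r$ is the Zariski closure of the image of $V$ under $(x_1,\dots,x_r)\mapsto(1:x_1:\dots:x_r)$. A complete intersection is called normal if its singular locus has codimension at least $2$ in it. *)

(* Defs.v *)
From HB Require Import structures.
From mathcomp Require Import all_boot all_order all_algebra.
From mathcomp Require Import mpoly.
Set Implicit Arguments. Unset Strict Implicit. Unset Printing Implicit Defensive.
Import Order.TTheory GRing.Theory Num.Theory.
Local Open Scope ring_scope.

Definition pset (T : Type) := T -> Prop.
Definition psubset (T : Type) (A B : pset T) := forall x, A x -> B x.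

Section Topology.
Variable T : Type.
Variable closed : pset T -> Prop.

Definition irreducible (S : pset T) :=
  (exists x, S x) /\
  forall A B, closed A -> closed B -> (forall x, S x -> A x \/ B x) ->
    psubset S A \/ psubset S B.

Definition has_chain (S : pset T) (n : nat) :=
  exists Z : nat -> pset T,
    (forall i, (i <= n)%N -> [/\ closed (Z i), irreducible (Z i) & psubset (Z i) S]) /\
    (forall i, (i < n)%N -> psubset (Z i) (Z i.+1) /\ ~ psubset (Z i.+1) (Z i)).

Definition dim_eq (S : pset T) (n : nat) := has_chain S n /\ ~ has_chain S n.+1.

(* S has codimension at least c in T': dim S + c <= dim T'
   (vacuous when S is empty, i.e. dim S = -1) *)
Definition codim_ge (S T' : pset T) (c : nat) :=
  forall n, has_chain S n -> has_chain T' (n + c).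
End Topology.

Section Geometry.
Variable K : fieldType.

Definition nonzero n (x : 'I_n -> K) := exists i, x i != 0.

Definition aclosed n (S : pset ('I_n -> K)) :=
  exists P : pset {mpoly K[n]}, forall x, S x <-> forall p, P p -> p.@[x] = 0.

(* Zariski-closed subsets of P^(n-1)(K), represented by their affine cones
   minus the origin (sets of nonzero vectors of K^n) *)
Definition pclosed n (S : pset ('I_n -> K)) :=
  exists P : pset {mpoly K[n]},
    (forall p, P p -> exists d, p \is d.-homog) /\
    forall x, S x <-> (nonzero x /\ forall p, P p -> p.@[x] = 0).

Definition vanish n (S : pset ('I_n -> K)) (p : {mpoly K[n]}) :=
  forall x, S x -> p.@[x] = 0.

(* singular points of a projective variety S of dimension dS in P^r
   (Jacobian criterion applied to the whole vanishing ideal of S) *)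
Definition singular r (S : pset ('I_r.+1 -> K)) (dS : nat) (x : 'I_r.+1 -> K) :=
  S x /\
  forall f : 'I_(r - dS) -> {mpoly K[r.+1]}, (forall i, vanish S (f i)) ->
    (\rank (\matrix_(i < r - dS, j < r.+1) ((f i)^`M(j)).@[x]) < r - dS)%N.

Definition complete_intersection r m (S : pset ('I_r.+1 -> K))
    (F : 'I_m -> {mpoly K[r.+1]}) :=
  [/\ forall i, exists d, F i \is d.-homog,
      forall x, S x <-> (nonzero x /\ forall i, (F i).@[x] = 0),
      forall p, vanish S p -> exists g : 'I_m -> {mpoly K[r.+1]},
                  p = \sum_(i < m) g i * F i
    & dim_eq (@pclosed r.+1) S (r - m)].

Definition normal_complete_intersection r m (S : pset ('I_r.+1 -> K))
    (F : 'I_m -> {mpoly K[r.+1]}) :=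
  complete_intersection S F /\
  codim_ge (@pclosed r.+1) (singular S (r - m)) S 2.

(* Hilbert function of a projective set S: h = dim of the degree-t part of
   K[X]/I(S) *)
Definition hilb_indep n (S : pset ('I_n -> K)) (t h : nat) :=
  exists f : 'I_h -> {mpoly K[n]},
    (forall i, f i \is t.-homog) /\
    forall c : 'I_h -> K, vanish S (\sum_(i < h) c i *: f i) -> forall i, c i = 0.

Definition hilb n (S : pset ('I_n -> K)) (t h : nat) :=
  hilb_indep S t h /\ ~ hilb_indep S t h.+1.

Definition pdegree n (S : pset ('I_n -> K)) (dS D : nat) :=
  exists P : {poly rat},
    [/\ size P = dS.+1, lead_coef P = D%:R / (dS`!)%:R &
        exists t0, forall t, (t0 <= t)%N -> exists h, hilb S t h /\ P.[t%:R] = h%:R].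
End Geometry.

Definition mwt r (mon : 'X_{1..r}) : nat := (\sum_(j < r) (r - j) * mon j)%N.

Definition wt (F : ringType) r (G : {mpoly F[r]}) : nat :=
  (\max_(mon <- msupp G) mwt mon)%N.

Definition wtpart (F : ringType) r (G : {mpoly F[r]}) : {mpoly F[r]} :=
  \sum_(mon <- msupp G | mwt mon == wt G) G@_mon *: 'X_[mon].

Definition indep_of (F : ringType) r (k : 'I_r) (G : {mpoly F[r]}) :=
  forall mon, mon \in msupp G -> mon k = 0%N.

Definition in_ideal_k (F : ringType) r m (k : 'I_r) (G : 'I_m -> {mpoly F[r]})
    (i : nat) (p : {mpoly F[r]}) :=
  exists g : 'I_m -> {mpoly F[r]},
    (forall j, indep_of k (g j)) /\ p = \sum_(j < m | (j < i)%N) g j * G j.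

Definition regular_seq_k (F : ringType) r m (k : 'I_r) (G : 'I_m -> {mpoly F[r]}) :=
  (forall i : 'I_m, forall h, indep_of k h ->
     in_ideal_k k G i (h * G i) -> in_ideal_k k G i h) /\
  ~ in_ideal_k k G m 1.

Section OverK.
Variables (F : fieldType) (K : fieldType) (iota : {rmorphism F -> K}).

Definition zeroset r m (G : 'I_m -> {mpoly F[r]}) : pset ('I_r -> K) :=
  fun a => forall i, (map_mpoly iota (G i)).@[a] = 0.

Definition jacobian_full r m (k : 'I_r) (G : 'I_m -> {mpoly F[r]})
    (Z : pset ('I_r -> K)) :=
  forall a, Z a ->
    \rank (\matrix_(i < m, j < r)
            (if j == k then 0 else (map_mpoly iota ((G i)^`M(j))).@[a])) = m.
End OverK.

Definition fpoly (K : ringType) r (a : 'I_r -> K) : {poly K} :=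
  'X^r + \sum_(j < r) a j *: 'X^j.

Definition shcoef (K : ringType) (p : {poly K}) (s d : nat) : K :=
  if (s <= d)%N then p`_(d - s) else 0.

(* j-th subresultant (principal coefficient) of f, g with formal degrees n, m:
   determinant of the matrix with rows x^(m-j-1) f, ..., f, x^(n-j-1) g, ..., g
   and columns indexed by the degrees n+m-j-1, ..., j.  For j = 0 this is the
   Sylvester resultant. *)
Definition subresmx (K : ringType) (n m j : nat) (f g : {poly K}) :=
  \matrix_(i < n + m - j.*2, c < n + m - j.*2)
     (if (i < m - j)%N then shcoef f (m - j - 1 - i) (n + m - j - 1 - c)
      else shcoef g (n - j - 1 - (i - (m - j))) (n + m - j - 1 - c)).

Definition subres (K : comRingType) (n m j : nat) (f g : {poly K}) : K :=
  \det (subresmx n m j f g).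

Definition Disc (K : comRingType) r (a : 'I_r -> K) : K :=
  subres r r.-1 0 (fpoly a) (fpoly a)^`().
Definition Subdisc (K : comRingType) r (a : 'I_r -> K) : K :=
  subres r r.-1 1 (fpoly a) (fpoly a)^`().

Definition Dlocus (K : comRingType) r (B : pset ('I_r -> K)) : pset ('I_r -> K) :=
  fun a => B a /\ Disc a = 0.
Definition S1locus (K : comRingType) r (B : pset ('I_r -> K)) : pset ('I_r -> K) :=
  fun a => Dlocus B a /\ Subdisc a = 0.

Definition symlift (F : ringType) r (G : {mpoly F[r]}) : {mpoly F[r]} :=
  G \mPo [tuple ((-1) ^+ (r - j) *: mesym r F (r - j)) | j < r].

Definition homogenize (F : ringType) r (p : {mpoly F[r]}) : {mpoly F[r.+1]} :=
  \sum_(mon <- msupp p)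
     p@_mon *: ('X_ord0 ^+ ((msize p).-1 - mdeg mon) *
                (('X_[mon] : {mpoly F[r]}) \mPo [tuple 'X_(lift ord0 i) | i < r])).

Definition emb1 (K : ringType) r (x : 'I_r -> K) : 'I_r.+1 -> K :=
  fun i => if unlift ord0 i is Some j then x j else 1.

Definition pcl (K : fieldType) r (V : pset ('I_r -> K)) : pset ('I_r.+1 -> K) :=
  fun y => nonzero y /\
    forall p : {mpoly K[r.+1]}, (exists d, p \is d.-homog) ->
      (forall x, V x -> p.@[emb1 x] = 0) -> p.@[y] = 0.

(* Main.v *)
Require Import Defs.
From HB Require Import structures.
From mathcomp Require Import all_boot all_order all_algebra.
From mathcomp Require Import mpoly.
From mathcomp Require Import fingroup perm.
From mathcomp Require Import ring zify.
From mathcomp Require boolp classical_sets.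
From Stdlib Require Import Classical FunctionalExtensionality.
Set Implicit Arguments. Unset Strict Implicit. Unset Printing Implicit Defensive.
Import Order.TTheory GRing.Theory Num.Theory.
Local Open Scope ring_scope.

(** The Jacobian condition of (H3) at the origin forces [G_i = c_i a_(j_i) + ...]
    with distinct [j_i], all other monomials involving only variables of smaller
    weight. So [W], its weighted degeneration and the family joining them are
    graphs over the remaining coefficients [y = (a_(e l))], one of which is [a_k],
    and [V(R_1^h, ..., R_m^h)] consists of the points [(x_0 : x)] for which
    [prod_i (T - x_i)] has the coefficients [gam (x_0, y)]. Over [B = K[x_0, y]] the
    coordinate ring of this cone is free on the Artin monomials [x^alpha],
    [alpha_i < r - i], and the symmetric group acts transitively on the fibres.

    Read on the graph, (H4) and (H6) say that the discriminant [D] in [B] is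
    nonzero and prime to [x_0], and (H5) says that at a generic point of each
    component of [D = 0] the polynomial has one double root, which is nonzero.
    Moving such a polynomial in the direction [a_k] shows that [D] is squarefree.
    The indicator function of a component of the cone is integral over [B] with a
    denominator whose square divides [D], so it is regular and the cone is
    irreducible; freeness shows that the [R_i^h] generate its ideal.

    A linear dependency between the gradients of the [R_i^h] at [x] gives a nonzero
    functional on polynomials of degree less than [r] that kills [T^k] and all
    [prod_(i != l) (T - x_i)]. There is none when the roots are distinct, nor when
    exactly two of them coincide at a nonzero value. Hence the singular locus lies
    in a subset of codimension two of the cone. Counting the basis monomials by
    degree gives the Hilbert function. *)

(** * Prime factorization in polynomial rings *)

(** Dimension is a statement about chains of irreducible closed sets, so each bound needs its own
    device. Upper bounds come from transcendence degree: a strict step between primes costs one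
    algebraically independent element, and integrality over [B] lets primes of the cone be
    contracted to [B] without losing strictness. Lower bounds come from lifting coordinate sections
    of the base through the finite map to [B], because a closed set minimal among those lying over
    such a section is irreducible. (H4)-(H6) speak of the fibres x_0 = 1 and x_0 = 0 only; the
    weighted homogeneity of [D] carries them to the whole family. A prime factor of [D] that is
    constant on x_0 = 1 would be a scalar times a power of x_0, which (H6) excludes. Hence every
    prime factor cuts out a hypersurface in W, too large for the exceptional set of (H5). Since r!
    may vanish in the field, invariant functions cannot be produced by averaging. Expansion in Artin
    monomials, compared at the permutations of a point with distinct roots, does that work
    instead. *)

Definition divides (R : comNzRingType) (a b : R) := exists c, b = c * a.

Lemma divides_mull (R : comNzRingType) (a b c : R) : divides a b -> divides a (c * b).
Proof. by case=> d ->; exists (c * d); rewrite mulrA. Qed.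

Lemma divides_mulr (R : comNzRingType) (a b c : R) : divides a b -> divides a (b * c).
Proof. by rewrite mulrC; apply: divides_mull. Qed.

Lemma divides_add (R : comNzRingType) (a b c : R) :
  divides a b -> divides a c -> divides a (b + c).
Proof. by case=> d -> [e ->]; exists (d + e); rewrite mulrDl. Qed.

Lemma divides_opp (R : comNzRingType) (a b : R) : divides a b -> divides a (- b).
Proof. by case=> d ->; exists (- d); rewrite mulNr. Qed.

Lemma divides_refl (R : comNzRingType) (a : R) : divides a a.
Proof. by exists 1; rewrite mul1r. Qed.

Lemma divides0 (R : comNzRingType) (a : R) : divides a 0.
Proof. by exists 0; rewrite mul0r. Qed.

Lemma divides_trans (R : comNzRingType) (a b c : R) :
  divides a b -> divides b c -> divides a c.
Proof. by move=> ab [d ->]; apply: divides_mull. Qed.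

Definition prime_elt (R : idomainType) (p : R) :=
  [/\ p != 0, p \isn't a GRing.unit &
      forall a b, divides p (a * b) -> divides p a \/ divides p b].

Definition has_prime_divisors (R : idomainType) :=
  forall a : R, a != 0 -> a \isn't a GRing.unit -> exists2 p, prime_elt p & divides p a.

Lemma nat_minimal (P : nat -> Prop) : (exists n, P n) ->
  exists2 n, P n & forall k, P k -> (n <= k)%N.
Proof.
case=> n; have [k] := ubnP n; elim: k n => // k IH n /ltnSE nk Pn.
case: (classic (exists2 l, P l & (l < n)%N)) => [[l Pl ln]|H].
  by apply: (IH l) => //; apply: leq_trans nk.
by exists n => // l Pl; rewrite leqNgt; apply/negP => ln; apply: H; exists l.
Qed.

Section GaussLemma.
Variables (R : idomainType) (delta : R -> nat).
Hypothesis deltaM : forall a b, a != 0 -> b != 0 -> delta (a * b) = (delta a + delta b)%N.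
Hypothesis delta_unit : forall a, a != 0 -> delta a = 0%N -> a \is a GRing.unit.
Hypothesis R_primes : has_prime_divisors R.
Implicit Types (p q u v : {poly R}).

Lemma divides_polyC (c : R) p : divides c%:P p <-> forall i, divides c p`_i.
Proof.
split=> [[q ->] i|H]; first by exists q`_i; rewrite coefMC.
have [f Hf] : exists f : {ffun 'I_(size p) -> R}, forall i : 'I_(size p), p`_i = f i * c.
  have : forall i : 'I_(size p), exists d, (p`_i == d * c) by move=> i; case: (H i) => d ->; exists d.
  move=> /fin_all_exists [f Hf]; exists (finfun f) => i; rewrite ffunE; exact/eqP.
exists (\sum_(i < size p) f i *: 'X^i); rewrite mulr_suml.
rewrite -[LHS]coefK poly_def; apply: eq_bigr => i _.
by rewrite Hf -!mul_polyC polyCM mulrAC.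
Qed.

(** Gauss's lemma: let i and j be least such that [c] does not divide [p]_i[and]q[_j]. In
    coefficient i + j of the product every other term is divisible by [c]. *)
Lemma polyC_prime (c : R) : prime_elt c -> prime_elt c%:P.
Proof.
case=> c0 cu cM; split; rewrite ?polyC_eq0 //.
  apply: contra cu; rewrite poly_unitE => /andP[_]; by rewrite coefC.
move=> p q pq; apply: NNPP => /not_or_and [np nq].
have exn u : ~ divides c%:P u -> exists n, ~ divides c u`_n.
  by move=> H; apply: not_all_ex_not => H'; apply: H; apply/divides_polyC.
have [i pi imin] := nat_minimal (exn p np).
have [j qj jmin] := nat_minimal (exn q nq).
have dlt u n k : (forall k, ~ divides c u`_k -> (n <= k)%N) -> (k < n)%N -> divides c u`_k.
  by move=> H kn; apply: NNPP => /H; rewrite leqNgt kn.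
have /divides_polyC/(_ (i + j)%N) := pq.
rewrite coefM (bigD1 (Ordinal (leq_addr j i : i < (i + j).+1)%N)) //= addKn => D.
suff /cM[] : divides c (p`_i * q`_j) by [].
set S := \big[_/_]_(_ | _) _ in D.
have DS : divides c S.
  apply: (big_ind (divides c)) => [|x y|k]; [exact: divides0|exact: divides_add|].
  rewrite -val_eqE /= neq_ltn => /orP[ki|ki]; first by apply: divides_mulr; apply: dlt ki.
  apply: divides_mull; apply: dlt jmin _; case: k ki => k /= kl ki; lia.
by rewrite -[X in divides c X](addrK S); apply: divides_add D _; apply: divides_opp.
Qed.

Definition primitive p := forall c : R, prime_elt c -> ~ divides c%:P p.

(** Splitting off a prime factor lowers [delta], which is additive and positive on non-units, so
    every nonzero element is reached by finitely many prime multiplications from a unit. *)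
Lemma delta_ind (P : R -> Prop) :
  (forall c, c \is a GRing.unit -> P c) ->
  (forall c d, prime_elt d -> c != 0 -> P c -> P (d * c)) -> forall c, c != 0 -> P c.
Proof.
move=> Pu PM c; have [n] := ubnP (delta c); elim: n c => // n IH c /ltnSE cn c0.
have [/Pu//|cu] := boolP (c \is a GRing.unit).
have [d dP [e ce]] := R_primes c0 cu.
have [d0 du _] := dP; have e0 : e != 0 by apply: contraNneq c0 => e0; rewrite ce e0 mul0r.
rewrite ce mulrC; apply: PM => //; apply: IH => //.
have d1 : (0 < delta d)%N by rewrite lt0n; apply: contra du => /eqP/delta_unit; apply.
apply: leq_trans cn; rewrite ce deltaM //; lia.
Qed.

(** The primes of [c] are removed one at a time: each divides the product of the cofactor with [p],
    and not [p], hence the cofactor. *)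
Lemma primitive_divides_cancel p u (c : R) :
  primitive p -> c != 0 -> divides p (c%:P * u) -> divides p u.
Proof.
move=> pP c0; move: c c0 u; apply: delta_ind => [c cu u D|c d dP c0 IH u [w]].
  have := divides_mull (c^-1)%:P D.
  by rewrite mulrA -polyCM mulVr // polyC1 mul1r.
have [d0 _ _] := dP; have [_ _ dM] := polyC_prime dP.
rewrite polyCM -mulrA => E.
have /dM[] : divides d%:P (w * p) by rewrite -E mulrC; exists (c%:P * u).
  case=> w' wE; apply: IH; exists w'; apply: (mulfI (_ : d%:P != 0)); first by rewrite polyC_eq0.
  by rewrite E wE; ring.
by move/(pP d dP).
Qed.

(** This brings a factorization over the fraction field back to [R]: every prime of [c] is charged
    to whichever of [q] and [u] it divides. Degrees are unaffected, and only that of [q] is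
    recorded. *)
Lemma gauss_split (c : R) p q u : c != 0 -> c%:P * p = q * u -> u != 0 ->
  exists q' u' d, [/\ p = q' * u', u = d%:P * u', d != 0 & size q' = size q].
Proof.
move=> c0; move: c c0 p q u; apply: delta_ind => [c cu p q u E u0|c d dP c0 IH p q u E u0].
  exists ((c^-1)%:P * q), u, 1; split; rewrite ?mul1r ?oner_eq0 //.
    by rewrite -mulrA -E mulrA -polyCM mulVr // polyC1 mul1r.
  rewrite mul_polyC size_scale //; by rewrite invr_eq0; apply: contraTneq cu => ->; rewrite unitr0.
have [d0 _ _] := dP; have [_ _ dM] := polyC_prime dP.
have d0' : d%:P != 0 by rewrite polyC_eq0.
have /dM[] : divides d%:P (q * u) by rewrite -E polyCM; exists (c%:P * p); ring.
  case=> q1 qE; have [] := IH p q1 u _ u0.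
    by apply: (mulfI d0'); rewrite mulrA -polyCM E qE; ring.
  move=> q' [u' [e [-> -> e0 S]]]; exists q', u', e; split => //.
  by rewrite S qE mulrC mul_polyC size_scale.
case=> u1 uE; have u10 : u1 != 0 by apply: contraNneq u0 => u10; rewrite uE u10 mul0r.
have [] := IH p q u1 _ u10.
  by apply: (mulfI d0'); rewrite mulrA -polyCM E uE; ring.
move=> q' [u' [e [-> u1E e0 S]]]; exists q', u', (d * e); split => //; last by rewrite mulf_neq0.
by rewrite uE u1E polyCM; ring.
Qed.

(** Take a nonzero [g] of least size in the ideal of [p] and [u]. Pseudo-division makes [g] divide a
    constant multiple of each of them, and irreducibility of [p] then leaves only the case of a
    constant [g]. *)
Lemma bezout_primitive p u : primitive p -> (1 < size p)%N ->
  (forall q v, p = q * v -> size q = 1%N \/ size v = 1%N) ->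
  ~ divides p u -> exists a b d, d != 0 /\ d%:P = a * p + b * u.
Proof.
move=> pP sp pI npu.
have p0 : p != 0 by rewrite -size_poly_gt0; apply: leq_trans sp.
pose I g := exists a b, g = a * p + b * u.
have [|n [g [g0 Ig gn]] gmin] := @nat_minimal (fun n => exists g, [/\ g != 0, I g & size g = n]).
  by exists (size p), p; split => //; exists 1, 0; rewrite mul1r mul0r addr0.
have key f : I f -> exists c q, c != 0 /\ c%:P * f = q * g.
  move=> If; exists (lead_coef g ^+ scalp f g), (f %/ g).
  split; first by rewrite expf_neq0 // lead_coef_eq0.
  have E := Pdiv.Idomain.divp_eq f g.
  rewrite mul_polyC E; suff -> : f %% g = 0 by rewrite addr0.
  apply: NNPP => /eqP r0.
  have : (n <= size (f %% g)%R)%N.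
    apply: gmin; exists (f %% g); split=> //.
    case: If => a1 [b1 fE]; case: Ig => a2 [b2 gE].
    have -> : f %% g = lead_coef g ^+ scalp f g *: f - f %/ g * g by rewrite E; ring.
    exists ((lead_coef g ^+ scalp f g)%:P * a1 - f %/ g * a2).
    exists ((lead_coef g ^+ scalp f g)%:P * b1 - f %/ g * b2).
    by rewrite -mul_polyC {2}fE [X in _ - _ * X]gE; ring.
  by rewrite -gn leqNgt ltn_modp g0.
have Ip : I p by exists 1, 0; rewrite mul1r mul0r addr0.
have Iu : I u by exists 0, 1; rewrite mul1r mul0r add0r.
have [c [q [c0 E]]] := key p Ip.
have [c' [q2 [c'0 E2]]] := key u Iu.
have [q' [g' [d [pE gE d0 sq]]]] := gauss_split c0 E g0.
(* Either [p] is a constant multiple of the common factor [g'], and then [p] divides [u], or [g']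
   has degree 0 and [g] is the constant sought. *)
have [s1|s1] := pI _ _ pE.
  case: npu; move/eqP: s1 => /size_poly1P [e e0 q'E].
  apply: (@primitive_divides_cancel _ _ (c' * e)) => //; first by rewrite mulf_neq0.
  exists (q2 * d%:P); rewrite polyCM mulrAC E2 gE pE q'E; ring.
case: Ig => a [b gE']; exists a, b.
move/eqP: s1 gE => /size_poly1P [e e0 ->] gE; exists (d * e).
by rewrite mulf_neq0 // -gE' gE polyCM.
Qed.

(** Without constant prime divisors, a divisor of least positive degree is irreducible. It is prime
    by Bezout: if it does not divide [u], it divides [d * v] for a nonzero constant [d], and [d]
    cancels by primitivity. *)
Lemma poly_has_prime_divisors : has_prime_divisors {poly R}.
Proof.
move=> p p0 pu.
case: (classic (exists2 c, prime_elt c & divides c%:P p)) => [[c cP cp]|np].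
  by exists c%:P => //; apply: polyC_prime.
have pP : primitive p by move=> c cP cp; apply: np; exists c.
have sp : (1 < size p)%N.
  rewrite ltnNge; apply/negP => /size1_polyC pE.
  have c0 : p`_0 != 0 by apply: contraNneq p0 => c0; rewrite pE c0.
  have [|c cP [d D]] := R_primes c0.
    by apply: contra pu => cu; rewrite pE poly_unitE size_polyC c0 coefC cu.
  by apply: (pP c cP); rewrite pE D polyCM; exists d%:P.
have [|n [p1 [pp1 sp1 p1n]] nmin] :=
  @nat_minimal (fun n => exists q, [/\ divides q p, (1 < size q)%N & size q = n]).
  by exists (size p), p; split => //; apply: divides_refl.
have p10 : p1 != 0 by rewrite -size_poly_gt0; apply: leq_trans sp1.
have p1P : primitive p1 by move=> c cP cp; apply: (pP c cP); apply: divides_trans pp1.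
have p1I q v : p1 = q * v -> size q = 1%N \/ size v = 1%N.
  move=> E; have := p10; rewrite E mulf_eq0 negb_or => /andP[q0 v0].
  have := size_mul q0 v0; rewrite -E.
  move: q0 v0; rewrite -!size_poly_gt0 => q0 v0 S.
  case: (leqP (size q) 1) => [|q1]; first by left; lia.
  have : (n <= size q)%N.
    by apply: nmin; exists q; split => //; apply: divides_trans pp1; rewrite E; exists v; rewrite mulrC.
  by rewrite -p1n; right; lia.
exists p1 => //; split=> //.
  by rewrite poly_unitE gtn_eqF.
move=> u v D; apply: NNPP => /not_or_and [nu nv]; apply: nv.
have [a [b [d [d0 E]]]] := bezout_primitive p1P sp1 p1I nu.
apply: (@primitive_divides_cancel _ _ d) => //; rewrite E mulrDl.
apply: divides_add; first by rewrite mulrAC; exists (a * v).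
by rewrite -mulrA; apply: divides_mull.
Qed.

Lemma bezout_prime p u : prime_elt p -> (1 < size p)%N -> ~ divides p u ->
  exists a b d, d != 0 /\ d%:P = a * p + b * u.
Proof.
case=> p0 pu pM sp; apply: bezout_primitive => // [c [c0 cu _] [q E]|q v E].
  have /pM[] : divides p (q * c%:P) by rewrite -E; apply: divides_refl.
    case=> w qE; case/negP: cu; apply/unitrPr; exists w`_0.
    move: E; rewrite qE -mulrA [p * _]mulrC mulrA => E.
    have : (w * c%:P) = 1 by apply: (mulIf p0); rewrite -E mul1r.
    by move/(congr1 (fun s : {poly R} => s`_0)); rewrite coefMC coefC eqxx mulrC.
  case=> w cE; have w0 : w != 0 by apply: contraNneq c0 => w0; rewrite -polyC_eq0 cE w0 mul0r.
  have : (size (c%:P) <= 1)%N by rewrite size_polyC leq_b1.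
  rewrite cE size_mul //; move: w0; rewrite -size_poly_gt0; lia.
have := p0; rewrite E mulf_eq0 negb_or => /andP[q0 v0].
have := size_mul q0 v0; rewrite -E.
have := q0; have := v0; rewrite -!size_poly_gt0 => v1 q1 S.
have /pM[] : divides p (q * v) by rewrite -E; apply: divides_refl.
  case=> w qE; have w0 : w != 0 by apply: contraNneq q0 => w0; rewrite qE w0 mul0r.
  have := size_mul w0 p0; rewrite -qE; move: w0; rewrite -size_poly_gt0; lia.
case=> w vE; have w0 : w != 0 by apply: contraNneq v0 => w0; rewrite vE w0 mul0r.
have := size_mul w0 p0; rewrite -vE; move: w0; rewrite -size_poly_gt0; lia.
Qed.

End GaussLemma.
Lemma mpoly_rmorph_ext n (R : fieldType) (S : nzRingType)
    (f g : {rmorphism {mpoly R[n]} -> S}) :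
  (forall c, f c%:MP = g c%:MP) -> (forall i, f 'X_i = g 'X_i) -> f =1 g.
Proof.
move=> fgC fgX p; rewrite [p]mpolyE !rmorph_sum; apply: eq_bigr => m _.
rewrite -mul_mpolyC !rmorphM fgC mpolyXE_id !rmorph_prod; congr (_ * _).
by apply: eq_bigr => i _; rewrite !rmorphXn fgX.
Qed.

Definition split_image (R : fieldType) n (j i : 'I_n.+1) : {poly {mpoly R[n]}} :=
  if unlift j i is Some i' then ('X_i')%:P else 'X.

HB.lock Definition msplit (R : fieldType) n (j : 'I_n.+1) :
    {mpoly R[n.+1]} -> {poly {mpoly R[n]}} :=
  mmap (polyC \o @mpolyC n R) (@split_image R n j).

HB.lock Definition mjoin (R : fieldType) n (j : 'I_n.+1) :
    {poly {mpoly R[n]}} -> {mpoly R[n.+1]} :=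
  horner_eval 'X_j \o map_poly (mmap (@mpolyC n.+1 R) (fun i => 'X_(lift j i))).

Section SplitVariable.
Variables (R : fieldType) (n : nat) (j : 'I_n.+1).
Local Notation msplit := (@msplit R n j).
Local Notation mjoin := (@mjoin R n j).
Local Notation split_image := (@split_image R n j).

Fact msplit_is_zmod_morphism : zmod_morphism msplit.
Proof. by rewrite msplit.unlock; apply: raddfB. Qed.
Fact msplit_is_monoid_morphism : monoid_morphism msplit.
Proof. by rewrite msplit.unlock; split; [apply: rmorph1|apply: rmorphM]. Qed.
HB.instance Definition _ := GRing.isZmodMorphism.Build _ _ msplit msplit_is_zmod_morphism.
HB.instance Definition _ := GRing.isMonoidMorphism.Build _ _ msplit msplit_is_monoid_morphism.

Fact mjoin_is_zmod_morphism : zmod_morphism mjoin.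
Proof. by rewrite mjoin.unlock; apply: raddfB. Qed.
Fact mjoin_is_monoid_morphism : monoid_morphism mjoin.
Proof. by rewrite mjoin.unlock; split; [apply: rmorph1|apply: rmorphM]. Qed.
HB.instance Definition _ := GRing.isZmodMorphism.Build _ _ mjoin mjoin_is_zmod_morphism.
HB.instance Definition _ := GRing.isMonoidMorphism.Build _ _ mjoin mjoin_is_monoid_morphism.

Lemma msplitC c : msplit c%:MP = (c%:MP)%:P.
Proof. by rewrite msplit.unlock mmapC. Qed.

Lemma msplitX i : msplit 'X_i = split_image i.
Proof. by rewrite msplit.unlock mmapX mmap1U. Qed.

Lemma mjoinC c : mjoin c%:P = mmap (@mpolyC n.+1 R) (fun i => 'X_(lift j i)) c.
Proof. by rewrite mjoin.unlock /= map_polyC /horner_eval hornerC. Qed.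

Lemma mjoinX : mjoin 'X = 'X_j.
Proof. by rewrite mjoin.unlock /= map_polyX /horner_eval hornerX. Qed.

Lemma msplitK : cancel msplit mjoin.
Proof.
move=> p; suff : mjoin \o msplit =1 idfun by apply.
apply: mpoly_rmorph_ext => [c|i] /=; first by rewrite msplitC mjoinC mmapC.
rewrite msplitX /split_image; case: unliftP => [i' ->|->]; last exact: mjoinX.
by rewrite mjoinC mmapX mmap1U.
Qed.

Lemma mjoinK : cancel mjoin msplit.
Proof.
have H c : msplit (mjoin c%:P) = c%:P.
  suff : msplit \o (mjoin \o polyC) =1 @polyC _ by apply.
  apply: mpoly_rmorph_ext => [d|i] /=; first by rewrite mjoinC mmapC msplitC.
  by rewrite mjoinC mmapX mmap1U msplitX /split_image liftK.
move=> p; rewrite -[p]coefK poly_def !rmorph_sum; apply: eq_bigr => i _.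
rewrite -mul_polyC !rmorphM /= H !rmorphXn /= mjoinX msplitX /split_image.
by rewrite unlift_none.
Qed.

Lemma meval_msplit (x : 'I_n.+1 -> R) p :
  p.@[x] = (map_poly (meval (x \o lift j)) (msplit p)).[x j].
Proof.
suff : meval x =1 (horner_eval (x j) \o map_poly (meval (x \o lift j))) \o msplit.
  by move/(_ p).
apply: mpoly_rmorph_ext => [c|i] /=.
  by rewrite msplitC map_polyC /horner_eval hornerC /= !mevalC.
rewrite msplitX /split_image mevalXU; case: unliftP => [i' ->|->].
  by rewrite map_polyC /horner_eval hornerC /= mevalXU.
by rewrite map_polyX /horner_eval hornerX.
Qed.

End SplitVariable.

Lemma msplit_unit (K : fieldType) n j (a : {mpoly K[n.+1]}) :
  msplit j a \is a GRing.unit -> a \is a GRing.unit.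
Proof.
case/unitrPr => b ab; apply/unitrPr; exists (mjoin j b).
by rewrite -{1}[a](msplitK j) -rmorphM ab rmorph1.
Qed.

Lemma prime_elt_iso (A B : idomainType) (f : A -> B) (g : B -> A) b :
  {morph f : x y / x * y} -> {morph g : x y / x * y} -> f 1 = 1 -> g 0 = 0 -> f 0 = 0 ->
  cancel f g -> cancel g f -> prime_elt b -> prime_elt (g b).
Proof.
move=> fM gM f1 g0 f0 fK gK [b0 bu bM]; split.
- by apply: contraNneq b0 => gb; rewrite -[b]gK gb f0.
- apply: contra bu => /unitrPr[c bc]; apply/unitrPr; exists (f c).
  by rewrite -[b]gK -fM bc f1.
have D a : divides b (f a) -> divides (g b) a.
  by case=> c E; exists (g c); rewrite -gM -E fK.
move=> a c [d E]; have /bM[/D|/D] : divides b (f a * f c) by exists (f d); rewrite -fM E fM gK.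
  by left.
by right.
Qed.

Lemma mjoin_prime (K : fieldType) n (j : 'I_n.+1) (p : {poly {mpoly K[n]}}) :
  prime_elt p -> prime_elt (mjoin j p).
Proof.
move=> pP; apply: (@prime_elt_iso _ _ (msplit j) (mjoin j)) pP.
- exact: (rmorphM (msplit j)).
- exact: (rmorphM (mjoin j)).
- exact: (rmorph1 (msplit j)).
- exact: (rmorph0 (mjoin j)).
- exact: (rmorph0 (msplit j)).
- exact: msplitK.
- exact: mjoinK.
Qed.

Lemma msplit_prime (K : fieldType) n (j : 'I_n.+1) (p : {mpoly K[n.+1]}) :
  prime_elt p -> prime_elt (msplit j p).
Proof.
move=> pP; apply: (@prime_elt_iso _ _ (mjoin j) (msplit j)) pP.
- exact: (rmorphM (mjoin j)).
- exact: (rmorphM (msplit j)).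
- exact: (rmorph1 (mjoin j)).
- exact: (rmorph0 (msplit j)).
- exact: (rmorph0 (mjoin j)).
- exact: mjoinK.
- exact: msplitK.
Qed.

Lemma mpoly_const_unit (K : fieldType) n (c : K) : c != 0 -> (c%:MP_[n]) \is a GRing.unit.
Proof. by move=> c0; apply/unitrPr; exists (c^-1)%:MP; rewrite -mpolyCM mulfV. Qed.

Lemma mpoly_unit_const (K : fieldType) n (p : {mpoly K[n]}) : p \is a GRing.unit ->
  exists2 c, c != 0 & p = c%:MP.
Proof.
move=> pu; apply/msize_poly1P/eqP.
have p0 : p != 0 by apply: contraTneq pu => ->; rewrite unitr0.
have q0 : p^-1 != 0 by rewrite invr_eq0.
have := msizeM p0 q0; rewrite mulrV // msize1.
move: p0 q0; rewrite -!msize_poly_eq0.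
by case: (msize p) => // a; case: (msize p^-1) => // b _ _ /eqP; lia.
Qed.

(** [(msize p).-1] is the total degree; it serves as [delta] when the Gauss argument is applied to
    polynomial coefficients. *)
Lemma mpoly_deltaM (K : fieldType) n (p q : {mpoly K[n]}) : p != 0 -> q != 0 ->
  (msize (p * q)).-1 = ((msize p).-1 + (msize q).-1)%N.
Proof.
move=> p0 q0; rewrite msizeM //; move: p0 q0; rewrite -!msize_poly_eq0.
by case: (msize p) => // a; case: (msize q) => //= b; rewrite addnS.
Qed.

Lemma mpoly_delta_unit (K : fieldType) n (p : {mpoly K[n]}) : p != 0 ->
  (msize p).-1 = 0%N -> p \is a GRing.unit.
Proof.
rewrite -msize_poly_eq0 => p0 p1.
have /eqP/msize_poly1P[c c0 ->] : msize p = 1%N by case: (msize p) p0 p1 => // a _ /= ->.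
exact: mpoly_const_unit.
Qed.

Lemma mpoly_has_prime_divisors (K : fieldType) n : has_prime_divisors {mpoly K[n]}.
Proof.
elim: n => [|n IH].
  move=> a; rewrite [a]nvar0_mpolyC mpolyC_eq0 => a0; by rewrite mpoly_const_unit.
move=> a a0 au.
have a0' : msplit ord0 a != 0 by apply: contraNneq a0 => a0; rewrite -[a](msplitK ord0) a0 rmorph0.
have au' : msplit ord0 a \isn't a GRing.unit.
  by apply: contra au; apply: msplit_unit.
have [p pP D] := poly_has_prime_divisors (@mpoly_deltaM K n) (@mpoly_delta_unit K n) IH a0' au'.
exists (mjoin ord0 p); first exact: mjoin_prime.
by case: D => c E; exists (mjoin ord0 c); rewrite -[a](msplitK ord0) E rmorphM.
Qed.

(** * Zero sets over an algebraically closed field *)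

Definition alg_closed (K : fieldType) :=
  forall p : {poly K}, size p != 1%N -> exists x, root p x.

Section InfiniteField.
Variable K : fieldType.
Hypothesis Kclosed : alg_closed K.

(** Any root of [p - 1] avoids the roots of [p]. *)
Lemma alg_closed_nonroot (p : {poly K}) : p != 0 -> exists x, ~~ root p x.
Proof.
move=> p0; have [/eqP/size_poly1P[c c0 ->]|sp] := eqVneq (size p) 1%N.
  by exists 0; rewrite rootC.
have [|x] := @Kclosed (p - 1).
  rewrite size_polyDl // size_polyN size_polyC oner_eq0 /=.
  by move: p0 sp; rewrite -size_poly_gt0; case: (size p) => // -[].
by rewrite /root hornerD hornerN hornerC subr_eq0 => /eqP px; exists x; rewrite px oner_eq0.
Qed.

Lemma poly_eval_eq0 (p : {poly K}) : (forall x, p.[x] = 0) -> p = 0.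
Proof.
by move=> H; apply/eqP; apply: contraT => /alg_closed_nonroot[x]; rewrite /root H eqxx.
Qed.

Lemma mpoly_eval_eq0 n (p : {mpoly K[n]}) : (forall x, p.@[x] = 0) -> p = 0.
Proof.
elim: n p => [|n IH] p H.
  by have := H (fun _ => 0); rewrite [p]nvar0_mpolyC mevalC => ->.
apply: (can_inj (msplitK ord0)); rewrite rmorph0; apply/polyP => i; rewrite coef0.
apply: IH => x; rewrite -(coef_map (meval x)) /=.
suff -> : map_poly (meval x) (msplit ord0 p) = 0 by rewrite coef0.
apply: poly_eval_eq0 => t.
pose y (i : 'I_n.+1) := if unlift ord0 i is Some i' then x i' else t.
have := H y; rewrite (meval_msplit ord0) {2}/y unlift_none.
congr (_ = 0); congr (_.[_]); apply: eq_map_poly => q; apply: meval_eq => k.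
by rewrite /= /y liftK.
Qed.

Lemma mpoly_eval_inj n (p q : {mpoly K[n]}) : (forall x, p.@[x] = q.@[x]) -> p = q.
Proof.
move=> H; apply/eqP; rewrite -subr_eq0; apply/eqP/mpoly_eval_eq0 => x.
by rewrite mevalB H subrr.
Qed.

Lemma mpoly_eval_neq0 n (p : {mpoly K[n]}) : p != 0 -> exists x, p.@[x] != 0.
Proof.
move=> p0; apply: NNPP => H; case/eqP: p0; apply: mpoly_eval_eq0 => x.
by apply/eqP; apply: contra_notT H => px; exists x.
Qed.

(** The coordinates of a point are set to 0 one after the other, none of which changes the value of
    [p]. *)
Lemma mpoly_const_in_vars n (p : {mpoly K[n.+1]}) :
  (forall j, (size (msplit j p) <= 1)%N) -> exists c, p = c%:MP.
Proof.
move=> H; exists (p.@[fun _ => 0]); apply: mpoly_eval_inj => x; rewrite mevalC.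
pose y k (i : 'I_n.+1) := if (i < k)%N then 0 else x i.
have E k : (k <= n.+1)%N -> p.@[x] = p.@[y k].
  elim: k => [|k IH] kn; first by apply: meval_eq => i.
  rewrite IH ?(ltnW kn) //; pose j := Ordinal kn.
  rewrite !(meval_msplit j) (size1_polyC (H j)) !map_polyC !hornerC /=.
  apply: meval_eq => i; rewrite /y /=; congr (if _ then _ else _).
  rewrite ltnS [in RHS]leq_eqVlt; case: eqP => //= E.
  by case/negP: (neq_lift j i); apply/eqP/val_inj => /=; rewrite E.
by rewrite (E n.+1) //; apply: meval_eq => i; rewrite /y ltn_ord.
Qed.

Lemma prime_elt_var n (p : {mpoly K[n]}) : prime_elt p -> (0 < n)%N.
Proof.
case: n p => // p [p0 pu _]; case/negP: pu; rewrite [p]nvar0_mpolyC mpoly_const_unit //.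
by rewrite -(@mpolyC_eq0 0) -nvar0_mpolyC.
Qed.

Lemma prime_elt_dep n (p : {mpoly K[n.+1]}) : prime_elt p -> exists j, (1 < size (msplit j p))%N.
Proof.
case=> p0 pu _; apply: NNPP => H; have [|c pE] := @mpoly_const_in_vars n p.
  by move=> j; rewrite leqNgt; apply/negP => s; apply: H; exists j.
by case/negP: pu; rewrite pE mpoly_const_unit // -(@mpolyC_eq0 n.+1) -pE.
Qed.

(* Eliminating a variable on which [p] depends from [p] and [q] would leave a
   nonzero polynomial vanishing on the projection of the zero set of [p]. *)
Lemma prime_nullstellensatz n (p q : {mpoly K[n]}) : prime_elt p ->
  (forall x, p.@[x] = 0 -> q.@[x] = 0) -> divides p q.
Proof.
move=> pP; have := prime_elt_var pP; case: n p q pP => // n p q pP _ H.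
have [j sp] := prime_elt_dep pP.
apply: NNPP => npq.
have pP' := msplit_prime j pP.
have [a [b [d [d0 E]]]] : exists a b (d : {mpoly K[n]}),
    d != 0 /\ d%:P = a * msplit j p + b * msplit j q.
  apply: (bezout_prime (@mpoly_deltaM K n) (@mpoly_delta_unit K n)
    (@mpoly_has_prime_divisors K n) pP' sp).
  by case=> c E; apply: npq; exists (mjoin j c); rewrite -[q](msplitK j) E rmorphM /= msplitK.
(* A point where neither the eliminant [d] nor the leading coefficient vanishes: there the
   specialized [p] keeps its degree and so has a root, at which the Bezout identity would give d =
   0. *)
have l0 : d * lead_coef (msplit j p) != 0.
  by rewrite mulf_neq0 // lead_coef_eq0 -size_poly_gt0; apply: leq_trans sp.
have [x] := mpoly_eval_neq0 l0; rewrite mevalM mulf_eq0 negb_or => /andP[dx lx].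
have [t] : exists t, root (map_poly (meval x) (msplit j p)) t.
  apply: Kclosed.
  by rewrite size_map_poly_id0 //; rewrite gtn_eqF.
rewrite /root => /eqP pt.
pose y (i : 'I_n.+1) := if unlift j i is Some i' then x i' else t.
have ev u : u.@[y] = (map_poly (meval x) (msplit j u)).[t].
  rewrite (meval_msplit j) {2}/y unlift_none.
  congr (_.[_]); apply: eq_map_poly => v; apply: meval_eq => k.
  by rewrite /= /y liftK.
have qt : (map_poly (meval x) (msplit j q)).[t] = 0 by rewrite -ev H // ev.
move/(congr1 (fun u => (map_poly (meval x) u).[t])): E.
rewrite rmorphD !rmorphM /= hornerD !hornerM pt qt !mulr0 addr0.
by rewrite map_polyC hornerC /= => dx0; rewrite dx0 eqxx in dx.
Qed.

End InfiniteField.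

(** * Chains of irreducible closed sets *)

Lemma linear_dependence (K : fieldType) (I J : finType) (a : I -> J -> K) :
  (#|J| < #|I|)%N ->
  exists v : I -> K, (exists i, v i != 0) /\ forall j, \sum_i v i * a i j = 0.
Proof.
move=> JI; pose A := \matrix_(i < #|I|, j < #|J|) a (enum_val i) (enum_val j).
have : kermx A != 0.
  rewrite -mxrank_eq0 mxrank_ker subn_eq0 -ltnNge; apply: leq_ltn_trans JI; exact: rank_leq_col.
case/rowV0Pn => v /sub_kermxP vA v0; have [k vk] : exists k, v 0 k != 0.
  apply: NNPP => H; case/eqP: v0; apply/rowP => k; rewrite mxE.
  by apply/eqP; apply: contra_notT H => ?; exists k.
exists (fun i => v 0 (enum_rank i)); split; first by exists (enum_val k); rewrite enum_valK.
move=> j; have /rowP/(_ (enum_rank j)) := vA; rewrite !mxE => E; rewrite -[RHS]E.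
rewrite [LHS](reindex (@enum_val I predT)) /=; last first.
  by apply: onW_bij; exists enum_rank; [exact: enum_valK|exact: enum_rankK].
apply: eq_bigr => i _; by rewrite mxE enum_valK enum_rankK.
Qed.

HB.lock Definition msubst (R : fieldType) a b (y : 'I_a -> {mpoly R[b]}) :
  {mpoly R[a]} -> {mpoly R[b]} := mmap (@mpolyC b R) y.

Section Substitution.
Variables (R : fieldType) (a b : nat) (y : 'I_a -> {mpoly R[b]}).
Local Notation msubst := (msubst y).
Fact msubst_is_zmod_morphism : zmod_morphism msubst.
Proof. by rewrite msubst.unlock; apply: raddfB. Qed.
Fact msubst_is_monoid_morphism : monoid_morphism msubst.
Proof. by rewrite msubst.unlock; split; [apply: rmorph1|apply: rmorphM]. Qed.
HB.instance Definition _ := GRing.isZmodMorphism.Build _ _ msubst msubst_is_zmod_morphism.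
HB.instance Definition _ := GRing.isMonoidMorphism.Build _ _ msubst msubst_is_monoid_morphism.
Lemma msubstC c : msubst c%:MP = c%:MP. Proof. by rewrite msubst.unlock mmapC. Qed.
Lemma msubstX i : msubst 'X_i = y i. Proof. by rewrite msubst.unlock mmapX mmap1U. Qed.
Lemma msubst_mon m : msubst 'X_[m] = \prod_i y i ^+ m i. Proof. by rewrite msubst.unlock mmapX. Qed.
Lemma msubstZ c p : msubst (c *: p) = c *: msubst p.
Proof. by rewrite -mul_mpolyC rmorphM /= msubstC mul_mpolyC. Qed.
Lemma meval_msubst x p : (msubst p).@[x] = p.@[fun i => (y i).@[x]].
Proof.
suff : meval x \o msubst =1 meval (fun i => (y i).@[x]) by apply.
by apply: mpoly_rmorph_ext => [c|i] /=; rewrite (msubstC, msubstX) ?mevalC // mevalXU.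
Qed.
End Substitution.

Record is_ideal (R : comNzRingType) (Q : pset R) : Prop := IsIdeal {
  ideal0 : Q 0;
  idealD : forall a b, Q a -> Q b -> Q (a + b);
  idealM : forall a b, Q b -> Q (a * b) }.

Record is_prime (R : comNzRingType) (Q : pset R) : Prop := IsPrime {
  prime_ideal :> is_ideal Q;
  prime_proper : ~ Q 1;
  primeM : forall a b, Q (a * b) -> Q a \/ Q b }.

Lemma idealN (R : comNzRingType) (Q : pset R) a : is_ideal Q -> Q a -> Q (- a).
Proof. by move=> QI Qa; rewrite -mulN1r; apply: idealM. Qed.

Lemma idealB (R : comNzRingType) (Q : pset R) a b : is_ideal Q -> Q a -> Q b -> Q (a - b).
Proof. by move=> QI Qa Qb; apply: idealD => //; apply: idealN. Qed.

Lemma ideal_sum (R : comNzRingType) (Q : pset R) (I : Type) (r : seq I) (P : pred I) (F : I -> R) :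
  is_ideal Q -> (forall i, P i -> Q (F i)) -> Q (\sum_(i <- r | P i) F i).
Proof. by move=> QI H; apply: (big_ind Q); [exact: ideal0|exact: idealD|]. Qed.

Lemma zero_is_prime (R : idomainType) : is_prime (fun a : R => a = 0).
Proof.
split; first split => // [a b -> ->|a b ->]; rewrite ?addr0 ?mulr0 //.
  by move/eqP; rewrite oner_eq0.
by move=> a b /eqP; rewrite mulf_eq0 => /orP[/eqP|/eqP]; [left|right].
Qed.

(** * Transcendence degree of residue rings *)

Section Height.
Variable K : fieldType.

Definition alg_indep n (Q : pset {mpoly K[n]}) l (y : 'I_l -> {mpoly K[n]}) :=
  forall g : {mpoly K[l]}, Q (msubst y g) -> g = 0.

(* The residue ring modulo [Q] has transcendence degree at least [l]. *)
Definition trdeg_ge n (Q : pset {mpoly K[n]}) l := exists y, @alg_indep n Q l y.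

Lemma trdeg_ge0 n (Q : pset {mpoly K[n]}) : is_ideal Q -> ~ Q 1 -> trdeg_ge Q 0.
Proof.
move=> QI Q1; exists (fun _ => 0) => g; rewrite [g]nvar0_mpolyC msubstC => Qg.
apply/eqP; rewrite mpolyC_eq0; apply: contra_notT Q1 => c0.
by rewrite -mpolyC1 -(mulVf c0) mpolyCM; apply: (idealM QI).
Qed.

(** An element [x] of [Q'] outside [Q] can be added to an independent family modulo [Q']. In a
    relation s(x) in [Q] the constant coefficient lies in [Q'], so it is zero; as [Q] is prime, a
    factor [x] can be cancelled and the argument repeated. *)
Lemma trdeg_geS n (Q Q' : pset {mpoly K[n]}) x l : is_prime Q -> is_ideal Q' ->
  psubset Q Q' -> Q' x -> ~ Q x -> trdeg_ge Q' l -> trdeg_ge Q l.+1.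
Proof.
move=> QP QI' QQ' Q'x nQx [y yI].
pose z (i : 'I_l.+1) := if unlift ord0 i is Some k then y k else x.
have key (s : {poly {mpoly K[l]}}) : Q (map_poly (msubst y) s).[x] -> s = 0.
  elim/poly_ind: s => // s c IH.
  rewrite rmorphD rmorphM /= map_polyX map_polyC hornerD hornerM hornerX hornerC /= => H.
  have c0 : c = 0.
    apply: yI; rewrite -[X in Q' X](addKr ((map_poly (msubst y) s).[x] * x)).
    exact: (idealD QI' (idealN QI' (idealM QI' _ Q'x)) (QQ' _ H)).
  move: H; rewrite c0 rmorph0 addr0 => /(primeM QP)[/IH -> //|//].
  by rewrite mul0r add0r.
exists z => g Qg; apply: (can_inj (msplitK ord0)); rewrite rmorph0; apply: key.
suff <- : msubst z g = (map_poly (msubst y) (msplit ord0 g)).[x] by [].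
suff : msubst z =1 (horner_eval x \o map_poly (msubst y)) \o msplit ord0 by apply.
apply: mpoly_rmorph_ext => [c|i] /=.
  by rewrite msplitC map_polyC /horner_eval hornerC /= !msubstC.
rewrite msplitX /split_image msubstX /z; case: unliftP => [i' _|_].
  by rewrite map_polyC /horner_eval hornerC /= msubstX.
by rewrite map_polyX /horner_eval hornerX.
Qed.

Lemma mpoly_deltaM_le n (p q : {mpoly K[n]}) :
  ((msize (p * q)).-1 <= (msize p).-1 + (msize q).-1)%N.
Proof.
have [->|p0] := eqVneq p 0; first by rewrite mul0r msize0.
have [->|q0] := eqVneq q 0; first by rewrite mulr0 msize0.
by rewrite mpoly_deltaM.
Qed.

Lemma mpoly_deltaX_le n (p : {mpoly K[n]}) k : ((msize (p ^+ k)).-1 <= k * (msize p).-1)%N.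
Proof.
elim: k => [|k IH]; first by rewrite expr0 msize1.
by rewrite exprS mulSn; apply: leq_trans (mpoly_deltaM_le _ _) _; rewrite leq_add2l.
Qed.

Lemma mpoly_delta_prod_le n (I : finType) (F : I -> {mpoly K[n]}) :
  ((msize (\prod_i F i)).-1 <= \sum_i (msize (F i)).-1)%N.
Proof.
elim/big_rec2: _ => [|i a q _ IH]; first by rewrite msize1.
by apply: leq_trans (mpoly_deltaM_le _ _) _; rewrite leq_add2l.
Qed.

(** A dimension count: with l > n there are more monomials in the [y i] with exponents at most [t]
    than monomials that can occur in their expansions. *)
Lemma trdeg_le n l (y : 'I_l -> {mpoly K[n]}) :
  (forall g : {mpoly K[l]}, msubst y g = 0 -> g = 0) -> (l <= n)%N.
Proof.
move=> yI; rewrite leqNgt; apply/negP => nl.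
(* The expansions have degree at most D = t e, so they live in a space of dimension at most (D +
   1)^n <= ((e + 1)(t + 1))^n = t (t + 1)^n by the choice of [t], which is less than (t + 1)^(n +
   1). *)
pose e := (\sum_i (msize (y i)).-1)%N.
pose t := ((e + 1) ^ n)%N.
pose D := (t * e)%N.
pose mA (f : {ffun 'I_l -> 'I_t.+1}) := [multinom (f i : nat) | i < l].
pose mB (f : {ffun 'I_n -> 'I_D.+1}) := [multinom (f i : nat) | i < n].
have [|v [[f0 vf0] vE]] := @linear_dependence K {ffun 'I_l -> 'I_t.+1} {ffun 'I_n -> 'I_D.+1}
  (fun f g => (msubst y 'X_[mA f])@_(mB g)).
  rewrite !card_ffun !card_ord.
  apply: (@leq_ltn_trans (((e + 1) * t.+1) ^ n)).
    by case: (n) => [|n'] //; rewrite leq_exp2r // /D; lia.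
  rewrite expnMn -/t; apply: (@leq_trans (t.+1 ^ n.+1)); last by rewrite leq_pexp2l.
  by rewrite expnS ltn_pmul2r // expn_gt0.
pose g := \sum_f v f *: 'X_[mA f].
have mAinj : injective mA.
  move=> f1 f2 /mnmP E; apply/ffunP => i; apply: val_inj; by have := E i; rewrite !mnmE.
have g0 : g = 0.
  apply: yI; apply/mpolyP => m; rewrite mcoeff0 /g rmorph_sum /= raddf_sum /=.
  have [mD|mD] := leqP (mdeg m) D.
    have mi i : (m i < D.+1)%N.
      by rewrite ltnS; apply: leq_trans mD; rewrite mdegE (bigD1 i) //= leq_addr.
    have mE : m = mB [ffun i => Ordinal (mi i)] by apply/mnmP => i; rewrite mnmE ffunE.
    rewrite -[RHS](vE [ffun i => Ordinal (mi i)]) -mE; apply: eq_bigr => f _.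
    by rewrite msubstZ mcoeffZ.
  rewrite big1 // => f _; rewrite msubstZ mcoeffZ memN_msupp_eq0 ?mulr0 //.
  apply: contraL mD => /msize_mdeg_lt; rewrite -leqNgt => mD.
  have : (mdeg m <= (msize (msubst y 'X_[mA f])).-1)%N by move: mD; case: (msize _).
  move=> /leq_trans; apply; rewrite msubst_mon; apply: leq_trans (mpoly_delta_prod_le _) _.
  rewrite /D /e big_distrr /=; apply: leq_sum => i _; apply: leq_trans (mpoly_deltaX_le _ _) _.
  by rewrite leq_mul2r mnmE -ltnS ltn_ord orbT.
case/eqP: vf0; have /mpolyP/(_ (mA f0)) := g0; rewrite mcoeff0 /g raddf_sum /=.
rewrite (bigD1 f0) //= big1 => [|f ff0]; first by rewrite addr0 mcoeffZ mcoeffX eqxx mulr1.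
by rewrite mcoeffZ mcoeffX (inj_eq mAinj) (negbTE ff0) mulr0.
Qed.

Lemma trdeg_ge_le n (Q : pset {mpoly K[n]}) l : is_ideal Q -> trdeg_ge Q l -> (l <= n)%N.
Proof. by move=> QI [y yI]; apply: (@trdeg_le _ _ y) => g g0; apply: yI; rewrite g0; apply: ideal0. Qed.

End Height.

Section Chains.
Variables (T : Type) (closed : pset T -> Prop).

Lemma has_chain_mono (S S' : pset T) l : psubset S S' -> has_chain closed S l -> has_chain closed S' l.
Proof.
move=> SS' [Z [H1 H2]]; exists Z; split => // i il; have [a b c] := H1 i il.
by split=> // x /c /SS'.
Qed.

Lemma has_chain_le (S : pset T) l l' : (l' <= l)%N -> has_chain closed S l -> has_chain closed S l'.
Proof.
move=> ll' [Z [H1 H2]]; exists Z; split=> i il; first by apply: H1; apply: leq_trans ll'.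
by apply: H2; apply: leq_trans ll'.
Qed.

Lemma has_chainS (S S' Z : pset T) l : has_chain closed S l -> psubset S Z ->
  closed Z -> irreducible closed Z -> ~ psubset Z S -> psubset Z S' -> has_chain closed S' l.+1.
Proof.
move=> [Y [H1 H2]] SZ Zc Zi ZS ZS'.
exists (fun i => if (i <= l)%N then Y i else Z); split=> i il.
  case: ifP => // il'; have [a b c] := H1 i il'; split=> // x /c /SZ /ZS' //.
rewrite -ltnS il; case: ifP => il'; first exact: H2.
have -> : i = l by lia.
have [_ _ c] := H1 l (leqnn l); split; first by move=> x /c /SZ.
by move=> H; apply: ZS => x /H /c.
Qed.

Lemma has_chain0 (Z S : pset T) : closed Z -> irreducible closed Z -> psubset Z S -> has_chain closed S 0.
Proof. by move=> a b c; exists (fun _ => Z); split. Qed.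
End Chains.

Section AffineSets.
Variable K : fieldType.
Hypothesis Kclosed : alg_closed K.

Lemma vanish_ideal n (S : pset ('I_n -> K)) : is_ideal (vanish S).
Proof.
split=> [x _|p q Hp Hq x Sx|p q Hq x Sx]; first by rewrite meval0.
  by rewrite mevalD Hp // Hq // addr0.
by rewrite mevalM Hq // mulr0.
Qed.

Lemma vanish_proper n (S : pset ('I_n -> K)) : (exists x, S x) -> ~ vanish S 1.
Proof. by case=> x Sx /(_ x Sx) /eqP; rewrite meval1 oner_eq0. Qed.

Lemma aclosed_zeros n (p : {mpoly K[n]}) : aclosed (fun x => p.@[x] = 0).
Proof. by exists (fun q => q = p) => x; split=> [H q ->|]; last apply. Qed.

Lemma aclosed_sep n (S : pset ('I_n -> K)) x : aclosed S -> ~ S x ->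
  exists2 p, vanish S p & p.@[x] != 0.
Proof.
move=> [P HP] nSx; apply: NNPP => H; apply: nSx; apply/HP => p Pp.
apply/eqP; apply: contra_notT H => px; exists p => // z /HP; exact.
Qed.

Lemma irreducible_prime n (S : pset ('I_n -> K)) : aclosed S -> irreducible (@aclosed K n) S ->
  is_prime (vanish S).
Proof.
move=> Sc [Sn Si]; split; [exact: vanish_ideal|exact: vanish_proper|].
move=> p q pq; apply: (Si (fun x => p.@[x] = 0) (fun x => q.@[x] = 0)); try exact: aclosed_zeros.
move=> x /pq; rewrite mevalM => /eqP; rewrite mulf_eq0 => /orP[/eqP|/eqP]; by [left|right].
Qed.

Lemma prime_irreducible n (S : pset ('I_n -> K)) : (exists x, S x) ->
  (forall p q, vanish S (p * q) -> vanish S p \/ vanish S q) -> irreducible (@aclosed K n) S.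
Proof.
move=> Sn Sp; split=> // A B Ac Bc AB.
case: (classic (psubset S A)) => [|nA]; [by left|right=> x Sx].
apply: NNPP => nBx; have [q qB qx] := aclosed_sep Bc nBx.
apply: nA => z Sz; apply: NNPP => nAz; have [p pA pz] := aclosed_sep Ac nAz.
have [w|H|H] := Sp p q.
- by rewrite mevalM => /AB[/pA|/qB] ->; rewrite ?mul0r ?mulr0.
- by rewrite H ?eqxx in pz.
- by rewrite H ?eqxx in qx.
Qed.

(** Along the chain the vanishing ideals strictly decrease, and each step adds one independent
    element by [trdeg_geS]. *)
Lemma chain_trdeg n (S : pset ('I_n -> K)) l : has_chain (@aclosed K n) S l ->
  exists Z, [/\ aclosed Z, irreducible (@aclosed K n) Z, psubset Z S & trdeg_ge (vanish Z) l].
Proof.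
case=> Z [H1 H2].
suff H i : (i <= l)%N -> trdeg_ge (vanish (Z i)) i.
  by have [a b c] := H1 l (leqnn l); exists (Z l); split=> //; apply: H.
elim: i => [|i IH] il.
  have [_ [Zn _] _] := H1 0%N isT.
  by apply: trdeg_ge0; [exact: vanish_ideal|exact: vanish_proper].
have [a b c] := H1 _ il; have [a' b' c'] := H1 _ (ltnW il).
have [ZZ nZZ] := H2 i il.
have [x [Zx nZx]] : exists x, Z i.+1 x /\ ~ Z i x.
  by apply: NNPP => H; apply: nZZ => x Zx; apply: NNPP => nx; apply: H; exists x.
have [p pZ px] := aclosed_sep a' nZx.
apply: (@trdeg_geS _ _ _ (vanish (Z i)) p); [exact: irreducible_prime|exact: vanish_ideal| | | |].
- by move=> q qZ z /ZZ /qZ.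
- by [].
- by move/(_ x Zx) => E; rewrite E eqxx in px.
- by apply: IH; apply: ltnW.
Qed.

Lemma chain_le n (S : pset ('I_n -> K)) l : has_chain (@aclosed K n) S l -> (l <= n)%N.
Proof. by move/chain_trdeg => [Z [_ _ _ H]]; apply: trdeg_ge_le H; apply: vanish_ideal. Qed.

(** The zero ideal lies strictly inside the vanishing ideal of any subset of [S], which leaves room
    for one more independent element. *)
Lemma hypersurface_chain_lt n (S : pset ('I_n -> K)) l (p : {mpoly K[n]}) : p != 0 -> vanish S p ->
  has_chain (@aclosed K n) S l -> (l < n)%N.
Proof.
move=> p0 pS /chain_trdeg [Z [_ _ ZS H]].
have := trdeg_geS (zero_is_prime _) (vanish_ideal Z) _ _ _ H => /(_ p) H'.
apply: (trdeg_ge_le (zero_is_prime {mpoly K[n]})); apply: H' => //.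
- by move=> q -> x _; rewrite meval0.
- by move=> x /ZS /pS.
- exact/eqP.
Qed.

Definition mpt a b (y : 'I_b -> {mpoly K[a]}) (x : 'I_a -> K) : 'I_b -> K := fun i => (y i).@[x].

Lemma meval_mpt a b (y : 'I_b -> {mpoly K[a]}) x p : p.@[mpt y x] = (msubst y p).@[x].
Proof. by rewrite meval_msubst. Qed.

(** The vanishing ideal of the image is the kernel of a ring morphism into a domain. *)
Lemma image_irreducible a b (y : 'I_b -> {mpoly K[a]}) :
  irreducible (@aclosed K b) (fun x => exists z, x = mpt y z).
Proof.
apply: prime_irreducible; first by exists (mpt y (fun _ => 0)), (fun _ => 0).
have H p : vanish (fun x => exists z, x = mpt y z) p <-> msubst y p = 0.
  split=> [H|H x [z ->]]; last by rewrite meval_mpt H meval0.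
  by apply: (mpoly_eval_eq0 Kclosed) => z; rewrite -meval_mpt; apply: H; exists z.
move=> p q /H /eqP; rewrite rmorphM mulf_eq0 => /orP[/eqP|/eqP] E; [left|right]; exact/H.
Qed.

Lemma aclosed_preimage a b (y : 'I_b -> {mpoly K[a]}) (S : pset ('I_b -> K)) :
  aclosed S -> aclosed (fun x => S (mpt y x)).
Proof.
case=> P HP; exists (fun q => exists2 p, P p & q = msubst y p) => x; rewrite HP.
split=> [H q [p Pp ->]|H p Pp]; first by rewrite -meval_mpt H.
by rewrite meval_mpt; apply: H; exists p.
Qed.

Lemma affine_space_chain n : has_chain (@aclosed K n) (fun _ => True) n.
Proof.
pose y k (i : 'I_n) : {mpoly K[n]} := if (i < k)%N then 'X_i else 0.
pose Z k := fun x => exists z, x = mpt (y k) z.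
have ZE k x : Z k x <-> forall i : 'I_n, (k <= i)%N -> x i = 0.
  split=> [[z ->] i|H]; first by rewrite leqNgt /mpt /y => /negbTE ->; rewrite meval0.
  exists x; apply: functional_extensionality => i; rewrite /mpt /y.
  by case: ltnP => [ik|/H ->]; rewrite ?meval0 // mevalXU.
exists Z; split=> k kn.
  split => //; last exact: image_irreducible.
  exists (fun p => exists2 i : 'I_n, (k <= i)%N & p = 'X_i) => x; rewrite ZE.
  split=> [H p [i ki ->]|H i ki]; first by rewrite mevalXU H.
  by rewrite -[x i]mevalXU; apply: H; exists i.
split=> [x /ZE H|H]; first by apply/ZE => i /ltnW; apply: H.
have /H/ZE : Z k.+1 (fun i => (i == k :> nat)%:R).
  by apply/ZE => i ki; rewrite gtn_eqF.
by move/(_ (Ordinal kn) (leqnn k)) => /eqP; rewrite eqxx oner_eq0.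
Qed.

Section ClosedEmbedding.
Variables (a b : nat) (theta : 'I_b -> {mpoly K[a]}) (rho : 'I_a -> {mpoly K[b]}).
Hypothesis thetaK : forall x, mpt rho (mpt theta x) = x.

(** The image of [Z] under [theta], written with the retraction [rho] so that it is visibly given by
    equations. It moves chains between affine space and a graph over it. *)
Definition graph_image (Z : pset ('I_a -> K)) : pset ('I_b -> K) :=
  fun x => Z (mpt rho x) /\ x = mpt theta (mpt rho x).

Lemma graph_imageE Z x : graph_image Z (mpt theta x) <-> Z x.
Proof. by rewrite /graph_image !thetaK; split=> [[]|]. Qed.

Lemma aclosed_graph_image Z : aclosed Z -> aclosed (graph_image Z).
Proof.
move=> /(aclosed_preimage rho) [P HP].
exists (fun q => P q \/ exists i, q = 'X_i - msubst rho (theta i)) => x; split.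
  case=> /HP ZP E p [|[i ->]]; first exact: ZP.
  by rewrite mevalB mevalXU -meval_mpt {1}E subrr.
move=> H; split; first by apply/HP => p Pp; apply: H; left.
apply: functional_extensionality => i.
have : ('X_i - msubst rho (theta i)).@[x] = 0 by apply: H; right; exists i.
by rewrite mevalB mevalXU -meval_mpt => /eqP; rewrite subr_eq0 => /eqP.
Qed.

Lemma graph_image_irreducible Z : irreducible (@aclosed K a) Z ->
  irreducible (@aclosed K b) (graph_image Z).
Proof.
case=> [[z Zz] Zi]; split; first by exists (mpt theta z); apply/graph_imageE.
move=> A B Ac Bc AB.
have [x Zx|H|H] := Zi _ _ (aclosed_preimage theta Ac) (aclosed_preimage theta Bc).
- by apply: AB; apply/graph_imageE.
- by left=> x [Zx ->]; apply: H.
- by right=> x [Zx ->]; apply: H.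
Qed.

Lemma preimage_irreducible S : psubset S (fun x => x = mpt theta (mpt rho x)) ->
  irreducible (@aclosed K b) S -> irreducible (@aclosed K a) (fun x => S (mpt theta x)).
Proof.
move=> Sg [[s Ss] Si]; split; first by exists (mpt rho s); rewrite -Sg.
move=> A B Ac Bc AB.
have [x Sx|H|H] := Si _ _ (aclosed_graph_image Ac) (aclosed_graph_image Bc).
- have := AB (mpt rho x); rewrite -(Sg _ Sx) => /(_ Sx)[H|H]; [left|right]; split=> //; exact: Sg.
- by left=> x /H /graph_imageE.
- by right=> x /H /graph_imageE.
Qed.

Lemma chain_graph_image C l : has_chain (@aclosed K a) C l ->
  has_chain (@aclosed K b) (graph_image C) l.
Proof.
case=> Z [H1 H2]; exists (fun i => graph_image (Z i)); split=> i il.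
  have [A B D] := H1 i il; split; [exact: aclosed_graph_image|exact: graph_image_irreducible|].
  by move=> x [/D ? ?].
have [A B] := H2 i il; split=> [x [/A ? ?] //|H]; apply: B => x Zx.
by apply/graph_imageE/H/graph_imageE.
Qed.

Lemma chain_preimage S l : psubset S (fun x => x = mpt theta (mpt rho x)) ->
  has_chain (@aclosed K b) S l -> has_chain (@aclosed K a) (fun x => S (mpt theta x)) l.
Proof.
move=> Sg [Z [H1 H2]]; exists (fun i x => Z i (mpt theta x)); split=> i il.
  have [A B D] := H1 i il; split; first exact: aclosed_preimage.
    by apply: preimage_irreducible => // x /D /Sg.
  by move=> x /D.
have [A B] := H2 i il; split=> [x /A //|H]; apply: B => x Zx.
have [_ _ D] := H1 i.+1 il.
by rewrite (Sg _ (D _ Zx)); apply: H; rewrite -(Sg _ (D _ Zx)).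
Qed.
End ClosedEmbedding.

Lemma prime_zeros_irreducible n (q : {mpoly K[n]}) : prime_elt q ->
  irreducible (@aclosed K n) (fun x => q.@[x] = 0).
Proof.
move=> qP; have [q0 qu qM] := qP; have N := @prime_nullstellensatz _ Kclosed _ q _ qP.
apply: prime_irreducible.
  apply: NNPP => H; case/negP: qu; have [|c cE] := N 1; first by move=> x qx; case: H; exists x.
  by apply/unitrPr; exists c; rewrite mulrC.
by move=> u v /N /qM[[c ->]|[c ->]]; [left|right] => x qx; rewrite mevalM qx mulr0.
Qed.

Definition insert_pt n (j : 'I_n.+1) (c : K) (x : 'I_n -> K) : 'I_n.+1 -> K :=
  fun i => if unlift j i is Some i' then x i' else c.

Lemma meval_insert n (j : 'I_n.+1) c x (p : {mpoly K[n.+1]}) :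
  p.@[insert_pt j c x] = (map_poly (meval x) (msplit j p)).[c].
Proof.
rewrite (meval_msplit j) {2}/insert_pt unlift_none.
congr (_.[_]); apply: eq_map_poly => v; apply: meval_eq => k.
by rewrite /= /insert_pt liftK.
Qed.

(** A prime factor [q] that involves coordinate i is restricted to a hyperplane on which another
    coordinate is frozen and [q] is still not constant. Induction gives a chain inside this slice,
    and the irreducible zero set of [q] goes on top. *)
Lemma nonconst_chain n (p : {mpoly K[n.+1]}) : ~ (exists c, p = c%:MP) ->
  has_chain (@aclosed K n.+1) (fun x => p.@[x] = 0) n.
Proof.
elim: n p => [|n IH] p pc.
all: have [||q qP [w pE]] := @mpoly_has_prime_divisors K _ p;
  [by apply: contra_notN pc => /eqP ->; exists 0; rewrite mpolyC0
  |by apply: contra_notN pc => /mpoly_unit_const[c _ ->]; exists c|].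
all: have qp : psubset (fun x => q.@[x] = 0) (fun x => p.@[x] = 0) by
  move=> x qx; rewrite pE mevalM qx mulr0.
all: have qi := prime_zeros_irreducible qP.
  by apply: has_chain0 qp => //; apply: aclosed_zeros.
have [i si] := prime_elt_dep Kclosed qP.
have q0 : msplit i q != 0 by rewrite -size_poly_gt0; apply: leq_trans si.
have [x] : exists x, (lead_coef (msplit i q)).@[x] != 0.
  by apply: (mpoly_eval_neq0 Kclosed); rewrite lead_coef_eq0.
move=> lx; set u := map_poly (meval x) (msplit i q).
have su : size u = size (msplit i q) by rewrite size_map_poly_id0.
(* [u] is [q] on a line parallel to axis i; a root and a non-root of it show that [q] is not
   constant on any slice containing this line. *)
have [|t /eqP ut] := Kclosed (p := u); first by rewrite su gtn_eqF.
have [|t' ut'] := alg_closed_nonroot Kclosed (p := u).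
  by rewrite -size_poly_gt0 su; apply: leq_trans si.
(* Coordinate [j] differs from [i], and [c] is its value along the chosen line. *)
pose j := lift i ord0; pose c := x ord0.
pose theta (k : 'I_n.+2) : {mpoly K[n.+1]} := if unlift j k is Some k' then 'X_k' else c%:MP.
pose rho (k : 'I_n.+1) : {mpoly K[n.+2]} := 'X_(lift j k).
have thetaE z : mpt theta z = insert_pt j c z.
  apply: functional_extensionality => k; rewrite /mpt /theta /insert_pt.
  by case: unlift => [k'|]; rewrite (mevalXU, mevalC).
have thetaK z : mpt rho (mpt theta z) = z.
  apply: functional_extensionality => k.
  by rewrite thetaE /mpt mevalXU /insert_pt liftK.
have jin s : insert_pt i s x = mpt theta (mpt rho (insert_pt i s x)).
  apply: functional_extensionality => k; rewrite thetaE /insert_pt.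
  case: (unliftP j k) => [k' ->|->]; first by rewrite /mpt mevalXU.
  by rewrite /j liftK.
have /IH IHq : ~ exists d, msubst theta q = d%:MP.
  case=> d E; have ev s : u.[s] = d.
    by rewrite /u -meval_insert jin meval_mpt E mevalC.
  by move: ut'; rewrite /root ev -ut ev eqxx.
apply: (has_chainS (chain_graph_image thetaK IHq) _ _ qi) => //.
- by move=> z [E ->]; rewrite meval_mpt.
- exact: aclosed_zeros.
(* If the zero set of [q] stayed in the hyperplane, [q] would divide 'X_j - c, which does not
   involve the variable i. *)
move=> H; have [|d E] := @prime_nullstellensatz _ Kclosed _ q ('X_j - c%:MP) qP.
  move=> z /H [_ ->]; rewrite mevalB mevalXU mevalC thetaE /insert_pt unlift_none.
  by rewrite subrr.
have Xc : msplit i ('X_j - c%:MP) = ('X_ord0 - c%:MP)%:P.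
  by rewrite rmorphB /= msplitX msplitC /split_image liftK polyCB.
have X0 : ('X_ord0 - c%:MP : {mpoly K[n.+1]}) != 0.
  apply/eqP => /(congr1 (meval (fun _ => c + 1))) /eqP.
  by rewrite mevalB mevalXU mevalC meval0 addrC addKr oner_eq0.
have := congr1 (msplit i) E; rewrite Xc rmorphM /= => E'.
have d0 : msplit i d != 0 by apply: contraNneq X0 => d0; rewrite -polyC_eq0 E' d0 mul0r.
have := size_mul d0 q0; rewrite -E' size_polyC X0 /=.
move: d0 si; rewrite -size_poly_gt0.
by move: (size (msplit i d)) (size (msplit i q)) => s1 s2; lia.
Qed.

End AffineSets.

(** * Lifting irreducible sets through a finite map *)

Section MinimalClosed.
Variables (X Y : Type) (closed : pset X -> Prop) (psi : X -> Y) (Z : pset Y) (S : pset X).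
Hypothesis closed_inter : forall (I : Type) (F : I -> pset X), inhabited I ->
  (forall i, closed (F i)) -> closed (fun x => forall i, F i x).
Hypothesis fibres_finite : forall y, Z y ->
  exists (J : finType) (s : J -> X), forall x, S x -> psi x = y -> exists j, x = s j.
Hypothesis S_closed : closed S.
Hypothesis S_onto : forall y, Z y -> exists2 x, S x & psi x = y.

Let onto (A : pset X) := forall y, Z y -> exists2 x, A x & psi x = y.

(* Finiteness of the fibres makes a chain of closed sets lying over [Z]
   intersect in a set still lying over [Z]. *)
Lemma exists_minimal_closed : exists M, [/\ closed M, psubset M S, onto M &
  forall A, closed A -> psubset A M -> onto A -> psubset M A].
Proof.
pose T := {A : pset X | [/\ closed A, psubset A S & onto A]}.
pose leT (a b : T) := boolp.asbool (psubset (sval b) (sval a)).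
have leP a b : leT a b <-> psubset (sval b) (sval a) by split=> [/boolp.asboolP|/boolp.asboolP].
have t0 : T by exists S; split.
have [||A0 A0tot|M Mmax] := @classical_sets.ZL_preorder T t0 leT.
- by move=> a; apply/leP.
- by move=> a b c /leP ba /leP cb; apply/leP => x /cb /ba.
- case: (classic (inhabited {a : T | A0 a})) => [A0ne|A0e]; last first.
    by exists t0 => s A0s; case: A0e; exists; exists s.
  pose W : pset X := fun x => forall a : {a : T | A0 a}, sval (sval a) x.
  have WT : [/\ closed W, psubset W S & onto W].
    split.
    - by apply: closed_inter => // -[[A [? ? ?]] ?].
    - by case: A0ne => -[[A [Ac AS Ao]] A0a] x /(_ (exist _ _ A0a)); apply: AS.
    move=> y Zy; have [J [s sE]] := fibres_finite Zy.
    apply: NNPP => nx.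
    have H j : exists a : T, A0 a /\ (psi (s j) = y -> ~ sval a (s j)).
      apply: NNPP => H; apply: nx; exists (s j).
        move=> [a A0a] /=; apply: NNPP => nas; apply: H; exists a; split => //.
      apply: NNPP => ny; apply: H; case: A0ne => -[a A0a]; exists a; split => //.
    have [B [A0B BE]] : exists B : T, A0 B /\ forall j, psi (s j) = y -> ~ sval B (s j).
      suff [B [A0B BE]] : exists B : T, A0 B /\
          forall j, j \in enum J -> psi (s j) = y -> ~ sval B (s j).
        by exists B; split => // j; apply: BE; rewrite mem_enum.
      elim: (enum J) => [|j l [B [A0B BE]]].
        by case: A0ne => -[a A0a]; exists a.
      have [a [A0a aE]] := H j.
      have [/leP ab|/leP ba] := A0tot _ _ A0a A0B.
        exists B; split => // k; rewrite inE => /orP[/eqP -> /aE|/BE] H1 //.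
        by move=> /ab.
      exists a; split => // k; rewrite inE => /orP[/eqP -> /aE|/BE H1 /H1] //.
      by move=> H2 /ba.
    case: B BE A0B => B [Bc BS Bo] /= BE _.
    have [x Bx xy] := Bo y Zy; have [j jx] := sE x (BS _ Bx) xy.
    by apply: (BE j); rewrite -jx.
  by exists (exist _ W WT) => a A0a; apply/leP => x /= /(_ (exist _ a A0a)).
case: M Mmax => M [Mc MS Mo] Mmax; exists M; split => // A Ac AM Ao.
have AT : [/\ closed A, psubset A S & onto A] by split => // x /AM /MS.
have lMA : leT (exist _ M (And3 Mc MS Mo)) (exist _ A AT) by apply/leP.
by have /leP := Mmax _ lMA.
Qed.
End MinimalClosed.

Section IrreducibleLift.
Variables (K : fieldType) (X : Type) (b : nat) (closed : pset X -> Prop).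
Variables (psi : X -> 'I_b -> K) (Z : pset ('I_b -> K)) (S : pset X).
Hypothesis closed_inter : forall (I : Type) (F : I -> pset X), inhabited I ->
  (forall i, closed (F i)) -> closed (fun x => forall i, F i x).
Hypothesis fibres_finite : forall y, Z y ->
  exists (J : finType) (s : J -> X), forall x, S x -> psi x = y -> exists j, x = s j.
Hypothesis S_closed : closed S.
Hypothesis S_onto : forall y, Z y -> exists2 x, S x & psi x = y.
Hypothesis Z_nonempty : exists y, Z y.
Hypothesis Z_prime : forall q1 q2 : {mpoly K[b]}, vanish Z (q1 * q2) -> vanish Z q1 \/ vanish Z q2.
Hypothesis psi_separates : forall A y, closed A -> psubset A S -> Z y ->
  ~ (exists2 x, A x & psi x = y) ->
  exists2 q : {mpoly K[b]}, (forall x, A x -> q.@[psi x] = 0) & q.@[y] != 0.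

(** A minimal closed [M] over [Z] is irreducible. If a closed [A] does not contain [M], then the
    intersection of [M] and [A] no longer covers [Z], so some [q] vanishes on its image but not on
    all of [Z]. Two such sets covering [M] would give two such [q] whose product vanishes on [Z]. *)
Lemma irreducible_lift : exists M, [/\ closed M, irreducible closed M, psubset M S &
  forall y, Z y -> exists2 x, M x & psi x = y].
Proof.
have [M [Mc MS Mo Mmin]] := exists_minimal_closed closed_inter fibres_finite S_closed S_onto.
exists M; split => //; split.
  by case: Z_nonempty => y /Mo[x Mx _]; exists x.
have closed2 A B : closed A -> closed B -> closed (fun x => A x /\ B x).
  move=> Ac Bc; have := @closed_inter bool (fun i => if i then A else B) (inhabits true).
  have -> : (fun x => forall i : bool, (if i then A else B) x) = (fun x => A x /\ B x).
    apply: functional_extensionality => x; apply: boolp.propext.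
    by split=> [H|[? ?] []] //; split; [apply: (H true)|apply: (H false)].
  by apply; case.
have key A : closed A -> ~ psubset M A -> exists2 q : {mpoly K[b]},
    (forall x, M x -> A x -> q.@[psi x] = 0) & exists2 y, Z y & q.@[y] != 0.
  move=> Ac nMA; have MAc := closed2 _ _ Mc Ac.
  apply: NNPP => nq; apply: nMA => x Mx.
  suff H : forall y, Z y -> exists2 x, M x /\ A x & psi x = y.
    have MAM : psubset (fun x => M x /\ A x) M by move=> z [].
    by have [] := Mmin _ MAc MAM H x Mx.
  move=> y Zy; apply: NNPP => nx; apply: nq.
  have [|q qA qy] := psi_separates MAc _ Zy nx; first by move=> z [/MS].
  by exists q; [move=> z Mz Az; apply: qA|exists y].
move=> A B Ac Bc AB; apply: NNPP => /not_or_and [nA nB].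
have [q1 q1A [y1 Zy1 q1y]] := key _ Ac nA; have [q2 q2B [y2 Zy2 q2y]] := key _ Bc nB.
have [|H|H] := Z_prime (q1 := q1) (q2 := q2); last 2 first.
- by rewrite H ?eqxx in q1y.
- by rewrite H ?eqxx in q2y.
move=> y /Mo[x Mx <-]; rewrite mevalM.
by have [Ax|Bx] := AB x Mx; [rewrite q1A ?mul0r|rewrite q2B ?mulr0].
Qed.
End IrreducibleLift.

Lemma aclosed_inter (K : fieldType) n (I : Type) (F : I -> pset ('I_n -> K)) :
  (forall i, aclosed (F i)) -> aclosed (fun x => forall i, F i x).
Proof.
move=> Fc; exists (fun p => exists i, vanish (F i) p) => x; split=> [Fx p [i]|H i]; first exact.
apply: NNPP => nFx; have [p pF] := aclosed_sep (Fc i) nFx.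
by rewrite H ?eqxx //; exists i.
Qed.

Section AvoidZeros.
Variables (K : fieldType) (n : nat).
Hypothesis Kclosed : alg_closed K.

(** The points are treated one by one: p + c q repairs the value at a new point and, for all but
    finitely many [c], spoils none of the old ones. *)
Lemma nonvanishing_at_points (J : finType) (u : J -> 'I_n -> K) (Q : pset {mpoly K[n]}) :
  is_ideal Q -> (forall j, exists2 p, Q p & p.@[u j] != 0) ->
  exists2 p, Q p & forall j, p.@[u j] != 0.
Proof.
move=> QI H.
suff [p Qp pE] : exists2 p, Q p & forall j, j \in enum J -> p.@[u j] != 0.
  by exists p => // j; apply: pE; rewrite mem_enum.
elim: (enum J) => [|j l [p Qp pE]]; first by exists 0 => //; exact: ideal0.
have [q Qq qj] := H j.
have [pj|pj] := eqVneq (p.@[u j]) 0; last first.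
  by exists p => // k; rewrite inE => /orP[/eqP ->|/pE].
(* The roots of [s] are the forbidden values of [c]: 0 for the new point, and one linear factor for
   every old point. *)
pose s := 'X * \prod_(k <- l) ((p.@[u k])%:P + (q.@[u k])%:P * 'X) : {poly K}.
have s0 : s != 0.
  rewrite mulf_neq0 ?polyX_eq0 //; rewrite prodf_seq_neq0; apply/allP => k kl /=.
  apply/eqP => /(congr1 (horner_eval 0)).
  rewrite /horner_eval hornerD hornerM !hornerC hornerX mulr0 addr0 => /eqP.
  exact/negP/pE.
have [c] := alg_closed_nonroot Kclosed s0.
rewrite /root hornerM hornerX mulf_eq0 negb_or => /andP[c0].
rewrite horner_prod prodf_seq_neq0 => /allP sE.
exists (p + c%:MP * q); first by apply: idealD => //; apply: idealM.
move=> k; rewrite inE mevalD mevalM mevalC => /orP[/eqP ->|kl].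
  by rewrite pj add0r mulf_neq0.
by have := sE k kl; rewrite hornerD hornerM !hornerC hornerX mulrC.
Qed.
End AvoidZeros.

(** * Projective sets represented by cones without the origin *)

Section ProjectiveSets.
Variables (K : fieldType) (n : nat).
Hypothesis Kclosed : alg_closed K.
Implicit Types (S : pset ('I_n -> K)) (x : 'I_n -> K) (p : {mpoly K[n]}).

Lemma meval_scale d p x t : p \is d.-homog -> p.@[fun i => t * x i] = t ^+ d * p.@[x].
Proof.
move=> ph; rewrite !mevalE mulr_sumr; apply: eq_big_seq => m mp.
rewrite mulrCA; congr (_ * _).
rewrite (eq_bigr (fun i => t ^+ m i * x i ^+ m i)) => [|i _]; last by rewrite exprMn.
by rewrite big_split /= -expr_sum -mdegE (dhomog_mf ph mp).
Qed.

Lemma pclosed_scale S x t : pclosed S -> t != 0 -> S x -> S (fun i => t * x i).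
Proof.
case=> P [Ph HP] t0 /HP[[i xi] H]; apply/HP; split; first by exists i; rewrite mulf_neq0.
by move=> p Pp; have [d pd] := Ph p Pp; rewrite (meval_scale _ _ pd) H ?mulr0.
Qed.

Lemma pclosed_nonzero S x : pclosed S -> S x -> nonzero x.
Proof. by case=> P [_ HP] /HP[]. Qed.

Lemma pclosed_sep S x : pclosed S -> nonzero x -> ~ S x ->
  exists p, [/\ vanish S p, exists d, p \is d.-homog & p.@[x] != 0].
Proof.
move=> [P [Ph HP]] x0 nSx; apply: NNPP => H; apply: nSx; apply/HP; split=> // p Pp.
apply/eqP; apply: contra_notT H => px; exists p; split=> //; last exact: Ph.
by move=> z /HP[_]; apply.
Qed.

Lemma pclosed_inter (I : Type) (F : I -> pset ('I_n -> K)) : inhabited I ->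
  (forall i, pclosed (F i)) -> pclosed (fun x => forall i, F i x).
Proof.
move=> [i0] Fc; exists (fun p => (exists d, p \is d.-homog) /\ exists i, vanish (F i) p).
split=> [p []//|x]; split=> [Fx|[x0 H] i].
  by split=> [|p [_ [i]]]; [apply: (pclosed_nonzero (Fc i0))|apply].
apply: NNPP => nFx; have [p [pF ph px]] := pclosed_sep (Fc i) x0 nFx.
by rewrite H ?eqxx // in px; split=> //; exists i.
Qed.

(** The restriction of [p] to the line through 0 and [x]. Its coefficients are the homogeneous
    components of [p] at [x], so one equation between polynomials encodes the vanishing of all of
    them. *)
Definition components_poly p x : {poly K} :=
  \sum_(d < msize p) (pihomog mdeg d p).@[x] *: 'X^d.

Lemma components_polyE p x t : (components_poly p x).[t] = p.@[fun i => t * x i].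
Proof.
rewrite {2}(@pihomog_partitionE n K mdeg (msize p) p) // raddf_sum horner_sum /=.
apply: eq_bigr => d _; rewrite hornerZ hornerXn mulrC (meval_scale (d := d)) //.
exact: pihomogP.
Qed.

Lemma vanish_components S p : pclosed S ->
  (vanish S p <-> forall x, S x -> components_poly p x = 0).
Proof.
move=> Sc; split=> [H x Sx|H x Sx]; last first.
  rewrite -[RHS](horner0 1) -(H x Sx) components_polyE.
  by apply: meval_eq => i; rewrite mul1r.
(* Scaling by t stays in [S] only for nonzero t; the factor 'X takes care of t = 0. *)
have : 'X * components_poly p x = 0.
  apply: (poly_eval_eq0 Kclosed) => t; rewrite hornerM hornerX components_polyE.
  have [->|t0] := eqVneq t 0; first by rewrite mul0r.
  by rewrite H ?mulr0 //; apply: pclosed_scale.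
by move/eqP; rewrite mulf_eq0 polyX_eq0 => /eqP.
Qed.

Lemma pclosed_components p : pclosed (fun x => nonzero x /\ components_poly p x = 0).
Proof.
exists (fun q => exists2 d : 'I_(msize p), q \is d.-homog & q = pihomog mdeg d p).
split=> [q [d qh _]|x]; first by exists d.
split=> -[x0 H]; split=> //.
  move=> q [d _ ->]; have /polyP/(_ d) := H; rewrite coef0 coef_sum (bigD1 d) //=.
  rewrite coefZ coefXn eqxx mulr1 big1 ?addr0 // => k kd.
  by rewrite coefZ coefXn eq_sym (inj_eq val_inj) (negbTE kd) mulr0.
rewrite /components_poly big1 // => d _; rewrite H ?scale0r //.
by exists d => //; apply: pihomogP.
Qed.

(** For inhomogeneous [p] the zero set is not projective; the closed set used instead is where all
    homogeneous components of [p] vanish, which on [S] means the same by scaling. *)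
Lemma pirreducible_prime S : pclosed S -> irreducible (@pclosed K n) S -> is_prime (vanish S).
Proof.
move=> Sc [Sn Si]; split; [exact: vanish_ideal|exact: vanish_proper|].
move=> p q pq.
have [|H|H] := Si _ _ (pclosed_components p) (pclosed_components q); last 2 first.
- by left; apply/(vanish_components _ Sc) => x /H[].
- by right; apply/(vanish_components _ Sc) => x /H[].
move=> x Sx; have x0 := pclosed_nonzero Sc Sx.
have : 'X * (components_poly p x * components_poly q x) = 0.
  apply: (poly_eval_eq0 Kclosed) => t; rewrite !hornerM hornerX !components_polyE -mevalM.
  have [->|t0] := eqVneq t 0; first by rewrite mul0r.
  by rewrite pq ?mulr0 //; apply: pclosed_scale.
by move/eqP; rewrite !mulf_eq0 polyX_eq0 /= => /orP[/eqP|/eqP]; [left|right].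
Qed.

Lemma prime_pirreducible S : (exists x, S x) -> (forall x, S x -> nonzero x) ->
  (forall p q, vanish S (p * q) -> vanish S p \/ vanish S q) -> irreducible (@pclosed K n) S.
Proof.
move=> Sn S0 Sp; split=> // A B Ac Bc AB.
case: (classic (psubset S A)) => [|nA]; [by left|right=> x Sx].
apply: NNPP => nBx; have [q [qB _ qx]] := pclosed_sep Bc (S0 x Sx) nBx.
apply: nA => z Sz; apply: NNPP => nAz; have [p [pA _ pz]] := pclosed_sep Ac (S0 z Sz) nAz.
have [w|H|H] := Sp p q.
- by rewrite mevalM => /AB[/pA|/qB] ->; rewrite ?mul0r ?mulr0.
- by rewrite H ?eqxx in pz.
- by rewrite H ?eqxx in qx.
Qed.

End ProjectiveSets.

(** * Artin monomials *)

Record is_subring (R : comNzRingType) (Q : pset R) : Prop := IsSubring {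
  subring1 : Q 1;
  subringB : forall a b, Q a -> Q b -> Q (a - b);
  subringM : forall a b, Q a -> Q b -> Q (a * b) }.

Section Subring.
Variables (R : comNzRingType) (Q : pset R).
Hypothesis QR : is_subring Q.
Lemma subring0 : Q 0. Proof. by rewrite -(subrr 1); apply: subringB => //; apply: subring1. Qed.
Lemma subringN a : Q a -> Q (- a).
Proof. by move=> Qa; rewrite -[- a]add0r; apply: subringB => //; apply: subring0. Qed.
Lemma subringD a b : Q a -> Q b -> Q (a + b).
Proof. by move=> Qa Qb; rewrite -[b]opprK; apply: subringB => //; apply: subringN. Qed.
Lemma subring_sum (I : Type) (s : seq I) (P : pred I) (F : I -> R) :
  (forall i, P i -> Q (F i)) -> Q (\sum_(i <- s | P i) F i).
Proof. by move=> H; apply: (big_ind Q); [exact: subring0|exact: subringD|]. Qed.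
Lemma subring_prod (I : Type) (s : seq I) (P : pred I) (F : I -> R) :
  (forall i, P i -> Q (F i)) -> Q (\prod_(i <- s | P i) F i).
Proof. by move=> H; apply: (big_ind Q); [exact: subring1|exact: subringM|]. Qed.
Lemma subringX a k : Q a -> Q (a ^+ k).
Proof. by move=> Qa; elim: k => [|k IH]; rewrite ?expr0 ?exprS; [exact: subring1|exact: subringM]. Qed.
End Subring.

Lemma mpoly_subring_full (K : fieldType) n (Q : pset {mpoly K[n]}) : is_subring Q ->
  (forall c, Q c%:MP) -> (forall i, Q 'X_i) -> forall p, Q p.
Proof.
move=> QR QC QX p; rewrite [p]mpolyE; apply: subring_sum => // m _.
rewrite -mul_mpolyC; apply: subringM => //; rewrite mpolyXE_id.
by apply: subring_prod => // i _; apply: subringX.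
Qed.

(* Exponents of the monomials [X^alpha], [alpha_i < r - i], which form a basis of
   the polynomial ring over the symmetric polynomials. *)
Definition artin r (alpha : {ffun 'I_r -> 'I_r}) := [forall i, (alpha i + i < r)%N].

Definition artin_mon (R : comNzRingType) r (x : 'I_r -> R) (alpha : {ffun 'I_r -> 'I_r}) : R :=
  \prod_i x i ^+ alpha i.

Section ArtinSpan.
Variables (R : comNzRingType) (r : nat) (x : 'I_r -> R) (Q : pset R).
Hypothesis QR : is_subring Q.

Let z (k : nat) : R := if insub k is Some i then x i else 0.
Let g (k : nat) : {poly R} := \prod_(k <= j < r) ('X - (z j)%:P).
Hypothesis Qg : forall i, Q (\prod_(j < r) ('X - (x j)%:P))`_i.

(** The [Q]-span of the monomials in the first [k] variables with exponent of the i-th below r - i.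
    It is a ring because [z k] is a root of [g k], a monic polynomial of degree r - k with
    coefficients in [tower k]. *)
Fixpoint tower (k : nat) : pset R :=
  if k is k'.+1 then
    fun p => exists q : nat -> R, (forall a, tower k' (q a)) /\
      p = \sum_(a < r - k') q a * z k' ^+ a
  else Q.

Lemma z_ord (i : 'I_r) : z i = x i.
Proof. by rewrite /z valK. Qed.

Lemma g0_coef i : Q (g 0)`_i.
Proof.
rewrite /g big_mkord; have -> : \prod_(i < r) ('X - (z i)%:P) = \prod_(i < r) ('X - (x i)%:P).
  by apply: eq_bigr => j _; rewrite z_ord.
exact: Qg.
Qed.

Lemma g_rec k : (k < r)%N -> g k = ('X - (z k)%:P) * g k.+1.
Proof. by move=> kr; rewrite /g big_ltn. Qed.

Lemma g_monic k : g k \is monic.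
Proof. by apply: rpred_prod => j _; apply: monicXsubC. Qed.

Lemma size_g k : (k <= r)%N -> size (g k) = (r - k).+1.
Proof.
move=> kr; rewrite /g -(big_map z xpredT (fun c => 'X - c%:P)) size_prod_XsubC size_map.
by rewrite size_iota.
Qed.

Lemma tower_step k : (k < r)%N -> is_subring (tower k) -> (forall i, tower k (g k)`_i) ->
  [/\ is_subring (tower k.+1), psubset (tower k) (tower k.+1), tower k.+1 (z k) &
      forall i, tower k.+1 (g k.+1)`_i].
Proof.
move=> kr SR gk; set T := tower k; set T' := tower k.+1.
have rk : (0 < r - k)%N by rewrite subn_gt0.
have sub : psubset T T'.
  move=> p Tp; exists (fun a => if a == 0%N then p else 0); split=> [a|].
    by case: eqP => // _; apply: subring0.
  rewrite (bigD1 (Ordinal rk)) //= expr0 mulr1 big1 ?addr0 // => a.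
  by rewrite -val_eqE /= => /negbTE ->; rewrite mul0r.
have TB a b : T' a -> T' b -> T' (a - b).
  move=> [q [Tq ->]] [q' [Tq' ->]]; exists (fun a => q a - q' a).
  split=> [i|]; first exact: (subringB SR (Tq i) (Tq' i)).
  by rewrite -sumrB; apply: eq_bigr => i _; rewrite mulrBl.
have TN a : T' a -> T' (- a) by move=> H; rewrite -[- a]add0r; exact: (TB _ _ (sub _ (subring0 SR)) H).
have TD a b : T' a -> T' b -> T' (a + b) by move=> Ha Hb; rewrite -[b]opprK; exact: (TB _ _ Ha (TN _ Hb)).
have TZ a b : T a -> T' b -> T' (a * b).
  move=> Ta [q [Tq ->]]; exists (fun i => a * q i); split=> [i|]; first exact: (subringM SR Ta (Tq i)).
  by rewrite mulr_sumr; apply: eq_bigr => i _; rewrite mulrA.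
have T0 : T' 0 := sub _ (subring0 SR).
have Tsum n (F : nat -> R) : (forall i, (i < n)%N -> T' (F i)) -> T' (\sum_(i < n) F i).
  by move=> H; apply: (big_ind T') => // i _; apply: H.
have Tpow a : (a < r - k)%N -> T' (z k ^+ a).
  move=> ak; exists (fun i => (i == a)%:R); split=> [i|].
    by case: (i == a); [exact: subring1|exact: subring0].
  rewrite (bigD1 (Ordinal ak)) //= eqxx mul1r big1 ?addr0 // => i.
  by rewrite -val_eqE /= => /negbTE ->; rewrite mul0r.
have Ttop : T' (z k ^+ (r - k)).
  have gz : (g k).[z k] = 0 by rewrite g_rec // hornerM hornerXsubC subrr mul0r.
  have := gz; rewrite horner_coef size_g ?(ltnW kr) // big_ord_recr /=.
  have -> : (g k)`_(r - k) = 1.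
    by have /monicP := g_monic k; rewrite /lead_coef size_g ?(ltnW kr).
  rewrite mul1r addrC => /eqP; rewrite addr_eq0 => /eqP ->; apply: TN.
  by apply: (Tsum _ (fun i => (g k)`_i * z k ^+ i)) => i ik; apply: TZ; [exact: gk|exact: Tpow].
have TX b : T' b -> T' (z k * b).
  case=> q [Tq ->]; rewrite mulr_sumr.
  apply: (Tsum _ (fun i => z k * (q i * z k ^+ i))) => i ik.
  rewrite mulrCA -exprS; apply: TZ; first exact: Tq.
  move: ik; rewrite leq_eqVlt => /orP[/eqP ->|ik]; first exact: Ttop.
  exact: Tpow.
have TM a b : T' a -> T' b -> T' (a * b).
  case=> q [Tq ->] Tb; rewrite mulr_suml.
  apply: (Tsum _ (fun i => q i * z k ^+ i * b)) => i ik.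
  rewrite -mulrA; apply: TZ; first exact: Tq.
  by elim: (i) => [|j IH]; rewrite ?expr0 ?mul1r // exprS -mulrA; apply: TX.
have T1 : T' 1 := sub _ (subring1 SR).
have S' : is_subring T' by split.
have Tz : T' (z k) by rewrite -[z k]mulr1; apply: TX.
split=> // i.
(* Dividing [g k] by T - z_k yields the coefficients of the quotient from the top down. *)
have [n] := ubnP (r - i); elim: n i => // n IH i /ltnSE ni.
have [si|si] := leqP (size (g k.+1)) i; first by rewrite nth_default.
have E : (g k)`_i.+1 = (g k.+1)`_i - z k * (g k.+1)`_i.+1.
  by rewrite g_rec // mulrBl coefB coefXM coefCM.
have -> : (g k.+1)`_i = (g k)`_i.+1 + z k * (g k.+1)`_i.+1 by rewrite E subrK.
apply: TD; first exact: (sub _ (gk _)).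
apply: TX; apply: IH; move: si; rewrite size_g //; lia.
Qed.

Lemma towerP k : (k <= r)%N ->
  [/\ is_subring (tower k), psubset Q (tower k), forall j, (j < k)%N -> tower k (z j) &
      forall i, tower k (g k)`_i].
Proof.
elim: k => [|k IH] kr; first by split=> // i; apply: g0_coef.
have [a b c d] := IH (ltnW kr); have [a' b' c' d'] := tower_step kr a d.
split=> //; first by move=> p /b /b'.
by move=> j; rewrite ltnS leq_eqVlt => /orP[/eqP -> //|/c /b'].
Qed.

Definition artin_span (p : R) := exists c : {ffun 'I_r -> 'I_r} -> R, (forall a, Q (c a)) /\
  p = \sum_(a | artin a) c a * artin_mon x a.

Lemma artin_spanD p q : artin_span p -> artin_span q -> artin_span (p + q).
Proof.
case=> c [Qc ->] [d [Qd ->]]; exists (fun a => c a + d a).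
split=> [a|]; first exact: (subringD QR (Qc a) (Qd a)).
by rewrite -big_split; apply: eq_bigr => a _; rewrite mulrDl.
Qed.

Lemma artin_span1 c a : Q c -> artin a -> artin_span (c * artin_mon x a).
Proof.
move=> Qc aa; exists (fun b => if b == a then c else 0); split=> [b|].
  by case: eqP => // _; apply: subring0.
rewrite (bigD1 a) //= eqxx big1 ?addr0 // => b /andP[_ /negbTE ->]; by rewrite mul0r.
Qed.

Lemma tower_span k p b : (k <= r)%N -> tower k p -> artin b ->
  (forall i : 'I_r, (i < k)%N -> b i = 0%N :> nat) -> artin_span (p * artin_mon x b).
Proof.
elim: k p b => [|k IH] p b kr; first by move=> Qp ab _; apply: artin_span1.
case=> q [Tq ->] ab b0; rewrite mulr_suml.
apply: (big_ind artin_span); [|exact: artin_spanD|move=> a _].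
  exists (fun _ => 0); split=> [_|]; first exact: subring0.
  by rewrite big1 // => c _; rewrite mul0r.
have ar : (a < r)%N by apply: leq_trans (ltn_ord a) _; rewrite leq_subr.
pose b' : {ffun 'I_r -> 'I_r} := [ffun i => if i == Ordinal kr then Ordinal ar else b i].
have -> : q a * z k ^+ a * artin_mon x b = q a * artin_mon x b'.
  rewrite -mulrA; congr (_ * _); rewrite /artin_mon (bigD1 (Ordinal kr)) //=.
  rewrite [RHS](bigD1 (Ordinal kr)) //= ffunE eqxx /= b0 //= expr0 mul1r.
  rewrite (z_ord (Ordinal kr) : z k = _); congr (_ * _).
  by apply: eq_bigr => i /negbTE ik; rewrite ffunE ik.
apply: IH; [exact: ltnW|exact: Tq| |].
  apply/forallP => i; rewrite ffunE; case: eqP => [->|_] /=; last exact: (forallP ab).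
  by rewrite addnC -ltn_subRL.
move=> i ik; rewrite ffunE; case: eqP => [E|_]; last by apply: b0; apply: leq_trans ik _.
by move: ik; rewrite E /= ltnn.
Qed.

Lemma artin_spanning : (0 < r)%N -> exists2 T : pset R, is_subring T &
  [/\ psubset Q T, forall i, T (x i) & forall p, T p -> artin_span p].
Proof.
move=> r0; have [a b c _] := towerP (leqnn r); exists (tower r) => //; split=> //.
  by move=> i; rewrite -z_ord; apply: c.
move=> p Tp; pose b0 : {ffun 'I_r -> 'I_r} := [ffun _ => Ordinal r0].
have -> : p = p * artin_mon x b0.
  by rewrite /artin_mon big1 ?mulr1 // => i _; rewrite ffunE expr0.
apply: (tower_span (leqnn r)) => // [|i _]; last by rewrite ffunE.
by apply/forallP => i; rewrite ffunE /= ltn_ord.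
Qed.
End ArtinSpan.

Section ArtinFree.
Variables (R : idomainType) (r : nat) (x : 'I_r -> R).
Hypothesis x_inj : injective x.
Implicit Types (s t : {perm 'I_r}) (a b : {ffun 'I_r -> 'I_r}).

(** The variables are peeled off from the last to the first. With the exponents beyond index l
    fixed, the sum is a polynomial of degree less than r - l in the l-th variable. Transposing l
    with the indices after it leaves the earlier variables alone and shows that the polynomial
    vanishes at r - l distinct points. *)
Lemma artin_free (c : {ffun 'I_r -> 'I_r} -> R) :
  (forall s, \sum_(a | artin a) c a * artin_mon (x \o s) a = 0) ->
  forall a, artin a -> c a = 0.
Proof.
move=> H; pose agree k a b := [forall i : 'I_r, (k <= i)%N ==> (a i == b i)].
pose T k s b := \sum_(a | artin a && agree k a b) c a * \prod_(i < r | (i < k)%N) x (s i) ^+ a i.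
have agreeP k a b : reflect (forall i : 'I_r, (k <= i)%N -> a i = b i) (agree k a b).
  apply: (iffP forallP) => [h i ki|h i]; first by have /implyP/(_ ki)/eqP := h i.
  by apply/implyP => ki; apply/eqP/h.
suff T0 k s b : (k <= r)%N -> artin b -> T k s b = 0.
  move=> b ab; rewrite -(T0 0%N 1%g b isT ab) /T (big_pred1 b) => [|a].
    by rewrite big_pred0 ?mulr1.
  apply/andP/eqP => [[_ /agreeP h]|->]; first by apply/ffunP => i; apply: h.
  by split=> //; apply/agreeP.
move=> kr; rewrite -(subKn kr); move: (r - k)%N (leq_subr k r) => d; move: s b.
elim: d => [|d IH] s b dr ab.
  rewrite subn0 -(H s); apply: eq_big => [a|a _].
    by apply/andP/idP => [[]//|aa]; split=> //; apply/agreeP => i; rewrite leqNgt ltn_ord.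
  by congr (_ * _); apply: eq_bigl => i; rewrite ltn_ord.
set l := (r - d.+1)%N; have lr : (l < r)%N by rewrite /l; lia.
have lE : (r - d)%N = l.+1 by rewrite /l; lia.
pose L := Ordinal lr.
pose upd (e : 'I_r) : {ffun 'I_r -> 'I_r} := [ffun i => if i == L then e else b i].
pose P := \sum_(e < r | (e + l < r)%N) (T l s (upd e))%:P * 'X^e : {poly R}.
have PE t : (forall i : 'I_r, (i < l)%N -> t i = s i) -> P.[x (t L)] = T l.+1 t b.
  move=> ts; rewrite /P horner_sum /T [RHS](partition_big (fun a => a L) (fun e => (e + l < r)%N)) /=.
    apply: eq_bigr => e el; rewrite hornerM hornerC hornerXn /T mulr_suml.
    apply: eq_big => [a|a /andP[aa /agreeP ag]].
      apply/andP/andP => [[aa /agreeP ag]|[/andP[aa /agreeP ag] /eqP aL]].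
        split; last by apply/eqP; rewrite ag // ffunE eqxx.
        apply/andP; split=> //; apply/agreeP => i li; rewrite ag ?(ltnW li) // ffunE.
        by case: eqP => // E; move: li; rewrite E /= ltnn.
      split=> //; apply/agreeP => i; rewrite leq_eqVlt ffunE => /orP[/eqP E|li].
        have -> : i = L by apply: val_inj.
        by rewrite eqxx.
      rewrite ag //; case: eqP => // E; by move: li; rewrite E /= ltnn.
    rewrite -mulrA; congr (_ * _); rewrite [RHS](bigD1 L) //= mulrC; congr (_ * _).
      by rewrite ag // ffunE eqxx.
    apply: eq_big => [i|i il]; last by rewrite ts.
    rewrite ltnS ltn_neqAle andbC; congr (_ && _).
  by move=> a /andP[/forallP/(_ L)].
have rootP (j : 'I_r) : (l <= j)%N -> P.[x (s j)] = 0.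
  move=> lj; have := PE (tperm L j * s)%g; rewrite permM tpermL => ->; last first.
    move=> i il; rewrite permM tpermD //; apply/eqP => /(congr1 val) /= E; move: il; rewrite -E ?ltnn //.
    by rewrite ltnNge lj.
  by rewrite -lE; apply: IH => //; apply: ltnW.
have P0 : P = 0.
  apply/eqP; apply: contraT => P0.
  pose rs := [seq x (s j) | j <- [seq j : 'I_r <- enum 'I_r | (l <= j)%N]].
  have /(_ rs) := max_poly_roots P0.
  have -> : all (root P) rs.
    by apply/allP => y /mapP[j]; rewrite mem_filter => /andP[lj _] ->; rewrite /root rootP.
  have -> : uniq rs.
    by rewrite map_inj_uniq => [|i j /x_inj /perm_inj //]; apply/filter_uniq/enum_uniq.
  move=> /(_ isT isT); rewrite ltnNge; case/negP.
  have -> : size rs = (r - l)%N.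
    rewrite size_map size_filter -(count_map val (fun j => (l <= j)%N)) val_enum_ord.
    rewrite -{1}(subnKC (ltnW lr)) iotaD count_cat add0n.
    rewrite (eq_in_count (a2 := pred0)) ?count_pred0 => [|i]; last first.
      by rewrite mem_iota add0n /= => il; rewrite leqNgt il.
    rewrite (eq_in_count (a2 := predT)) ?count_predT ?size_iota // => i.
    by rewrite mem_iota => /andP[].
  apply/leq_sizeP => i il; rewrite /P coef_sum big1 // => e el.
  rewrite coefCM coefXn; case: eqP => [E|]; last by rewrite mulr0.
  by move: el; rewrite -E; lia.
have bL : (b L + l < r)%N by have /forallP/(_ L) := ab.
have := congr1 (fun p : {poly R} => p`_(b L)) P0; rewrite coef0 /P coef_sum (bigD1 (b L)) //=.
rewrite coefCM coefXn eqxx mulr1 big1 ?addr0 => [|e /andP[_ eb]]; last first.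
  by rewrite coefCM coefXn eq_sym (inj_eq val_inj) (negbTE eb) mulr0.
suff -> : upd (b L) = b by [].
by apply/ffunP => i; rewrite ffunE; case: eqP => [->|].
Qed.

End ArtinFree.

Lemma card_gt_ord r (i : nat) : #|[pred j : 'I_r | (i < j)%N]| = (r - i.+1)%N.
Proof.
rewrite -sum1_card big_mkcond /=.
elim: r => [|r IH]; first by rewrite big_ord0.
rewrite big_ord_recr /=; set s := (\sum_(_ < r) _)%N.
have -> : s = (r - i.+1)%N by rewrite -IH.
by case: ifP; rewrite inE /=; lia.
Qed.

(** * The Vandermonde product and a dual basis of the Artin monomials *)

Section Vandermonde.
Variables (R : comNzRingType) (r : nat).
Implicit Types (x z : 'I_r -> R) (s : {perm 'I_r}).

Definition vdm x : R := \prod_(i < r) \prod_(j < r | (i < j)%N) (x j - x i).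

Lemma vdm_det x : vdm x = \det (Vandermonde r (\row_i x i)).
Proof.
rewrite det_Vandermonde; apply: eq_bigr => i _; apply: eq_bigr => j _; by rewrite !mxE.
Qed.

Lemma vdm_perm x s : vdm (x \o s) = (-1) ^+ s * vdm x.
Proof.
rewrite !vdm_det.
have -> : Vandermonde r (\row_i (x \o s) i) = Vandermonde r (\row_i x i) *m perm_mx s^-1.
  by rewrite -col_permE; apply/matrixP => i j; rewrite !mxE.
by rewrite det_mulmx det_perm odd_permV mulrC.
Qed.

(** The coefficient of z^a in the product over i < j of x_j - z_i, as [theta_expand] shows. *)
Definition theta x (a : {ffun 'I_r -> 'I_r}) : R :=
  \prod_(i < r) (\prod_(j < r | (i < j)%N) ((x j)%:P - 'X))`_(a i).

Lemma theta_expand x z :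
  \prod_(i < r) \prod_(j < r | (i < j)%N) (x j - z i) = \sum_(a | artin a) theta x a * artin_mon z a.
Proof.
pose p (i : 'I_r) : {poly R} := \prod_(j < r | (i < j)%N) ((x j)%:P - 'X).
have sp (i : 'I_r) : (size (p i) <= r - i)%N.
  apply: leq_trans (size_poly_prod_leq _ _) _.
  rewrite (eq_bigr (fun _ => 2%N)) => [|j _]; last by rewrite -opprB size_polyN size_XsubC.
  rewrite sum_nat_const muln2 -addnn -addSn addnK.
  have : (i < r)%N by []. move=> ir.
  rewrite (card_gt_ord r i).
  by lia.
have pz (i : 'I_r) : \prod_(j < r | (i < j)%N) (x j - z i) = \sum_(e < r) (p i)`_e * z i ^+ e.
  rewrite -horner_coef_wide; last by apply: leq_trans (sp i) (leq_subr _ _).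
  by rewrite horner_prod; apply: eq_bigr => j _; rewrite hornerD hornerC hornerN hornerX.
rewrite (eq_bigr _ (fun i _ => pz i)) bigA_distr_bigA /= [RHS]big_mkcond /=.
apply: eq_bigr => a _; case: ifP => [aa|/negbT].
  by rewrite /theta /artin_mon -big_split.
rewrite negb_forall => /existsP[i]; rewrite -leqNgt => ai.
rewrite (bigD1 i) //= [(p i)`_ _]nth_default ?mul0r //.
by apply: leq_trans (sp i) _; rewrite leq_subLR addnC.
Qed.
End Vandermonde.

Section VandermondeDual.
Variables (R : idomainType) (r : nat) (x : 'I_r -> R).
Hypothesis x_inj : injective x.

Lemma vdm_neq0 : vdm x != 0.
Proof.
apply/prodf_neq0 => i _; apply/prodf_neq0 => j ij.
by rewrite subr_eq0; apply: contraTneq ij => /x_inj ->; rewrite ltnn.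
Qed.

Lemma perm_le_eq1 (s : {perm 'I_r}) : (forall i, (s i <= i)%N) -> s = 1%g.
Proof.
move=> H; apply/permP => i; rewrite perm1; have [n] := ubnP i.
elim: n i => // n IH i /ltnSE il; have := H i; rewrite leq_eqVlt => /orP[/eqP/val_inj //|si].
have E := IH (s i) (leq_trans si il); have := perm_inj E => E'.
by move: si; rewrite E' ltnn.
Qed.

(* The resultant-like kernel [prod_(i < j) (X_j - Z_i)] vanishes when [Z] is a
   nontrivial permutation of [X]; its coefficients therefore give a dual basis
   of the monomials [X^a]. *)
Lemma theta_dual (a a' : {ffun 'I_r -> 'I_r}) : artin a -> artin a' ->
  \sum_(s : {perm 'I_r}) (-1) ^+ s * theta (x \o s) a * artin_mon (x \o s) a' = vdm x *+ (a == a').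
Proof.
move=> aa aa'; apply/eqP; rewrite -subr_eq0; apply/eqP; move: a aa.
apply: (artin_free x_inj) => t.
under eq_bigr => a aa do rewrite mulrBl mulr_suml.
rewrite sumrB exchange_big /= [X in _ - X](bigD1 a') //= eqxx mulr1n.
rewrite [X in _ - (_ + X)]big1 ?addr0 => [|a /andP[_ /negbTE ->]]; last by rewrite mul0r.
rewrite (eq_bigr (fun s : {perm 'I_r} => (-1) ^+ s * artin_mon (x \o s) a' *
    \prod_(i < r) \prod_(j < r | (i < j)%N) ((x \o s) j - (x \o t) i))) => [|s _]; last first.
  rewrite theta_expand mulr_sumr; apply: eq_bigr => a _.
  by rewrite [in LHS](mulrAC ((-1) ^+ s)) [in RHS]mulrA.
rewrite (bigD1 t) //= [X in _ + X - _]big1 => [|s st].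
  rewrite addr0 -/(vdm (x \o t)) vdm_perm; apply/eqP; rewrite subr_eq0; apply/eqP.
  by rewrite mulrACA -expr2 sqrr_sign mul1r mulrC.
apply/eqP; rewrite mulf_eq0; apply/orP; right.
have [i ti] : exists i : 'I_r, (i < (t * s^-1)%g i)%N.
  apply: NNPP => H; case/eqP: st.
  have /perm_le_eq1 E : forall i, ((t * s^-1)%g i <= i)%N.
    by move=> i; rewrite leqNgt; apply/negP => il; apply: H; exists i.
  by rewrite -[t](mulgKV s) E mul1g.
rewrite (bigD1 i) //= (bigD1 ((t * s^-1)%g i)) //=.
by rewrite permM permKV subrr !mul0r.
Qed.
End VandermondeDual.

(** * Subresultants and discriminants *)

Section Subresultant.
Variable R : comNzRingType.
Implicit Types (f g U V : {poly R}) (n m j : nat).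

Lemma shcoefE f s d : shcoef f s d = ('X^s * f)`_d.
Proof. by rewrite /shcoef coefXnM ltnNge; case: leqP. Qed.

Lemma coefM_shift f U A d : (size U <= A)%N ->
  \sum_(i < A) U`_i * shcoef f i d = (U * f)`_d.
Proof.
move=> sU; have -> : U = \poly_(i < A) U`_i.
  apply/polyP => i; rewrite coef_poly; case: ltnP => // iA.
  by rewrite nth_default // (leq_trans sU).
rewrite poly_def mulr_suml coef_sum; apply: eq_bigr => i _.
rewrite -poly_def coef_poly ltn_ord shcoefE -scalerAl coefZ //.
Qed.

Lemma sum_rev_shift f U A d : (size U <= A)%N ->
  \sum_(0 <= i < A) U`_(A - 1 - i) * shcoef f (A - 1 - i) d = (U * f)`_d.
Proof.
move=> sU; rewrite -(coefM_shift _ _ sU) -(big_mkord xpredT (fun i => U`_i * shcoef f i d)).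
rewrite [RHS]big_nat_rev /= add0n; apply: eq_big_nat => i /andP[_ iA].
by rewrite -subnDA add1n.
Qed.

Definition syl_entry n m j f g (i c : nat) : R :=
  if (i < m - j)%N then shcoef f (m - j - 1 - i) (n + m - j - 1 - c)
  else shcoef g (n - j - 1 - (i - (m - j))) (n + m - j - 1 - c).

Lemma subresE n m j f g : (j <= n)%N -> (j <= m)%N ->
  subres n m j f g =
  \det (\matrix_(i < (m - j) + (n - j), c < (m - j) + (n - j)) syl_entry n m j f g i c).
Proof.
move=> jn jm; rewrite /subres /subresmx.
by have -> : (n + m - j.*2 = (m - j) + (n - j))%N by lia.
Qed.

(** Row vectors correspond to pairs of cofactors of bounded degree: multiplied by the subresultant
    matrix they give the coefficients of U f + V g in the degrees from n + m - j - 1 down to j. *)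
Definition syl_row n m j U V (i : nat) : R :=
  if (i < m - j)%N then U`_(m - j - 1 - i) else V`_(n - j - 1 - (i - (m - j))).

Lemma syl_row_mul n m j f g U V c :
  (size U <= m - j)%N -> (size V <= n - j)%N ->
  \sum_(i < (m - j) + (n - j)) syl_row n m j U V i * syl_entry n m j f g i c =
  (U * f + V * g)`_(n + m - j - 1 - c).
Proof.
move=> sU sV; set d := (n + m - j - 1 - c)%N.
rewrite -(big_mkord xpredT (fun i => syl_row n m j U V i * syl_entry n m j f g i c)).
rewrite (big_cat_nat (n := (m - j)%N)) ?leq_addr //= coefD; congr (_ + _).
  rewrite -(sum_rev_shift _ _ sU); apply: eq_big_nat => i /andP[_ im].
  by rewrite /syl_row /syl_entry im.
rewrite -{1}[(m - j)%N]add0n [((m - j) + (n - j))%N]addnC big_addn addnK.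
rewrite -(sum_rev_shift _ _ sV); apply: eq_big_nat => i /andP[_ im].
by rewrite /syl_row /syl_entry ltnNge leq_addl /= addnK.
Qed.

Lemma syl_row_surj n m j (w : nat -> R) :
  exists U V, [/\ (size U <= m - j)%N, (size V <= n - j)%N &
    forall i, (i < (m - j) + (n - j))%N -> w i = syl_row n m j U V i].
Proof.
exists (\poly_(k < m - j) w (m - j - 1 - k)%N).
exists (\poly_(k < n - j) w (n - j - 1 - k + (m - j))%N).
split; rewrite ?size_poly // => i il; rewrite /syl_row.
case: ltnP => im; rewrite coef_poly.
  have -> : (m - j - 1 - i < m - j)%N by lia.
  by congr w; lia.
have -> : (n - j - 1 - (i - (m - j)) < n - j)%N by lia.
by congr w; lia.
Qed.

Lemma syl_entry_horner n m f g (t : R) i : (size f <= n.+1)%N -> (size g <= m.+1)%N ->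
  (i < m + n)%N ->
  \sum_(c < m + n) syl_entry n m 0 f g i c * t ^+ (m + n - 1 - c) =
  if (i < m)%N then t ^+ (m - 1 - i) * f.[t] else t ^+ (n - 1 - (i - m)) * g.[t].
Proof.
move=> sf sg iN.
have key (q : {poly R}) N : (size q <= N)%N ->
    \sum_(c < N) q`_(N - 1 - c) * t ^+ (N - 1 - c) = q.[t].
  move=> sq; rewrite (horner_coef_wide _ sq) -(big_mkord xpredT (fun i => q`_i * t ^+ i)).
  rewrite [RHS]big_nat_rev /= add0n big_mkord; apply: eq_bigr => k _.
  by rewrite -subnDA add1n.
set s := if (i < m)%N then (m - 1 - i)%N else (n - 1 - (i - m))%N.
set p := if (i < m)%N then f else g.
have sp : (size ('X^s * p)%R <= m + n)%N.
  apply: leq_trans (size_polyMleq _ _) _; rewrite size_polyXn /= /s /p.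
  by case: ifP => im; [move: sf|move: sg]; move: (size _) => l; lia.
have -> : (if (i < m)%N then t ^+ (m - 1 - i) * f.[t] else t ^+ (n - 1 - (i - m)) * g.[t]) =
    ('X^s * p).[t] by rewrite hornerM hornerXn /s /p; case: ifP.
rewrite -(key _ _ sp); apply: eq_bigr => c _; congr (_ * _).
rewrite /syl_entry !subn0 [(n + m)%N]addnC /s /p.
by case: ifP => _; rewrite shcoefE.
Qed.
End Subresultant.

Lemma det_kernel0 (K : fieldType) N (A : 'M[K]_N) (w : 'rV_N) : w != 0 -> w *m A = 0 -> \det A = 0.
Proof. by move=> w0 wA; apply/eqP/det0P; exists w. Qed.

Section FPoly.
Variables (R : comNzRingType) (r : nat) (a : 'I_r -> R).

Lemma fpoly_coef (j : 'I_r) : (fpoly a)`_j = a j.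
Proof.
rewrite /fpoly coefD coefXn ltn_eqF // add0r coef_sum (bigD1 j) //=.
rewrite coefZ coefXn eqxx mulr1 big1 ?addr0 // => i ij.
by rewrite coefZ coefXn eq_sym (inj_eq val_inj) (negbTE ij) mulr0.
Qed.

Lemma size_fpoly_tail : (size (\sum_(j < r) a j *: 'X^j : {poly R})%R <= r)%N.
Proof.
apply: (leq_trans (size_sum _ _ _)); apply/bigmax_leqP => j _.
by apply: leq_trans (size_scale_leq _ _) _; rewrite size_polyXn.
Qed.

Lemma size_fpoly : size (fpoly a) = r.+1.
Proof. by rewrite /fpoly size_polyDl size_polyXn // ltnS size_fpoly_tail. Qed.

Lemma fpoly_monic : fpoly a \is monic.
Proof.
rewrite monicE /lead_coef size_fpoly /= /fpoly coefD coefXn eqxx.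
by rewrite [X in _ + X]nth_default ?addr0 // size_fpoly_tail.
Qed.

Lemma size_fpoly_deriv : (size (fpoly a)^`() <= r)%N.
Proof.
rewrite -ltnS -size_fpoly lt_size_deriv //; apply: contraTneq fpoly_monic => ->.
by rewrite monicE lead_coef0 eq_sym oner_eq0.
Qed.

Lemma fpoly_eqP (p : {poly R}) : p \is monic -> size p = r.+1 ->
  (forall j : 'I_r, p`_j = a j) -> p = fpoly a.
Proof.
move=> pm sp pa; apply/polyP => i; case: (ltngtP i r) => ir.
- by rewrite (pa (Ordinal ir)) (fpoly_coef (Ordinal ir)).
- by rewrite !nth_default // ?size_fpoly ?sp.
- by have := monicP pm; have := monicP fpoly_monic; rewrite /lead_coef sp size_fpoly ir /= => -> ->.
Qed.
End FPoly.

Lemma map_fpoly (R S : comNzRingType) (h : {rmorphism R -> S}) r (a : 'I_r -> R) :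
  map_poly h (fpoly a) = fpoly (h \o a).
Proof.
rewrite /fpoly rmorphD /= map_polyXn rmorph_sum /=; congr (_ + _).
by apply: eq_bigr => j _; rewrite map_polyZ /= map_polyXn.
Qed.

Lemma map_shcoef (R S : comNzRingType) (h : {rmorphism R -> S}) p s d :
  h (shcoef p s d) = shcoef (map_poly h p) s d.
Proof. by rewrite /shcoef coef_map; case: ifP => // _; rewrite rmorph0. Qed.

Lemma map_subres (R S : comNzRingType) (h : {rmorphism R -> S}) n m j f g :
  h (subres n m j f g) = subres n m j (map_poly h f) (map_poly h g).
Proof.
rewrite /subres -det_map_mx; congr (\det _); apply/matrixP => i c; rewrite !mxE.
by case: ifP => _; rewrite map_shcoef.
Qed.

Lemma map_Disc (R S : comNzRingType) (h : {rmorphism R -> S}) r (a : 'I_r -> R) :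
  h (Disc a) = Disc (h \o a).
Proof. by rewrite /Disc map_subres -deriv_map map_fpoly. Qed.

Lemma map_Subdisc (R S : comNzRingType) (h : {rmorphism R -> S}) r (a : 'I_r -> R) :
  h (Subdisc a) = Subdisc (h \o a).
Proof. by rewrite /Subdisc map_subres -deriv_map map_fpoly. Qed.

Section DiscriminantRoots.
Variables (R : idomainType) (n : nat) (x : 'I_n.+1 -> R) (a : 'I_n.+1 -> R).
Hypothesis a_roots : fpoly a = \prod_i ('X - (x i)%:P).
Let f := fpoly a.

Lemma fpoly_root i : f.[x i] = 0.
Proof. by rewrite /f a_roots (bigD1 i) //= hornerM hornerXsubC subrr mul0r. Qed.

Lemma fpoly_deriv_root i : f^`().[x i] = \prod_(j | j != i) (x i - x j).
Proof.
rewrite /f a_roots (bigD1 i) //= derivM derivXsubC mul1r hornerD hornerM.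
by rewrite hornerXsubC subrr mul0r addr0 horner_prod; apply: eq_bigr => j _; rewrite hornerXsubC.
Qed.

(* Multiplying the Sylvester matrix by the powers of the roots makes it block
   triangular. *)
Lemma Disc_prod : injective x -> Disc a = \prod_i f^`().[x i].
Proof.
move=> x_inj; rewrite /Disc /= subresE // !subn0 -/f.
set E := syl_entry _ _ _ _ _.
set M : 'M_(n + n.+1) := \matrix_(i, c) E i c.
pose Q12 := \matrix_(i < n, k < n.+1) x k ^+ (n + n.+1 - 1 - i).
pose V := \matrix_(i < n.+1, k < n.+1) x k ^+ (n - i).
pose D := diag_mx (\row_k f^`().[x k]).
pose Q := block_mx 1%:M Q12 0 V.
have EH i k : (i < n + n.+1)%N -> \sum_(c < n + n.+1) E i c * x k ^+ (n + n.+1 - 1 - c) =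
    if (i < n)%N then 0 else x k ^+ (n - (i - n)) * f^`().[x k].
  move=> il; rewrite syl_entry_horner // ?size_fpoly ?size_fpoly_deriv // fpoly_root mulr0.
  by rewrite subn1.
have V0 : \det V != 0.
  have -> : V = row_perm (perm (@rev_ord_inj n.+1)) (Vandermonde n.+1 (\row_k x k)).
    by apply/matrixP => i k; rewrite !mxE permE /= subSS.
  rewrite row_permE det_mulmx det_perm mulf_neq0 ?signr_eq0 //.
  by rewrite -vdm_det vdm_neq0.
have MQ : M *m Q = block_mx (ulsubmx M) 0 (dlsubmx M) (V *m D).
  rewrite -{1}[M]submxK mulmx_block !mulmx1 !mulmx0 !addr0.
  have EHs (i : 'I_(n + n.+1)) k : \sum_(c < n) E i c * x k ^+ (n + n.+1 - 1 - c) +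
      \sum_(c < n.+1) E i (n + c)%N * x k ^+ (n - c) =
      if (i < n)%N then 0 else x k ^+ (n - (i - n)) * f^`().[x k].
    rewrite -(EH i k (ltn_ord i)) big_split_ord /=; congr (_ + _).
    by apply: eq_bigr => c _; congr (_ * _ ^+ _); lia.
  congr block_mx; apply/matrixP => i k; rewrite !mxE.
    have E1 := EHs (lshift n.+1 i) k; rewrite /= ltn_ord in E1; rewrite -[RHS]E1.
    by congr (_ + _); apply: eq_bigr => c _; rewrite !mxE.
  have := EHs (rshift n i) k; rewrite /= ltnNge leq_addr /= addKn => EE.
  transitivity (x k ^+ (n - i) * f^`().[x k]).
    by rewrite -EE; congr (_ + _); apply: eq_bigr => c _; rewrite !mxE.
  rewrite (bigD1 k) //= !mxE eqxx mulr1n big1 ?addr0 // => l lk.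
  by rewrite !mxE (negbTE lk) mulr0n mulr0.
(* This block holds the coefficients of the shifts of f in degrees above n; f is monic of degree n +
   1, so the block is unitriangular. *)
have T1 : \det (ulsubmx M) = 1.
  rewrite -det_tr det_trig.
    rewrite big1 // => i _; rewrite !mxE /= /E /syl_entry subn0 ltn_ord shcoefE coefXnM.
    rewrite ifF; last by have := ltn_ord i; lia.
    have -> : (n.+1 + n - 0 - 1 - i - (n - 1 - i) = n.+1)%N by have := ltn_ord i; lia.
    by have := monicP (fpoly_monic a); rewrite /lead_coef size_fpoly.
  apply/is_trig_mxP => i k ik; rewrite !mxE /= /E /syl_entry subn0 ltn_ord shcoefE coefXnM.
  rewrite ifF; last by have := ltn_ord k; lia.
  by rewrite nth_default // size_fpoly; have := ltn_ord k; lia.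
have := congr1 determinant MQ.
rewrite det_mulmx det_ublock det1 mul1r det_lblock T1 mul1r det_mulmx mulrC => /(mulfI V0) ->.
by rewrite det_diag; apply: eq_bigr => k _; rewrite mxE.
Qed.
End DiscriminantRoots.

(** The number of pairs i < j, one sign for each. *)
Definition vdm_sign r : nat := (\sum_(i < r) (r - i.+1))%N.

Lemma prod_diff_vdm (R : comNzRingType) r (x : 'I_r -> R) :
  \prod_i \prod_(j | j != i) (x i - x j) = (-1) ^+ vdm_sign r * vdm x ^+ 2.
Proof.
have E (i : 'I_r) : \prod_(j | j != i) (x i - x j) =
    (-1) ^+ (r - i.+1) * \prod_(j < r | (i < j)%N) (x j - x i) * \prod_(j < r | (j < i)%N) (x i - x j).
  rewrite (bigID (fun j : 'I_r => (i < j)%N)) /=; congr (_ * _).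
    rewrite -(card_gt_ord r i) -prodrN; apply: eq_big => [j|j _]; last by rewrite opprB.
    by rewrite andb_idl //; apply: contraTneq => ->; rewrite ltnn.
  by apply: eq_bigl => j; rewrite -leqNgt ltn_neqAle.
rewrite (eq_bigr _ (fun i _ => E i)) !big_split /= -expr_sum -mulrA; congr (_ * _).
rewrite expr2; congr (_ * _); rewrite [LHS](exchange_big_dep xpredT) //=.
Qed.

(** The powers of a double root form a kernel vector. Over a ring this only says, through the
    adjugate, that the determinant kills every entry; the last entry is t^0 = 1. *)
Lemma Disc_double (R : comNzRingType) n (a : 'I_n.+1 -> R) t :
  (fpoly a).[t] = 0 -> (fpoly a)^`().[t] = 0 -> Disc a = 0.
Proof.
move=> ft dft; rewrite /Disc /= subresE // !subn0.
set M := \matrix_(i, c) _.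
pose v : 'cV[R]_(n + n.+1) := \col_c t ^+ (n + n.+1 - 1 - c).
have Mv : M *m v = 0.
  apply/colP => i; rewrite !mxE.
  have := @syl_entry_horner _ n.+1 n (fpoly a) (fpoly a)^`() t i.
  rewrite size_fpoly size_fpoly_deriv ltn_ord ft dft !mulr0 if_same => /(_ (ltnSn _) isT isT) E.
  by rewrite -[RHS]E; apply: eq_bigr => c _; rewrite !mxE.
have lN : (n + n < n + n.+1)%N by rewrite addnS.
have : (\adj M *m M) *m v = 0 by rewrite -mulmxA Mv mulmx0.
rewrite mul_adj_mx mul_scalar_mx => /colP/(_ (Ordinal lN)); rewrite !mxE /=.
have -> : (n + n.+1 - 1 - (n + n) = 0)%N by lia. by rewrite mulr1.
Qed.

Lemma Disc_vdm (R : idomainType) n (x a : 'I_n.+1 -> R) :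
  fpoly a = \prod_i ('X - (x i)%:P) -> Disc a = (-1) ^+ vdm_sign n.+1 * vdm x ^+ 2.
Proof.
move=> ax; have [/injectiveP xi|/injectiveP xi] := boolP (injectiveb x).
  rewrite (Disc_prod ax xi) -prod_diff_vdm; apply: eq_bigr => i _; exact: fpoly_deriv_root.
have [i [j [ij xij]]] : exists i j, i != j /\ x i = x j.
  apply: NNPP => H; apply: xi => i j xij; apply/eqP; apply: contra_notT H => ij.
  by exists i, j.
rewrite (Disc_double (t := x i)); first last.
- by rewrite (fpoly_deriv_root ax) (bigD1 j) 1?eq_sym //= xij subrr mul0r.
- exact: (fpoly_root ax).
apply/eqP; rewrite eq_sym mulf_eq0 signr_eq0 /= expf_eq0 /=.
have [i1 [j1 [ij1 xij1]]] : exists i j : 'I_n.+1, (i < j)%N /\ x i = x j.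
  by move: ij; rewrite -val_eqE neq_ltn => /orP[ij|ij]; [exists i, j|exists j, i].
by rewrite /vdm (bigD1 i1) //= (bigD1 j1) //= xij1 subrr !mul0r.
Qed.

Lemma syl_row_eq0 (R : comNzRingType) n m j (U V : {poly R}) :
  (size U <= m - j)%N -> (size V <= n - j)%N ->
  (forall i, (i < (m - j) + (n - j))%N -> syl_row n m j U V i = 0) -> U = 0 /\ V = 0.
Proof.
move=> sU sV H; split; apply/polyP => k; rewrite coef0.
  have [kU|Uk] := ltnP k (m - j); last by rewrite nth_default // (leq_trans sU).
  have := H (m - j - 1 - k)%N; rewrite /syl_row ifT; last lia.
  have -> : (m - j - 1 - (m - j - 1 - k) = k)%N by lia.
  by apply; lia.
have [kV|Vk] := ltnP k (n - j); last by rewrite nth_default // (leq_trans sV).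
have := H ((m - j) + (n - j - 1 - k))%N; rewrite /syl_row ifF; last lia.
have -> : (n - j - 1 - (m - j + (n - j - 1 - k) - (m - j)) = k)%N by lia.
by apply; lia.
Qed.

(** Writing f = u d and f' = v d, the relation v f - u f' = 0 is a kernel row of the first
    subresultant matrix: as d has degree 2, the cofactors are short enough. *)
Lemma Subdisc_common_factor (K : fieldType) n (a : 'I_n.+2 -> K) (d : {poly K}) : size d = 3%N ->
  d %| fpoly a -> d %| (fpoly a)^`() -> Subdisc a = 0.
Proof.
move=> sd /dvdpP[u fE] /dvdpP[v gE]; rewrite /Subdisc /= subresE // .
have d0 : d != 0 by rewrite -size_poly_gt0 sd.
have u0 : u != 0.
  by apply: contraTneq (fpoly_monic a) => u0; rewrite fE u0 mul0r monicE lead_coef0 eq_sym oner_eq0.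
have su : size u = n.+1.
  by have := size_fpoly a; rewrite fE size_mul // sd; move: (size u) => s; lia.
have sv : (size v <= n.+1 - 1)%N.
  have [->|v0] := eqVneq v 0; first by rewrite size_poly0.
  have := size_fpoly_deriv a; rewrite gE size_mul // sd; move: (size v) => s; lia.
have su' : (size (- u)%R <= n.+2 - 1)%N by rewrite size_polyN su; lia.
apply: (@det_kernel0 _ _ _ (\row_i syl_row n.+2 n.+1 1 v (- u) i)).
  apply: contra u0 => /eqP/rowP H; rewrite -oppr_eq0.
  have [|_ ->] // := syl_row_eq0 sv su' _.
  by move=> i il; have := H (Ordinal il); rewrite !mxE.
apply/rowP => c; rewrite !mxE.
have E0 : v * fpoly a + (- u) * (fpoly a)^`() = 0 by rewrite gE fE; ring.
transitivity ((v * fpoly a + (- u) * (fpoly a)^`())`_(n.+2 + n.+1 - 1 - 1 - c)).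
  by rewrite -(syl_row_mul _ _ _ sv su'); apply: eq_bigr => i _; rewrite !mxE.
by rewrite E0 coef0.
Qed.

(** * The discriminant along a line in the direction of one coefficient *)

Section LineDerivative.
Variables (K : fieldType) (n : nat) (a : 'I_n.+2 -> K) (k : 'I_n.+2) (t : K).
Let f := fpoly a.
Variables (f1 f2 : {poly K}).
Hypothesis fE : f = f1 * ('X - t%:P).
Hypothesis dfE : f^`() = f2 * ('X - t%:P).
Hypothesis f1t : f1.[t] = 0.
Hypothesis t0 : t != 0.
Hypothesis f12 : coprimep f1 f2.

Definition line_coef (j : 'I_n.+2) : {poly K} := (a j)%:P + (if j == k then 'X else 0).
Let fs := fpoly line_coef.

Lemma fs_expand : fs = map_poly polyC f + ('X)%:P * 'X^k.
Proof.
rewrite /fs /f map_fpoly /fpoly -addrA; congr (_ + _).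
have -> : ('X)%:P * 'X^k = \sum_(j < n.+2) (if j == k then 'X else 0) *: 'X^j :> {poly {poly K}}.
  rewrite (bigD1 k) //= eqxx big1 ?addr0 => [|j /negbTE ->]; last by rewrite scale0r.
  by rewrite mul_polyC.
by rewrite -big_split; apply: eq_bigr => j _; rewrite /= scalerDl.
Qed.

Lemma fs_horner : fs.[t%:P] = 'X * (t ^+ k)%:P.
Proof.
rewrite fs_expand hornerD horner_map /= fE hornerM hornerXsubC subrr mulr0 add0r.
by rewrite hornerM hornerC hornerXn polyC_exp.
Qed.

Lemma fs_deriv_horner : fs^`().[t%:P] = 'X * (t ^+ k.-1 *+ k)%:P.
Proof.
rewrite fs_expand derivD deriv_map hornerD horner_map /= dfE hornerM hornerXsubC subrr mulr0 add0r.
by rewrite derivM derivC mul0r add0r derivXn hornerM hornerC hornerMn hornerXn polyCMn polyC_exp.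
Qed.

(** The derivative along the line of the column of values at t: moving a_k by s changes f(t) by s
    t^k and f'(t) by s k t^(k-1), and row i carries a further power of t. *)
Definition line_col (i : nat) : K :=
  if (i < n.+1)%N then t ^+ (n.+1 - 1 - i) * t ^+ k
  else t ^+ (n.+2 - 1 - (i - n.+1)) * (t ^+ k.-1 *+ k).

(** A unipotent column operation replaces the last column of the Sylvester matrix by the values at t
    of its rows. Since t is a double root at parameter 0, that column is divisible by 'X. *)
Lemma Disc_line_factor : exists d : {poly K}, Disc line_coef = d * 'X /\
  d.[0] = \det (\matrix_(i < n.+1 + n.+2, c < n.+1 + n.+2)
     if (c == n.+1 + n.+1 :> nat)%N then line_col i else syl_entry n.+2 n.+1 0 f f^`() i c).
Proof.
pose N := (n.+1 + n.+2)%N.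
pose Es := syl_entry n.+2 n.+1 0 fs fs^`().
pose Ms : 'M[{poly K}]_N := \matrix_(i < N, c < N) Es i c.
pose Ns : 'M[{poly K}]_N := \matrix_(i < N, c < N)
  if (c == n.+1 + n.+1 :> nat)%N then (line_col i)%:P else Es i c.
pose T : 'M[{poly K}]_N := \matrix_(i < N, c < N)
  if (c == n.+1 + n.+1 :> nat)%N then t%:P ^+ (N - 1 - i) else (i == c)%:R.
pose D : 'M[{poly K}]_N := diag_mx (\row_c if (c == n.+1 + n.+1 :> nat)%N then 'X else 1).
have lN : (n.+1 + n.+1 < N)%N by rewrite /N ltn_add2l.
pose L := Ordinal lN.
have MT : Ms *m T = Ns *m D.
  apply/matrixP => i c; rewrite mxE [RHS]mxE.
  have [cL|cL] := eqVneq (c : nat) (n.+1 + n.+1)%N.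
    have -> : c = L by apply: val_inj.
    rewrite [RHS](bigD1 L) //= [X in _ = _ + X]big1 ?addr0 => [|l lL]; last first.
      by rewrite !mxE (negbTE lL) mulr0n mulr0.
    rewrite !mxE /= !eqxx mulr1n.
    transitivity (\sum_(c < n.+1 + n.+2) Es i c * t%:P ^+ (n.+1 + n.+2 - 1 - c)).
      apply: eq_bigr => l _; rewrite !mxE /=. by rewrite eqxx.
    rewrite syl_entry_horner // ?size_fpoly ?size_fpoly_deriv // fs_horner fs_deriv_horner.
    by rewrite /line_col; case: ifP => _; rewrite -!polyC_exp polyCM; ring.
  rewrite [LHS](bigD1 c) //= [RHS](bigD1 c) //= !big1 ?addr0.
  - by rewrite !mxE (negbTE cL) eqxx mulr1n.
  - by move=> l lc; rewrite !mxE (negbTE lc) mulr0n mulr0.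
  - by move=> l lc; rewrite !mxE (negbTE cL) (negbTE lc) mulr0.
have detT : \det T = 1.
  rewrite -det_tr det_trig.
    rewrite big1 // => i _; rewrite !mxE; case: eqP => [->|_]; last by rewrite eqxx.
    by have -> : (N - 1 - (n.+1 + n.+1) = 0)%N by rewrite /N; lia.
  apply/is_trig_mxP => i c ic; rewrite !mxE ifF.
    by rewrite -val_eqE gtn_eqF.
  have cN : (c < n.+1 + n.+2)%N by exact: ltn_ord.
  apply/negbTE; rewrite neq_ltn (leq_trans ic) //; move: cN; rewrite !addnS ltnS; exact.
have detD : \det D = 'X.
  rewrite det_diag (bigD1 L) //= mxE eqxx big1 ?mulr1 // => c cL.
  by rewrite mxE ifF //; apply: contraNF cL => /eqP E; apply/eqP/val_inj.
exists (\det Ns); split.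
  have := congr1 determinant MT; rewrite !det_mulmx detT detD mulr1 => <-.
  by rewrite /Disc /= subresE.
rewrite -[_.[0]]/(horner_eval 0 (\det Ns)) -det_map_mx; congr (\det _).
have map0 : map_poly (horner_eval 0) fs = f.
  rewrite /fs map_fpoly; congr (fpoly _); apply: functional_extensionality => j /=.
  by rewrite /horner_eval hornerD hornerC; case: eqP; rewrite ?hornerX ?horner0 addr0.
apply/matrixP => i c; rewrite !mxE; case: ifP => _; first by rewrite /= /horner_eval hornerC.
rewrite /Es /syl_entry -map0 deriv_map -!map_shcoef.
by case: ifP.
Qed.

(** Otherwise the matrix of [Disc_line_factor] has a kernel row (U, V). Its columns other than the
    last make U f + V f' constant, and evaluation at t makes it zero, so U f1 + V f2 = 0. By
    coprimality and degrees, V = e f1 and U = - e f2 with a constant e. The last column then reads e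
    f2(t) t^k = 0, whence e = 0. *)
Lemma Disc_line_simple : ~ divides ('X ^+ 2) (Disc line_coef).
Proof.
case=> c; have [d [-> dE]] := Disc_line_factor.
rewrite expr2 mulrA => /(mulIf (negbT (polyX_eq0 _))) dc.
move: dE; rewrite dc hornerM hornerX mulr0 => /esym/eqP/det0P[w w0 wN]; case/eqP: w0.
pose wn k := if insub k is Some i then w 0 i else 0.
have wnE (i : 'I_(n.+1 + n.+2)) : wn i = w 0 i by rewrite /wn valK.
have [U [V [sU sV wE]]] := syl_row_surj n.+2 n.+1 0 wn.
pose h := U * f + V * f^`().
have h_coef l : (0 < l)%N -> h`_l = 0.
  move=> l0; have [lN|lN] := leqP l (n.+1 + n.+1); last first.
    apply: nth_default; apply: leq_trans (size_polyD _ _) _; rewrite geq_max.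
    apply/andP; split; (apply: leq_trans (size_polyMleq _ _) _).
      have := size_fpoly a; rewrite -/f => ->; move: sU; move: (size U) => s; lia.
    by have := size_fpoly_deriv a; rewrite -/f; move: sV; move: (size V) (size f^`()) => s s'; lia.
  have lc : (n.+1 + n.+1 - l < n.+1 + n.+2)%N by lia.
  have := syl_row_mul f f^`() (n.+1 + n.+1 - l) sU sV.
  have -> : (n.+2 + n.+1 - 0 - 1 - (n.+1 + n.+1 - l) = l)%N by lia.
  rewrite -/h => <-; rewrite !subn0.
  have /rowP/(_ (Ordinal lc)) := wN; rewrite !mxE => E; rewrite -[RHS]E.
  apply: eq_bigr => i _; rewrite !mxE /= ifF; last by apply/negbTE; lia.
  by rewrite -wE ?subn0 // wnE.
have h0 : h = 0.
  have hC : h = (h`_0)%:P by apply/polyP => -[|l]; rewrite coefC //= h_coef.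
  have : h.[t] = 0.
    by rewrite /h hornerD !hornerM dfE fE !hornerM hornerXsubC subrr !mulr0 addr0.
  by rewrite hC hornerC => ->.
have rel : U * f1 + V * f2 = 0.
  apply: (mulIf (_ : 'X - t%:P != 0)); first by rewrite polyXsubC_eq0.
  by rewrite mul0r -h0 /h dfE fE; ring.
have f10 : f1 != 0.
  by apply: contraTneq (fpoly_monic a) => f10; rewrite -/f fE f10 mul0r monicE lead_coef0 eq_sym oner_eq0.
have sf1 : size f1 = n.+2.
  by have := size_fpoly a; rewrite -/f fE size_Mmonic ?monicXsubC // size_XsubC; move: (size f1) => s; lia.
have /dvdpP[e VE] : f1 %| V.
  rewrite -(Gauss_dvdpl _ f12); apply/dvdpP; exists (- U).
  by apply/eqP; rewrite mulNr -subr_eq0 opprK addrC rel.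
(* [V] has degree at most n + 1, which is the degree of [f1]. *)
have se : (size e <= 1)%N.
  have [->|e0] := eqVneq e 0; first by rewrite size_poly0.
  by move: sV; rewrite VE size_mul // sf1; move: (size e) => s; lia.
have UE : U = - e * f2.
  apply: (mulIf f10); apply/eqP; rewrite -subr_eq0; apply/eqP; rewrite -rel VE; ring.
have f2t : f2.[t] != 0.
  apply/negP => /eqP f2t; have := coprimep_root f12; move=> /(_ t).
  by rewrite /root f1t f2t eqxx => /(_ isT).
have U_col (A : {poly K}) l : (size A <= l)%N -> \sum_(0 <= i < l) A`_(l - 1 - i) * t ^+ (l - 1 - i) = A.[t].
  move=> sA; rewrite (horner_coef_wide _ sA) -(big_mkord xpredT (fun i => A`_i * t ^+ i)).
  by rewrite [RHS]big_nat_rev /= add0n; apply: eq_big_nat => i /andP[_ il]; rewrite -subnDA add1n.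
pose G i := syl_row n.+2 n.+1 0 U V i * line_col i.
have G1 : \sum_(0 <= i < n.+1) G i = U.[t] * t ^+ k.
  rewrite -(U_col U n.+1 sU) mulr_suml; apply: eq_big_nat => i /andP[_ il].
  by rewrite /G /syl_row /line_col !subn0 il -!mulrA.
have G2 : \sum_(n.+1 <= i < n.+1 + n.+2) G i = V.[t] * (t ^+ k.-1 *+ k).
  rewrite -{1}[n.+1]add0n [(n.+1 + n.+2)%N]addnC big_addn addnK.
  rewrite -(U_col V n.+2 sV) mulr_suml; apply: eq_big_nat => i /andP[_ il].
  by rewrite /G /syl_row /line_col !subn0 ltnNge leq_addl /= addnK -!mulrA.
have last0 : U.[t] * t ^+ k + V.[t] * (t ^+ k.-1 *+ k) = 0.
  have lN : (n.+1 + n.+1 < n.+1 + n.+2)%N by rewrite ltn_add2l.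
  rewrite -G1 -G2 -big_cat_nat ?leq_addr //= big_mkord.
  have /rowP/(_ (Ordinal lN)) := wN; rewrite !mxE => E; rewrite -[RHS]E.
  by apply: eq_bigr => i _; rewrite !mxE /= eqxx /G -wE ?subn0 // wnE.
move: last0; rewrite VE hornerM f1t mulr0 mul0r addr0 UE hornerM hornerN => /eqP.
rewrite !mulf_eq0 oppr_eq0 (negbTE f2t) orbF expf_eq0 (negbTE t0) andbF orbF => /eqP et.
have e0 : e = 0 by move: et; rewrite (size1_polyC se) hornerC => ->.
apply/rowP => i; rewrite mxE -wnE wE ?subn0 // /syl_row VE UE e0 oppr0 !mul0r !coef0.
by case: ifP.
Qed.
End LineDerivative.

(** * The cone over the space of coefficients *)

Lemma alg_closed_split (K : fieldType) (p : {poly K}) n : alg_closed K -> p \is monic ->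
  size p = n.+1 -> exists x : 'I_n -> K, p = \prod_i ('X - (x i)%:P).
Proof.
move=> Kclosed; elim: n p => [|n IH] p pm sp.
  exists (fun _ => 0); rewrite big_ord0; move/eqP: sp => /size_poly1P[c c0 pE].
  by move: pm; rewrite pE monicE lead_coefC => /eqP ->.
have [|t /factor_theorem[q pE]] := Kclosed p; first by rewrite sp.
have qm : q \is monic by rewrite -(monicMr _ (monicXsubC t)) -pE.
have sq : size q = n.+1.
  by move: sp; rewrite pE size_Mmonic ?monicXsubC ?monic_neq0 // size_XsubC addn2 => -[].
have [x qE] := IH q qm sq.
exists (fun i => if unlift ord0 i is Some j then x j else t).
rewrite big_ord_recl unlift_none pE qE mulrC; congr (_ * _).
by apply: eq_bigr => i _; rewrite liftK.
Qed.

Lemma prod_XsubC_perm (K : fieldType) r (x y : 'I_r -> K) :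
  \prod_i ('X - (x i)%:P) = \prod_i ('X - (y i)%:P) -> exists s : {perm 'I_r}, y = x \o s.
Proof.
move=> E; pose tx := [tuple x i | i < r]; pose ty := [tuple y i | i < r].
have : perm_eq ty tx.
  apply: prod_XsubC_eq; rewrite !big_tuple.
  rewrite (eq_bigr (fun i => 'X - (y i)%:P)) => [|i _]; last by rewrite tnth_mktuple.
  by rewrite -E; apply: eq_bigr => i _; rewrite tnth_mktuple.
case/tuple_permP => s ys; exists s; apply: functional_extensionality => i /=.
have -> : y i = tnth ty i by rewrite tnth_mktuple.
have -> : ty = [tuple tnth tx (s i) | i < r] by apply: val_inj.
by rewrite !tnth_mktuple.
Qed.

Section RootCoordinates.
Variables (K : fieldType) (r : nat).
Implicit Types (x : 'I_r.+1 -> K) (s t : {perm 'I_r}).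

(** Coordinate 0 is the homogenizing variable; the remaining ones are read as the roots of a
    polynomial of degree r. *)
Definition rpt x : 'I_r -> K := fun i => x (lift ord0 i).

Definition coefA (j : 'I_r) : {mpoly K[r.+1]} :=
  (-1) ^+ (r - j) *: msubst (fun i => 'X_(lift ord0 i)) (mesym r K (r - j)).

Definition coef_at x (j : 'I_r) : K := (coefA j).@[x].

Lemma coef_at_mesym x j : coef_at x j = (-1) ^+ (r - j) * (mesym r K (r - j)).@[rpt x].
Proof.
rewrite /coef_at mevalZ meval_msubst; congr (_ * _); apply: meval_eq => i.
by rewrite mevalXU.
Qed.

Lemma fpoly_coef_at x : fpoly (coef_at x) = \prod_i ('X - (rpt x i)%:P).
Proof.
symmetry; apply: fpoly_eqP.
- by apply: rpred_prod => i _; apply: monicXsubC.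
- by rewrite size_prod_XsubC /index_enum -enumT size_enum_ord.
move=> j; rewrite coef_at_mesym.
pose cs := [tuple rpt x i | i < r].
have kr : (r - j < r.+1)%N by rewrite ltnS leq_subr.
have H : (\prod_(c <- cs) ('X - c%:P))`_j = (-1) ^+ (r - j) * (mesym r K (r - j)).@[tnth cs].
  by rewrite -(mroots_coeff cs (Ordinal kr)) subKn // ltnW.
have -> : \prod_i ('X - (rpt x i)%:P) = \prod_(c <- cs) ('X - c%:P).
  by rewrite big_tuple; apply: eq_bigr => i _; rewrite tnth_mktuple.
by rewrite H; congr (_ * _); apply: meval_eq => i; rewrite tnth_mktuple.
Qed.

Definition act s x : 'I_r.+1 -> K :=
  fun i => if unlift ord0 i is Some j then x (lift ord0 (s j)) else x ord0.

Lemma act0 s x : act s x ord0 = x ord0.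
Proof. by rewrite /act unlift_none. Qed.

Lemma rpt_act s x : rpt (act s x) = rpt x \o s.
Proof. by apply: functional_extensionality => i; rewrite /rpt /act /= liftK. Qed.

Lemma pt_ext x y : x ord0 = y ord0 -> rpt x = rpt y -> x = y.
Proof.
move=> E0 E; apply: functional_extensionality => i.
by case: (unliftP ord0 i) => [j ->|->] //; rewrite -/(rpt x j) E.
Qed.

Lemma actM s t x : act s (act t x) = act (s * t) x.
Proof.
apply: pt_ext; first by rewrite !act0.
by rewrite !rpt_act; apply: functional_extensionality => i /=; rewrite permM.
Qed.

Lemma act1 x : act 1 x = x.
Proof.
apply: pt_ext; first by rewrite act0.
by rewrite rpt_act; apply: functional_extensionality => i /=; rewrite perm1.
Qed.

Lemma coef_at_act s x : coef_at (act s x) = coef_at x.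
Proof.
apply: functional_extensionality => j.
have E : fpoly (coef_at (act s x)) = fpoly (coef_at x).
  by rewrite !fpoly_coef_at rpt_act /= [RHS](reindex_inj (@perm_inj _ s)).
by rewrite -[LHS]fpoly_coef -[RHS]fpoly_coef E.
Qed.

Definition act_poly s : {mpoly K[r.+1]} -> {mpoly K[r.+1]} :=
  msubst (fun i => if unlift ord0 i is Some j then 'X_(lift ord0 (s j)) else 'X_ord0).

Lemma meval_act s x p : (act_poly s p).@[x] = p.@[act s x].
Proof.
rewrite /act_poly meval_msubst; apply: meval_eq => i; rewrite /act.
by case: unlift => [j|]; rewrite mevalXU.
Qed.

Definition rootX (i : 'I_r) : {mpoly K[r.+1]} := 'X_(lift ord0 i).

Lemma meval_artin_mon x s a : (artin_mon (rootX \o s) a).@[x] = artin_mon (rpt x \o s) a.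
Proof.
rewrite /artin_mon rmorph_prod; apply: eq_bigr => i _.
by rewrite rmorphXn /= mevalXU.
Qed.

Lemma meval_artin_mon1 x a : (artin_mon rootX a).@[x] = artin_mon (rpt x) a.
Proof.
rewrite /artin_mon rmorph_prod; apply: eq_bigr => i _.
by rewrite rmorphXn /= mevalXU.
Qed.

Lemma meval_vdm x : (vdm rootX).@[x] = vdm (rpt x).
Proof.
rewrite /vdm rmorph_prod; apply: eq_bigr => i _; rewrite rmorph_prod; apply: eq_bigr => j _.
by rewrite rmorphB /= !mevalXU.
Qed.

Lemma meval_theta x s a : (theta (rootX \o s) a).@[x] = theta (rpt x \o s) a.
Proof.
rewrite /theta rmorph_prod; apply: eq_bigr => i _.
have E : map_poly (meval x) (\prod_(j < r | (i < j)%N) (((rootX \o s) j)%:P - 'X)) =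
    \prod_(j < r | (i < j)%N) (((rpt x \o s) j)%:P - 'X).
  rewrite rmorph_prod; apply: eq_bigr => j _.
  by rewrite rmorphB /= map_polyX map_polyC /= mevalXU.
by rewrite -(coef_map (meval x)) /= E.
Qed.

Lemma fpoly_coefA : alg_closed K -> \prod_(j < r) ('X - (rootX j)%:P) = fpoly coefA.
Proof.
move=> Kclosed; apply/polyP => i; apply: (mpoly_eval_inj Kclosed) => x.
suff E : map_poly (meval x) (\prod_(j < r) ('X - (rootX j)%:P)) = map_poly (meval x) (fpoly coefA).
  by rewrite -!(coef_map (meval x)) /= E.
rewrite map_fpoly rmorph_prod /= -[RHS]/(fpoly (coef_at x)) fpoly_coef_at; apply: eq_bigr => j _.
by rewrite rmorphB /= map_polyX map_polyC /= mevalXU.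
Qed.
End RootCoordinates.

Arguments coefA {K r}.
Arguments rootX {K r}.

(* [gam] lists the coefficients [a_j] as polynomials in the coordinates
   [(X_0, y_1, ..., y_N)] of the base, of which [y_l] is the free coefficient
   [a_(e l)]; the cone below is the affine cone over the projective closure. *)
Section ConeDefs.
Variables (K : fieldType) (n N : nat) (e : 'I_N -> 'I_n.+2) (gam : 'I_n.+2 -> {mpoly K[N.+1]}).
Local Notation r := n.+2.

Definition psi (i : 'I_N.+1) : {mpoly K[r.+1]} :=
  if unlift ord0 i is Some l then coefA (e l) else 'X_ord0.

Definition psipt : ('I_r.+1 -> K) -> 'I_N.+1 -> K := mpt psi.

Definition gampt (b : 'I_N.+1 -> K) : 'I_r -> K := fun j => (gam j).@[b].

Definition cone (x : 'I_r.+1 -> K) := coef_at x = gampt (psipt x).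

(** Scaling the roots by t multiplies a_j by t^(r-j); these weights make [psipt] equivariant. *)
Definition base_weight (i : 'I_N.+1) : nat := if unlift ord0 i is Some l then r - e l else 1.

Definition base_scale (t : K) (b : 'I_N.+1 -> K) : 'I_N.+1 -> K :=
  fun i => t ^+ base_weight i * b i.

Record cone_ok : Prop := ConeOk {
  cone_free : forall l, gam (e l) = 'X_(lift ord0 l);
  cone_hom : forall t b j, gampt (base_scale t b) j = t ^+ (r - j) * gampt b j }.

Definition DiscB : {mpoly K[N.+1]} := Disc gam.
Definition SubdiscB : {mpoly K[N.+1]} := Subdisc gam.

Lemma meval_DiscB b : DiscB.@[b] = Disc (gampt b).
Proof. by rewrite /DiscB (map_Disc (meval b)). Qed.

Lemma meval_SubdiscB b : SubdiscB.@[b] = Subdisc (gampt b).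
Proof. by rewrite /SubdiscB (map_Subdisc (meval b)). Qed.

Lemma psipt0 x : psipt x ord0 = x ord0.
Proof. by rewrite /psipt /mpt /psi unlift_none mevalXU. Qed.

Lemma psiptS x l : psipt x (lift ord0 l) = coef_at x (e l).
Proof. by rewrite /psipt /mpt /psi liftK. Qed.

Lemma psipt_act s x : psipt (act s x) = psipt x.
Proof.
apply: functional_extensionality => i; case: (unliftP ord0 i) => [l ->|->].
  by rewrite !psiptS coef_at_act.
by rewrite !psipt0 act0.
Qed.

Lemma cone_act s x : cone x -> cone (act s x).
Proof. by rewrite /cone psipt_act coef_at_act. Qed.

Lemma cone_orbit x y : cone x -> cone y -> psipt x = psipt y -> exists s, y = act s x.
Proof.
move=> cx cy E; have [|s ys] := @prod_XsubC_perm K r (rpt x) (rpt y).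
  by rewrite -!fpoly_coef_at cx cy E.
exists s; apply: pt_ext; first by rewrite act0 -!psipt0 E.
by rewrite rpt_act.
Qed.

Lemma cone_Disc x : cone x -> DiscB.@[psipt x] = (-1) ^+ vdm_sign r * vdm (rpt x) ^+ 2.
Proof. by move=> cx; rewrite meval_DiscB; apply: Disc_vdm; rewrite -cx fpoly_coef_at. Qed.

Lemma aclosed_cone : aclosed cone.
Proof.
exists (fun p => exists j, p = coefA j - msubst psi (gam j)) => x; split=> [cx p [j ->]|H].
  by rewrite mevalB -meval_mpt -[_.@[x]]/(coef_at x j) cx /gampt subrr.
apply: functional_extensionality => j; apply/eqP; rewrite -subr_eq0; apply/eqP.
by rewrite -(H _ (ex_intro _ j erefl)) mevalB -meval_mpt.
Qed.

Hypothesis Kclosed : alg_closed K.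
Hypothesis ok : cone_ok.

Lemma coef_at_onto a t : exists2 x : 'I_r.+1 -> K, coef_at x = a & x ord0 = t.
Proof.
have [y yE] := alg_closed_split Kclosed (fpoly_monic a) (size_fpoly _).
exists (fun i => if unlift ord0 i is Some j then y j else t); last by rewrite unlift_none.
apply: functional_extensionality => j; rewrite -[LHS]fpoly_coef -[RHS]fpoly_coef fpoly_coef_at yE.
suff -> : rpt (fun i => if unlift ord0 i is Some j then y j else t) = y by [].
by apply: functional_extensionality => i; rewrite /rpt liftK.
Qed.

Lemma cone_onto b : exists2 x, cone x & psipt x = b.
Proof.
have [x xA x0] := coef_at_onto (gampt b) (b ord0).
have xb : psipt x = b.
  apply: functional_extensionality => i; case: (unliftP ord0 i) => [l ->|->].
    by rewrite psiptS xA /gampt (cone_free ok) mevalXU.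
  by rewrite psipt0 x0.
by exists x => //; rewrite /cone xb.
Qed.

Lemma coef_at_scale t (x : 'I_r.+1 -> K) j : coef_at (fun i => t * x i) j = t ^+ (r - j) * coef_at x j.
Proof.
rewrite !coef_at_mesym -[rpt (fun i => t * x i)]/(fun i => t * rpt x i).
by rewrite (meval_scale _ _ (dhomog_mesym _ _ (r - j))) mulrCA.
Qed.

Lemma psipt_scale t x : psipt (fun i => t * x i) = base_scale t (psipt x).
Proof.
apply: functional_extensionality => i; rewrite /base_scale /base_weight.
case: (unliftP ord0 i) => [l ->|->].
  by rewrite !psiptS coef_at_scale.
by rewrite !psipt0.
Qed.

Lemma cone_scale t x : cone x -> cone (fun i => t * x i).
Proof.
move=> cx; apply: functional_extensionality => j.
by rewrite coef_at_scale psipt_scale (cone_hom ok) cx.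
Qed.

Lemma msubst_congr a b (I : pset {mpoly K[b]}) (y z : 'I_a -> {mpoly K[b]}) q : is_ideal I ->
  (forall i, I (y i - z i)) -> I (msubst y q - msubst z q).
Proof.
move=> II H; move: q; apply: mpoly_subring_full => [|c|i]; last 2 first.
- by rewrite !msubstC subrr; apply: ideal0.
- by rewrite !msubstX.
split=> [|p q Ip Iq|p q Ip Iq].
- by rewrite !rmorph1 subrr; apply: ideal0.
- rewrite !rmorphB /=.
  have -> : msubst y p - msubst y q - (msubst z p - msubst z q) =
     (msubst y p - msubst z p) - (msubst y q - msubst z q) by ring.
  exact: idealB.
rewrite !rmorphM /=.
have -> : msubst y p * msubst y q - msubst z p * msubst z q =
   msubst y q * (msubst y p - msubst z p) + msubst z p * (msubst y q - msubst z q) by ring.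
by apply: idealD => //; apply: idealM.
Qed.

Definition base_exp (c : {ffun 'I_r -> 'I_r} -> {mpoly K[N.+1]}) : {mpoly K[r.+1]} :=
  \sum_(a | artin a) msubst psi (c a) * artin_mon rootX a.

(** The ideal is left arbitrary because two are needed: the full vanishing ideal of the cone, to
    expand functions, and the ideal of the R_i^h, to prove in [cone_radical] that it is equally
    large. *)
Lemma cone_spanning (I : pset {mpoly K[r.+1]}) p : is_ideal I ->
  (forall j, I (coefA j - msubst psi (gam j))) ->
  exists c, I (p - base_exp c).
Proof.
move=> II HI.
pose chi (i : 'I_r.+1) : {mpoly K[r.+1]} := if unlift ord0 i is Some j then coefA j else 'X_ord0.
pose gam' (i : 'I_r.+1) : {mpoly K[N.+1]} := if unlift ord0 i is Some j then gam j else 'X_ord0.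
(* Spanning is first proved over the ring generated by X_0 and all coefficients; the dependent ones
   are replaced by [gam] only modulo [I]. *)
pose Q : pset {mpoly K[r.+1]} := fun p => exists q, p = msubst chi q.
have QR : is_subring Q.
  split=> [|_ _ [q ->] [q' ->]|_ _ [q ->] [q' ->]].
  - by exists 1; rewrite rmorph1.
  - by exists (q - q'); rewrite rmorphB.
  - by exists (q * q'); rewrite rmorphM.
have Qg i : Q (\prod_(j < r) ('X - (rootX j)%:P))`_i.
  rewrite fpoly_coefA //; case: (ltngtP i r) => ir.
  - rewrite (fpoly_coef _ (Ordinal ir)); exists ('X_(lift ord0 (Ordinal ir))).
    by rewrite msubstX /chi liftK.
  - by rewrite nth_default ?size_fpoly //; apply: subring0.
  - have E := monicP (@fpoly_monic {mpoly K[r.+1]} r coefA).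
    by rewrite /lead_coef size_fpoly /= in E; rewrite ir E; apply: subring1.
have [T TR [QT Tx Tspan]] := artin_spanning QR Qg isT.
have : T p.
  move: p; apply: mpoly_subring_full => // [c|i].
    by apply: QT; exists c%:MP; rewrite msubstC.
  case: (unliftP ord0 i) => [j ->|->]; first exact: Tx.
  by apply: QT; exists 'X_ord0; rewrite msubstX /chi unlift_none.
move=> /Tspan[c [Qc ->]].
have [c' c'E] : exists c' : {ffun 'I_r -> 'I_r} -> {mpoly K[r.+1]}, forall a, c a = msubst chi (c' a).
  have : forall a, exists q, (c a == msubst chi q) by move=> a; have [q ->] := Qc a; exists q.
  by move=> /fin_all_exists[c' c'E]; exists c' => a; apply/eqP.
exists (fun a => msubst gam' (c' a)); rewrite /base_exp -sumrB.
apply: ideal_sum => // a _; rewrite -mulrBl mulrC; apply: idealM => //; rewrite c'E.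
have -> : msubst psi (msubst gam' (c' a)) = msubst (fun i => msubst psi (gam' i)) (c' a).
  apply: (mpoly_eval_inj Kclosed) => x; rewrite !meval_msubst.
  by apply: meval_eq => i; rewrite !meval_msubst.
apply: msubst_congr => // i; rewrite /chi /gam'.
case: unlift => [j|]; first exact: HI.
by rewrite msubstX /psi unlift_none subrr; apply: ideal0.
Qed.

Lemma cone_vanish_gen j : vanish cone (coefA j - msubst psi (gam j)).
Proof.
by move=> x cx; rewrite mevalB -meval_mpt -[_.@[x]]/(coef_at x j) cx /gampt subrr.
Qed.

Lemma cone_spanning_pt p : exists c, forall x, cone x ->
  p.@[x] = \sum_(a | artin a) (c a).@[psipt x] * artin_mon (rpt x) a.
Proof.
have [c Hc] := @cone_spanning (vanish cone) p (vanish_ideal _) cone_vanish_gen.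
exists c => x /Hc; rewrite mevalB => /eqP; rewrite subr_eq0 => /eqP ->.
rewrite /base_exp raddf_sum; apply: eq_bigr => a _.
by rewrite /= mevalM -meval_mpt meval_artin_mon1.
Qed.

Hypothesis Disc0 : DiscB != 0.

Lemma cone_generic b : DiscB.@[b] != 0 -> exists x, [/\ cone x, psipt x = b & injective (rpt x)].
Proof.
have [x cx <-] := cone_onto b; rewrite cone_Disc // mulf_eq0 signr_eq0 /= expf_eq0 /= => v0.
exists x; split=> // i j xij; apply/eqP; apply: contraNT v0 => ij.
have [i1 [j1 [ij1 xij1]]] : exists i j : 'I_r, (i < j)%N /\ rpt x i = rpt x j.
  by move: ij; rewrite -val_eqE neq_ltn => /orP[ij|ij]; [exists i, j|exists j, i].
by rewrite /vdm (bigD1 i1) //= (bigD1 j1) //= xij1 subrr !mul0r.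
Qed.

(** Where [DiscB] is nonzero the fibre consists of the permutations of a point with distinct roots,
    so [artin_free] applies; multiplying by [DiscB] covers the other points. *)
Lemma cone_independent (c : {ffun 'I_r -> 'I_r} -> {mpoly K[N.+1]}) :
  (forall x, cone x -> \sum_(a | artin a) (c a).@[psipt x] * artin_mon (rpt x) a = 0) ->
  forall a, artin a -> c a = 0.
Proof.
move=> H a aa; suff /eqP : DiscB * c a = 0 by rewrite mulf_eq0 (negbTE Disc0) => /eqP.
apply: (mpoly_eval_eq0 Kclosed) => b; rewrite mevalM.
have [->|/cone_generic[x [cx xb xi]]] := eqVneq (DiscB.@[b]) 0; first by rewrite mul0r.
rewrite (artin_free xi (c := fun a => (c a).@[b])) ?mulr0 // => s.
by have := H _ (cone_act s cx); rewrite psipt_act rpt_act xb.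
Qed.

(** An invariant function is constant on a fibre with distinct roots. Comparing that constant with
    its Artin expansion leaves only the trivial monomial, whose coefficient is the function on the
    base. *)
Lemma cone_invariant p : (forall x s, cone x -> p.@[act s x] = p.@[x]) ->
  exists q, forall x, cone x -> p.@[x] = q.@[psipt x].
Proof.
move=> pinv; have [c Hc] := cone_spanning_pt p.
pose a0 : {ffun 'I_r -> 'I_r} := [ffun _ => ord0].
have aa0 : artin a0 by apply/forallP => i; rewrite ffunE /= ltn_ord.
have mon0 y : artin_mon y a0 = 1 :> K by rewrite /artin_mon big1 // => i _; rewrite ffunE expr0.
exists (c a0) => x cx; rewrite Hc // (bigD1 a0) //= mon0 mulr1 big1 ?addr0 // => a /andP[aa a0a].
suff -> : c a = 0 by rewrite meval0 mul0r.
suff /eqP : DiscB * c a = 0 by rewrite mulf_eq0 (negbTE Disc0) => /eqP.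
apply: (mpoly_eval_eq0 Kclosed) => b; rewrite mevalM.
have [->|/cone_generic[y [cy yb yi]]] := eqVneq (DiscB.@[b]) 0; first by rewrite mul0r.
have := @artin_free K r (rpt y) yi (fun a => (c a).@[b] - (if a == a0 then p.@[y] else 0)).
move=> /(_ _ a aa); rewrite (negbTE a0a) subr0 => -> //; first by rewrite mulr0.
move=> s; under eq_bigr => a' aa' do rewrite mulrBl.
rewrite sumrB [X in _ - X](bigD1 a0) //= eqxx mon0 mulr1.
rewrite [X in _ - (_ + X)]big1 ?addr0 => [|a' /andP[_ /negbTE ->]]; last by rewrite mul0r.
have := Hc _ (cone_act s cy); rewrite pinv // psipt_act rpt_act yb => <-.
exact: subrr.
Qed.

(** Choose a function that vanishes on [A] and at no point of the fibre over [b]. The product of its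
    conjugates is invariant, so it comes from the base and separates [b] from the image of [A].
    Separation of points is a hypothesis so that affine and projective closed sets are both
    covered. *)
Lemma cone_separates_gen A b : psubset A cone ->
  (forall x, cone x -> psipt x = b -> exists2 p, vanish A p & p.@[x] != 0) ->
  exists2 q : {mpoly K[N.+1]}, (forall x, A x -> q.@[psipt x] = 0) & q.@[b] != 0.
Proof.
move=> AS nb; have [x cx xb] := cone_onto b.
have [p pA px] : exists2 p, vanish A p & forall s : {perm 'I_r}, p.@[act s x] != 0.
  apply: (nonvanishing_at_points Kclosed (vanish_ideal A)) => s.
  by apply: nb; [apply: cone_act|rewrite psipt_act].
pose nrm := \prod_(s : {perm 'I_r}) act_poly s p.
have nrmE z : nrm.@[z] = \prod_(s : {perm 'I_r}) p.@[act s z].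
  by rewrite /nrm rmorph_prod; apply: eq_bigr => s _; rewrite /= meval_act.
have [|q qE] := @cone_invariant nrm.
  move=> z s cz; rewrite !nrmE [RHS](reindex_inj (mulIg s)) /=.
  by apply: eq_bigr => t _; rewrite actM.
exists q => [z Az|]; last by rewrite -xb -qE // nrmE; apply/prodf_neq0 => s _.
rewrite -qE; last exact: AS.
by rewrite nrmE (bigD1 1%g) //= act1 pA // mul0r.
Qed.

Lemma cone_separates A b : aclosed A -> psubset A cone ->
  ~ (exists2 x, A x & psipt x = b) ->
  exists2 q : {mpoly K[N.+1]}, (forall x, A x -> q.@[psipt x] = 0) & q.@[b] != 0.
Proof.
move=> Ac AS nb; apply: cone_separates_gen => // x cx xb.
by apply: aclosed_sep => // Ax; apply: nb; exists x.
Qed.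

Lemma cone_fibres b : exists (J : finType) (s : J -> 'I_r.+1 -> K),
  forall x, cone x -> psipt x = b -> exists j, x = s j.
Proof.
have [x0 c0 x0b] := cone_onto b; exists {perm 'I_r}, (fun s => act s x0) => x cx xb.
by apply: cone_orbit => //; rewrite x0b xb.
Qed.

End ConeDefs.

Section PrimeElements.
Variables (R : idomainType) (p : R).
Hypothesis pP : prime_elt p.

Lemma prime_elt_exp a k : divides p (a ^+ k) -> divides p a.
Proof.
have [p0 pu pM] := pP; elim: k => [|k IH]; last by rewrite exprS => /pM[//|/IH].
case=> c; rewrite expr0 => E; case/negP: pu; apply/unitrPr; exists c; by rewrite mulrC.
Qed.

Lemma monic_relation_divides D (g : nat -> R) a : g D = 1 ->
  (forall i, (i < D)%N -> divides p (g i)) ->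
  \sum_(i < D.+1) g i * a ^+ i = 0 -> divides p a.
Proof.
move=> gD gp; rewrite big_ord_recr /= gD mul1r addrC => /eqP; rewrite addr_eq0 => /eqP E.
apply: (@prime_elt_exp _ D); rewrite E; apply: divides_opp.
apply: (big_ind (divides p)) => [|x y|i _]; [exact: divides0|exact: divides_add|].
exact/divides_mulr/gp.
Qed.

(* Integral closedness at [p]: [d (c / b)^2] is integral, so a pole of [c / b]
   along [p] would need [p ^ 2] to divide [d]. *)
Lemma integral_divides (d c b : R) D (g : nat -> R) : ~ divides (p ^+ 2) d -> divides p b ->
  g D = 1 -> \sum_(i < D.+1) g i * (b ^+ (2 * (D - i)) * (d * c ^+ 2) ^+ i) = 0 -> divides p c.
Proof.
have [p0 pu pM] := pP => npd [b' bE] gD E; apply: NNPP => npc.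
have nc2 : ~ divides p (c ^+ 2) by move/prime_elt_exp.
case: (classic (divides p d)) => [[d' dE]|npd'].
  have nd' : ~ divides p d' by case=> d'' d'E; apply: npd; exists d''; rewrite dE d'E expr2 mulrA.
  suff /pM[] : divides p (d' * c ^+ 2) by [].
  (* With b = b' p and d = d' p every term of the relation contains p^D; after cancelling it,
     p^(D-i) still remains in the i-th coefficient. *)
  apply: (@monic_relation_divides D (fun i => g i * (p ^+ (D - i) * b' ^+ (2 * (D - i))))).
  - by rewrite subnn muln0 !expr0 !mulr1.
  - move=> i iD; apply: divides_mull; apply: divides_mulr.
    by rewrite -(subnSK iD) exprS; apply: divides_mulr; apply: divides_refl.
  apply: (mulfI (expf_neq0 D p0)); rewrite mulr0 -[RHS]E mulr_sumr.
  apply: eq_bigr => i _; rewrite bE dE.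
  have -> : (b' * p) ^+ (2 * (D - i)) = b' ^+ (2 * (D - i)) * p ^+ (2 * (D - i)) by rewrite exprMn.
  have -> : (d' * p * c ^+ 2) ^+ i = (d' * c ^+ 2) ^+ i * p ^+ i by rewrite mulrAC exprMn.
  have -> : p ^+ D = p ^+ (D - i) * p ^+ i by rewrite -exprD subnK // -ltnS.
  have -> : p ^+ (2 * (D - i)) = p ^+ (D - i) * p ^+ (D - i) by rewrite -exprD mul2n addnn.
  move: (p ^+ (D - i)) (p ^+ i) (b' ^+ _) ((d' * c ^+ 2) ^+ i) => s1 s2 s3 s4; ring.
suff /pM[] : divides p (d * c ^+ 2) by [].
apply: (@monic_relation_divides D (fun i => g i * b ^+ (2 * (D - i)))).
- by rewrite subnn muln0 expr0 mulr1.
- move=> i iD; apply: divides_mull; rewrite -(subnSK iD) mulnS exprS.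
  by apply: divides_mulr; exists b'.
by rewrite -[RHS]E; apply: eq_bigr => i _; rewrite mulrA.
Qed.
End PrimeElements.

(** * Irreducibility of the cone *)

Section ConeIrreducible.
Variables (K : fieldType) (n N : nat) (e : 'I_N -> 'I_n.+2) (gam : 'I_n.+2 -> {mpoly K[N.+1]}).
Local Notation r := n.+2.
Hypothesis Kclosed : alg_closed K.
Hypothesis ok : cone_ok e gam.
Local Notation cone := (cone e gam).
Local Notation psi := (psi K e).
Local Notation psipt := (psipt e).
Local Notation DiscB := (DiscB gam).
Hypothesis Disc0 : DiscB != 0.
Hypothesis Disc_sqfree : forall p, prime_elt p -> ~ divides (p ^+ 2) DiscB.

Let D := #|{perm 'I_r}|.

Section OverComponent.
Variable M : pset ('I_r.+1 -> K).
Hypothesis Mc : aclosed M.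
Hypothesis Mi : irreducible (@aclosed K r.+1) M.
Hypothesis MS : psubset M cone.
Hypothesis Mo : forall b, exists2 x, M x & psipt x = b.

Let MP : is_prime (vanish M) := irreducible_prime Mc Mi.

Lemma base_eval_inj (p q : {mpoly K[N.+1]}) :
  (forall x, M x -> p.@[psipt x] = q.@[psipt x]) -> p = q.
Proof. by move=> H; apply: (mpoly_eval_inj Kclosed) => b; have [x Mx <-] := Mo b; apply: H. Qed.

Lemma base_not_vanish (p : {mpoly K[N.+1]}) : p != 0 -> ~ vanish M (msubst psi p).
Proof.
move=> p0 H; case/eqP: p0; apply: base_eval_inj => x Mx.
by rewrite meval0 meval_mpt H.
Qed.

(** The relation is the product over the group of T minus the conjugates of [u]; its coefficients
    are invariant, so they descend to the base. *)
Lemma orbit_relation (u : {mpoly K[r.+1]}) : exists g : nat -> {mpoly K[N.+1]}, g D = 1 /\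
  forall x, cone x -> \sum_(i < D.+1) (g i).@[psipt x] * u.@[x] ^+ i = 0.
Proof.
pose Pi : {poly {mpoly K[r.+1]}} := \prod_(s : {perm 'I_r}) ('X - (act_poly s u)%:P).
have PiE x : map_poly (meval x) Pi = \prod_(s : {perm 'I_r}) ('X - (u.@[act s x])%:P).
  rewrite rmorph_prod; apply: eq_bigr => s _.
  by rewrite rmorphB /= map_polyX map_polyC /= meval_act.
have sPi : size Pi = D.+1 by rewrite size_prod_XsubC /index_enum -enumT -cardE.
have Pim : Pi \is monic by apply: rpred_prod => s _; apply: monicXsubC.
have H i : exists q, forall x, cone x -> (Pi`_i).@[x] = q.@[psipt x].
  apply: cone_invariant => // x s cx.
  rewrite -[LHS](coef_map (meval (act s x))) -[RHS](coef_map (meval x)) /= !PiE.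
  rewrite (reindex_inj (mulIg (s^-1)%g)) /=.
  suff -> : \prod_j ('X - (u.@[act (j * s^-1)%g (act s x)])%:P) =
    \prod_s0 ('X - (u.@[act s0 x])%:P) by [].
  by apply: eq_bigr => t _; rewrite actM mulgKV.
have [g gE] := boolp.choice H; exists g; split.
  apply: base_eval_inj => x Mx; rewrite -gE; last exact: MS.
  by have := monicP Pim; rewrite /lead_coef sPi /= => ->; rewrite !meval1.
move=> x cx; have : (map_poly (meval x) Pi).[u.@[x]] = 0.
  by rewrite PiE (bigD1 1%g) //= hornerM act1 hornerXsubC subrr mul0r.
have sm : (size (map_poly (meval x) Pi) <= D.+1)%N by rewrite -sPi; apply: size_poly.
rewrite (horner_coef_wide _ sm) => E; rewrite -[RHS]E; apply: eq_bigr => i _.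
by rewrite coef_map /= gE.
Qed.

Let A (s : {perm 'I_r}) := boolp.asbool (forall x, M x -> M (act s x)).
Lemma AP s : A s <-> (forall x, M x -> M (act s x)).
Proof. by split=> /boolp.asboolP. Qed.

(** [A] asks for one inclusion only; in a finite group the inverse of s is a power of s. *)
Lemma A_inv s : A s -> A (s^-1)%g.
Proof.
move/AP => As; apply/AP; rewrite invg_expg.
elim: (#[s].-1)%g => [|k IH] x Mx; first by rewrite expg0 act1.
by rewrite expgS -actM; apply/As/IH.
Qed.

(** If s does not stabilize [M], neither does its inverse, so some equation of [M] fails at a point
    of s^-1 M; transported by s^-1 it kills s M but not [M]. The product over all such s works
    because the ideal of [M] is prime. *)
Lemma separating_element : exists2 u, ~ vanish M u &
  forall s x, ~~ A s -> M x -> u.@[act s x] = 0.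
Proof.
have H s : exists v, ~ vanish M v /\ (~~ A s -> forall x, M x -> v.@[act s x] = 0).
  have [As|nAs] := boolP (A s).
    by exists 1; split=> //; apply: prime_proper MP.
  have nAi : ~ (forall x, M x -> M (act (s^-1)%g x)).
    by move/AP/A_inv; rewrite invgK; apply/negP.
  have [x /not_all_ex_not[Mx nMx]] := not_all_ex_not _ _ nAi.
  have [w wM wx] := aclosed_sep Mc nMx.
  exists (act_poly (s^-1)%g w); split=> [H|_ z Mz].
    by have := H x Mx; rewrite meval_act => E; rewrite E eqxx in wx.
  by rewrite meval_act actM mulVg act1 wM.
have [v vE] := boolp.choice H; exists (\prod_s v s).
  apply: (big_ind (fun u => ~ vanish M u)) => [|a b na nb|s _].
  - exact: prime_proper MP.
  - by move/(primeM MP) => [].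
  - by have [] := vE s.
move=> s x nAs Mx; rewrite (bigD1 s) //= mevalM.
by have [_ /(_ nAs x Mx) ->] := vE s; rewrite mul0r.
Qed.

(** The function with Artin coefficients [c] is [b] times the indicator of [M] among its
    conjugates. *)
Definition splits_as (b : {mpoly K[N.+1]}) (c : {ffun 'I_r -> 'I_r} -> {mpoly K[N.+1]}) :=
  forall x (s : {perm 'I_r}), M x -> \sum_(a | artin a) (c a).@[psipt x] * artin_mon (rpt x \o s) a =
     if A s then b.@[psipt x] else 0.

(** In the monic relation of a separating [u], a power of [u] is cancelled on [M] until the constant
    term g_i0 is nonzero: g_i0 + u h' = 0 on [M]. Then - u h' equals g_i0 on [M] and vanishes on the
    other conjugates, where [u] does. *)
Lemma splits_as_exists : exists b c, b != 0 /\ splits_as b c.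
Proof.
have [u uM u0] := separating_element; have [g [gD gE]] := orbit_relation u.
have [|i0 gi0 i0min] := @nat_minimal (fun i => g i != 0).
  by exists D; rewrite gD oner_eq0.
have i0D : (i0 <= D)%N by apply: i0min; rewrite gD oner_eq0.
pose h := \sum_(i < (D - i0).+1) msubst psi (g (i0 + i)%N) * u ^+ i.
pose h' := \sum_(i < D - i0) msubst psi (g (i0 + i.+1)%N) * u ^+ i.
have hE : h = msubst psi (g i0) + u * h'.
  rewrite /h big_ord_recl /= addn0 expr0 mulr1; congr (_ + _).
  by rewrite /h' mulr_sumr; apply: eq_bigr => i _; rewrite /= mulrCA -exprS.
have uh : vanish M (u ^+ i0 * h).
  move=> x Mx; rewrite -[RHS](gE x (MS Mx)) mevalM rmorphXn /= /h raddf_sum /=.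
  rewrite -(big_mkord xpredT (fun i => (g i).@[psipt x] * u.@[x] ^+ i)).
  rewrite (big_cat_nat (n := i0)) //=; last exact: leqW.
  rewrite [X in _ = X + _]big_nat [X in _ = X + _]big1 ?add0r => [|i /andP[_ ii0]]; last first.
    have /eqP -> : g i == 0 by apply: contraTT ii0 => /i0min; rewrite -leqNgt.
    by rewrite meval0 mul0r.
  rewrite -[X in _ = \sum_(X <= _ < _) _]add0n big_addn subSn // big_mkord mulr_sumr; apply: eq_bigr => i _.
  rewrite mevalM rmorphXn /= -meval_mpt addnC exprD.
  by rewrite mulrCA -[in RHS](mulrC (_ ^+ i0)).
have hM : vanish M h.
  have [H|//] := primeM MP uh; case: uM => x Mx; have /eqP := H x Mx.
  by rewrite rmorphXn /= expf_eq0 => /andP[_ /eqP].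
have [c Hc] := cone_spanning_pt e gam Kclosed (- (u * h')).
exists (g i0), c; split=> // x s Mx.
have := Hc _ (cone_act s (MS Mx)); rewrite psipt_act rpt_act => <-.
rewrite mevalN mevalM; case: ifPn => [/AP As|nAs]; last by rewrite u0 // mul0r oppr0.
have /eqP := hM _ (As x Mx); rewrite hE mevalD mevalM -meval_mpt addr_eq0 => /eqP <-.
by rewrite -/(psipt _) psipt_act.
Qed.

Lemma vdm_not_vanish : ~ vanish M (vdm rootX).
Proof.
move=> H; have [b] := mpoly_eval_neq0 Kclosed Disc0; have [x Mx <-] := Mo b.
have := H x Mx; rewrite meval_vdm cone_Disc // => [->|]; last exact: MS.
by rewrite expr0n mulr0 eqxx.
Qed.

(** The dual basis solves for the coefficients: V c_a = b W, where V is the Vandermonde product and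
    [W] a polynomial. As V^2 is [DiscB] up to sign, DiscB (c_a / b)^2 is integral up to sign, and
    [integral_divides] applies because [DiscB] is squarefree. *)
Lemma splits_as_divides b c p a : splits_as b c -> prime_elt p -> divides p b -> artin a ->
  divides p (c a).
Proof.
move=> bc pP pb aa.
pose W : {mpoly K[r.+1]} := \sum_(s | A s) (-1) ^+ s * theta (rootX \o s) a.
have WE x : W.@[x] = \sum_(s | A s) (-1) ^+ s * theta (rpt x \o s) a.
  rewrite /W raddf_sum; apply: eq_bigr => s _ /=.
  by rewrite mevalM meval_theta rmorphXn rmorphN1.
have F0 x : M x -> vdm (rpt x) * (c a).@[psipt x] = b.@[psipt x] * W.@[x].
  move=> Mx; apply/eqP; rewrite -subr_eq0; apply/eqP.
  suff H : vanish M (vdm rootX * msubst psi (c a) - msubst psi b * W).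
    by rewrite -[RHS](H x Mx) mevalB !mevalM meval_vdm -!meval_mpt.
  (* One more factor [vdm], which does not vanish identically on [M], reduces the identity to points
     with distinct roots, where [theta_dual] is available. *)
  suff /(primeM MP)[/vdm_not_vanish|] : vanish M (vdm rootX * (vdm rootX * msubst psi (c a) - msubst psi b * W)) by [].
  move=> z Mz; rewrite mevalM mevalB !mevalM meval_vdm -!meval_mpt -/(psipt z) WE.
  have [/injectiveP zi|/injectiveP zi] := boolP (injectiveb (rpt z)); last first.
    have -> : vdm (rpt z) = 0; last by rewrite mul0r.
    apply/eqP; apply: contra_notT zi => v0 i j zij; apply/eqP; apply: contraNT v0 => ij.
    have [i1 [j1 [ij1 zij1]]] : exists i j : 'I_r, (i < j)%N /\ rpt z i = rpt z j.
      by move: ij; rewrite -val_eqE neq_ltn => /orP[ij|ij]; [exists i, j|exists j, i].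
    by rewrite /vdm (bigD1 i1) //= (bigD1 j1) //= zij1 subrr !mul0r.
  suff -> : vdm (rpt z) * (c a).@[psipt z] =
     b.@[psipt z] * (\sum_(s | A s) (-1) ^+ s * theta (rpt z \o s) a) by rewrite subrr mulr0.
  transitivity (\sum_(s : {perm 'I_r}) (-1) ^+ s * theta (rpt z \o s) a *
     \sum_(a' | artin a') (c a').@[psipt z] * artin_mon (rpt z \o s) a').
    under eq_bigr => s _ do rewrite mulr_sumr.
    rewrite exchange_big /= (bigD1 a) //=.
    rewrite [X in _ = _ + X]big1 ?addr0 => [|a' /andP[aa' a'a]].
      transitivity ((c a).@[psipt z] * (vdm (rpt z) *+ (a == a))).
        by rewrite eqxx mulr1n mulrC.
      rewrite -(theta_dual zi aa aa) mulr_sumr; apply: eq_bigr => s _.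
      by rewrite mulrCA.
    rewrite (eq_bigr (fun s : {perm 'I_r} => (c a').@[psipt z] *
       ((-1) ^+ s * theta (rpt z \o s) a * artin_mon (rpt z \o s) a'))) => [|s _]; last by rewrite mulrCA.
    by rewrite -mulr_sumr theta_dual // eq_sym (negbTE a'a) mulr0n mulr0.
  rewrite mulr_sumr [RHS]big_mkcond /=; apply: eq_bigr => s _; rewrite bc //.
  by case: ifP => _; rewrite ?mulr0 // mulrC.
pose d : {mpoly K[N.+1]} := (-1) ^+ vdm_sign r * DiscB.
have dE x : M x -> d.@[psipt x] = vdm (rpt x) ^+ 2.
  move=> Mx; rewrite /d mevalM cone_Disc; last exact: MS.
  by rewrite rmorphXn rmorphN1 mulrA -expr2 sqrr_sign mul1r.
have [g [gD gE]] := orbit_relation (W ^+ 2).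
apply: (@integral_divides _ p pP d (c a) b D g) => //.
  case=> q dq; apply: (Disc_sqfree pP); exists ((-1) ^+ vdm_sign r * q).
  by rewrite -mulrA -dq /d mulrA -expr2 sqrr_sign mul1r.
apply: base_eval_inj => x Mx; rewrite meval0 raddf_sum /=.
transitivity (b.@[psipt x] ^+ (2 * D) * \sum_(i < D.+1) (g i).@[psipt x] * (W ^+ 2).@[x] ^+ i).
  rewrite mulr_sumr; apply: eq_bigr => i _.
  have dc : (d * c a ^+ 2).@[psipt x] = (b.@[psipt x] * W.@[x]) ^+ 2.
    by rewrite mevalM rmorphXn /= dE // -exprMn F0.
  have W2 : (W ^+ 2).@[x] = W.@[x] ^+ 2 by rewrite rmorphXn.
  have bD : (b ^+ (2 * (D - i))).@[psipt x] = b.@[psipt x] ^+ (2 * (D - i)) by rewrite rmorphXn.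
  have di : ((d * c a ^+ 2) ^+ i).@[psipt x] = (d * c a ^+ 2).@[psipt x] ^+ i by rewrite rmorphXn.
  rewrite (mevalM _ (g i)) (mevalM _ (b ^+ _)) bD di dc W2 -!exprM exprMn.
  have -> : (2 * D = 2 * (D - i) + 2 * i)%N by rewrite -mulnDr subnK // -ltnS.
  rewrite exprD; move: (_ ^+ (2 * (D - i))) (b.@[_] ^+ (2 * i)) (W.@[x] ^+ _) => s1 s2 s3; ring.
by rewrite gE ?mulr0 //; apply: MS.
Qed.

(** A denominator of least degree has no prime factor, since such a factor would divide every
    coefficient and could be cancelled. *)
Lemma splits_as_unit : exists c, splits_as 1 c.
Proof.
have [|k [b [c [bk b0 bc]]] kmin] := @nat_minimal (fun k => exists b c,
    [/\ (msize b).-1 = k, b != 0 & splits_as b c]).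
  by have [b [c [b0 bc]]] := splits_as_exists; exists (msize b).-1, b, c.
have [/mpoly_unit_const[t t0 bE]|bu] := boolP (b \is a GRing.unit).
  exists (fun a => t^-1 *: c a) => x s Mx.
  under eq_bigr => a _ do rewrite mevalZ -mulrA.
  rewrite -mulr_sumr bc // bE mevalC meval1.
  by case: ifP => _; rewrite ?mulr0 // mulVf.
have [p pP pb] := mpoly_has_prime_divisors b0 bu.
have H a : exists c', artin a -> c a = c' * p.
  have [aa|naa] := boolP (artin a); last by exists 0.
  by have [c' ->] := splits_as_divides bc pP pb aa; exists c'.
have [c' c'E] := boolp.choice H; have [b' bE] := pb.
have b'0 : b' != 0 by apply: contraNneq b0 => b'0; rewrite bE b'0 mul0r.
have [p0 pu _] := pP.
suff b'c' : splits_as b' c'.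
  have : (k <= (msize b').-1)%N by apply: kmin; exists b', c'.
  have dp : (msize p).-1 != 0%N by apply: contra pu => /eqP/(mpoly_delta_unit p0).
  by move: dp; rewrite -bk bE mpoly_deltaM //; move: (msize p).-1 (msize b').-1 => s1 s2; lia.
move=> x s Mx; apply/eqP; rewrite -subr_eq0; apply/eqP.
pose Gs := \sum_(a | artin a) msubst psi (c' a) * artin_mon (rootX \o s) a -
   (if A s then msubst psi b' else 0).
have GsE z : Gs.@[z] = \sum_(a | artin a) (c' a).@[psipt z] * artin_mon (rpt z \o s) a -
   (if A s then b'.@[psipt z] else 0).
  rewrite mevalB raddf_sum; congr (_ - _).
    by apply: eq_bigr => a _; rewrite /= mevalM meval_artin_mon -meval_mpt.
  by case: ifP; rewrite ?meval0 // -meval_mpt.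
rewrite -GsE; move: x Mx; change (vanish M Gs).
suff /(primeM MP)[/(base_not_vanish p0)|] : vanish M (msubst psi p * Gs) by [].
move=> z Mz; rewrite mevalM GsE -meval_mpt -/(psipt z) mulrBr mulr_sumr.
have := bc z s Mz; rewrite bE mevalM => E.
have -> : \sum_(a | artin a) p.@[psipt z] * ((c' a).@[psipt z] * artin_mon (rpt z \o s) a) =
   \sum_(a | artin a) (c a).@[psipt z] * artin_mon (rpt z \o s) a.
  by apply: eq_bigr => a aa; rewrite c'E // mevalM mulrA [p.@[_] * _]mulrC.
by rewrite E; case: ifP => _; rewrite ?mulr0 ?subrr // [p.@[_] * _]mulrC subrr.
Qed.

(* The indicator of [M] is now a polynomial function on the cone, hence constant
   along each line through the vertex. *)
Lemma component_full : psubset cone M.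
Proof.
have [c Hc] := splits_as_unit.
have ME x s : M x -> (base_exp e c).@[act s x] = (A s)%:R.
  move=> Mx; rewrite /base_exp raddf_sum /=.
  transitivity (\sum_(a | artin a) (c a).@[psipt x] * artin_mon (rpt x \o s) a).
    apply: eq_bigr => a _; rewrite mevalM meval_artin_mon1 rpt_act -meval_mpt.
    by rewrite -/(psipt _) psipt_act.
  by rewrite Hc // meval1; case: ifP.
have orb y : cone y -> exists s x, M x /\ y = act s x.
  move=> cy; have [x Mx xy] := Mo (psipt y).
  by have [s ys] := cone_orbit (MS Mx) cy xy; exists s, x.
have const y : cone y -> (base_exp e c).@[y] = (base_exp e c).@[fun _ => 0].
  move=> cy; pose q := components_poly (base_exp e c) y.
  have qE t : q.[t] = (base_exp e c).@[fun i => t * y i].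
    exact: components_polyE.
  have : q * (q - 1) = 0.
    apply: (poly_eval_eq0 Kclosed) => t; rewrite hornerM hornerD hornerN hornerC qE.
    have [s [x [Mx ->]]] := orb _ (cone_scale ok t cy).
    by rewrite ME //; case: (A s); rewrite ?subrr ?mulr0 ?mul0r.
  have q1 : q.[1] = (base_exp e c).@[y] by rewrite qE; apply: meval_eq => i; rewrite mul1r.
  have q0 : q.[0] = (base_exp e c).@[fun _ => 0] by rewrite qE; apply: meval_eq => i; rewrite mul0r.
  rewrite -q1 -q0 => /eqP; rewrite mulf_eq0 subr_eq0 => /orP[/eqP ->|/eqP ->].
    by rewrite !horner0.
  by rewrite !hornerC.
have [[x0 Mx0] _] := Mi.
have A1 : A 1 by apply/AP => x; rewrite act1.
have one : (base_exp e c).@[fun _ => 0] = 1.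
  by rewrite -(const _ (MS Mx0)) -[x0]act1 ME // A1.
move=> y cy; have [s [x [Mx ->]]] := orb y cy.
have := const _ (cone_act s (MS Mx)); rewrite ME // one.
by case: (A s) (AP s) => [[H _] _|_ /eqP]; [apply: H|rewrite eq_sym oner_eq0].
Qed.
End OverComponent.

Lemma cone_prime : is_prime (vanish cone).
Proof.
have [|||||||M [Mc Mi MS Mo]] := @irreducible_lift K ('I_r.+1 -> K) N.+1 (@aclosed K r.+1)
  psipt (fun _ => True) cone.
- by move=> I F _; apply: aclosed_inter.
- by move=> y _; apply: cone_fibres.
- exact: aclosed_cone.
- by move=> y _; apply: cone_onto.
- by exists (fun _ => 0).
- move=> q1 q2 H; have : q1 * q2 = 0 by apply: (mpoly_eval_eq0 Kclosed) => x; apply: H.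
  by move/eqP; rewrite mulf_eq0 => /orP[/eqP|/eqP] ->; [left|right] => x _; rewrite meval0.
- by move=> A y Ac AS _; apply: (cone_separates Kclosed ok Disc0 Ac AS).
have Mo' b : exists2 x, M x & psipt x = b by apply: Mo.
have E : vanish cone = vanish M.
  apply: functional_extensionality => p; apply: boolp.propext; split=> H x; first by move/MS/H.
  by move/(component_full Mc Mi MS Mo')/H.
by rewrite E; apply: irreducible_prime.
Qed.
End ConeIrreducible.

Lemma contains_prime_divisor (K : fieldType) n (Q : pset {mpoly K[n]}) a : is_prime Q ->
  a != 0 -> Q a -> exists p, [/\ prime_elt p, divides p a & Q p].
Proof.
move=> QP; have [k] := ubnP (msize a).-1; elim: k a => // k IH a /ltnSE ak a0 Qa.
have [/mpoly_unit_const[c c0 aE]|au] := boolP (a \is a GRing.unit).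
  case: (prime_proper QP); rewrite -mpolyC1 -(mulVf c0) mpolyCM -aE.
  exact: (idealM QP).
have [p pP [b bE]] := mpoly_has_prime_divisors a0 au; have [p0 pu _] := pP.
have pa : divides p a by exists b.
have b0 : b != 0 by apply: contraNneq a0 => b0; rewrite bE b0 mul0r.
move: Qa; rewrite bE => /(primeM QP)[Qb|Qp]; last by exists p; rewrite -bE.
have [|q [qP qb Qq]] := IH b _ b0 Qb.
  have dp : (msize p).-1 != 0%N by apply: contra pu => /eqP/(mpoly_delta_unit p0).
  by move: ak dp; rewrite bE mpoly_deltaM //; move: (msize p).-1 (msize b).-1 => s1 s2; lia.
by exists q; split=> //; apply: divides_mulr.
Qed.

Lemma principal_prime (R : idomainType) (p : R) : prime_elt p -> is_prime (divides p).
Proof.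
case=> p0 pu pM; split; [split|case=> c E|exact: pM].
- exact: divides0.
- by move=> a b; apply: divides_add.
- by move=> a b; apply: divides_mull.
by case/negP: pu; apply/unitrPr; exists c; rewrite mulrC.
Qed.

Lemma mpolyX_prime (K : fieldType) n (i : 'I_n.+1) : prime_elt ('X_i : {mpoly K[n.+1]}).
Proof.
have E : ('X_i : {mpoly K[n.+1]}) = mjoin i 'X by rewrite mjoinX.
rewrite E; apply: mjoin_prime; split; rewrite ?polyX_eq0 //.
  by rewrite poly_unitE size_polyX.
have D (p : {poly {mpoly K[n]}}) : divides 'X p <-> p.[0] = 0.
  split=> [[c ->]|/eqP]; first by rewrite hornerM hornerX mulr0.
  by rewrite -/(root p 0) => /factor_theorem[c ->]; exists c; rewrite subr0.
move=> a b /D; rewrite hornerM => /eqP; rewrite mulf_eq0 => /orP[/eqP|/eqP] H; [left|right]; exact/D.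
Qed.

(** * Dimension of the projective cone *)

Section ConeDimension.
Variables (K : fieldType) (n N : nat) (e : 'I_N -> 'I_n.+2) (gam : 'I_n.+2 -> {mpoly K[N.+1]}).
Local Notation r := n.+2.
Hypothesis Kclosed : alg_closed K.
Hypothesis ok : cone_ok e gam.
Local Notation cone := (cone e gam).
Local Notation psi := (psi K e).
Local Notation psipt := (psipt e).
Local Notation DiscB := (DiscB gam).
Hypothesis Disc0 : DiscB != 0.

(** Modulo [I] a function is an Artin expansion; if it vanishes on the cone, so does the expansion,
    and independence makes all its coefficients zero. *)
Lemma cone_radical (I : pset {mpoly K[r.+1]}) p : is_ideal I ->
  (forall j, I (coefA j - msubst psi (gam j))) -> psubset I (vanish cone) ->
  vanish cone p -> I p.
Proof.
move=> II HI Iv pv; have [c Hc] := cone_spanning Kclosed p II HI.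
suff c0 : base_exp e c = 0 by rewrite -[p]subr0 -c0.
have H x : cone x -> \sum_(a | artin a) (c a).@[psipt x] * artin_mon (rpt x) a = 0.
  move=> cx; have := Iv _ Hc x cx; rewrite mevalB pv // sub0r => /eqP; rewrite oppr_eq0 => /eqP E.
  rewrite -[RHS]E /base_exp raddf_sum; apply: eq_bigr => a _.
  by rewrite /= mevalM -meval_mpt meval_artin_mon1.
rewrite /base_exp big1 // => a aa.
by rewrite (cone_independent Kclosed ok Disc0 H aa) rmorph0 mul0r.
Qed.

Definition pcone (x : 'I_r.+1 -> K) := nonzero x /\ cone x.

Lemma gampt_eq0 b : (forall i, b i = 0) -> gampt gam b = fun _ => 0.
Proof.
move=> b0; apply: functional_extensionality => j.
have -> : b = base_scale (n := n) e 0 b.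
  by apply: functional_extensionality => i; rewrite /base_scale b0 mulr0.
by rewrite (cone_hom ok) expr0n subn_eq0 leqNgt ltn_ord mul0r.
Qed.

Lemma psipt_eq0 x : cone x -> (forall i, psipt x i = 0) -> forall i, x i = 0.
Proof.
move=> cx H; have cx0 : coef_at x = gampt gam (psipt x) := cx; rewrite (gampt_eq0 H) in cx0.
have x0 : x ord0 = 0 by rewrite -(H ord0) psipt0.
have fx : fpoly (coef_at x) = 'X^r.
  by rewrite cx0 /fpoly big1 ?addr0 // => j _; rewrite scale0r.
move=> i; case: (unliftP ord0 i) => [j ->|->] //.
have : ('X^r).[rpt x j] = 0 :> K.
  by rewrite -fx fpoly_coef_at (bigD1 j) //= hornerM hornerXsubC subrr mul0r.
by rewrite hornerXn => /eqP; rewrite expf_eq0 => /andP[_ /eqP].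
Qed.

Lemma coef_at0 : coef_at (fun _ : 'I_r.+1 => 0 : K) = fun _ => 0.
Proof.
apply: functional_extensionality => j.
have -> : (fun _ : 'I_r.+1 => 0) = (fun i => 0 * (0 : K)) :> ('I_r.+1 -> K).
  by apply: functional_extensionality => k; rewrite mulr0.
by rewrite coef_at_scale expr0n subn_eq0 leqNgt ltn_ord mul0r.
Qed.

Lemma psipt_at0 i : psipt (fun _ : 'I_r.+1 => 0 : K) i = 0.
Proof. by case: (unliftP ord0 i) => [l ->|->]; rewrite (psiptS, psipt0) ?coef_at0. Qed.

Lemma nonzero_psipt (x : 'I_r.+1 -> K) : nonzero (psipt x) -> nonzero x.
Proof.
move=> [i xi]; apply: NNPP => H; case/negP: xi.
have -> : x = fun _ => 0.
  by apply: functional_extensionality => k; apply/eqP; apply: contra_notT H => xk; exists k.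
by rewrite psipt_at0.
Qed.

Lemma pcone_exists : exists x, pcone x.
Proof.
have [x cx xb] := cone_onto Kclosed ok (fun _ => 1).
exists x; split=> //; apply: nonzero_psipt => //; exists ord0.
by rewrite xb oner_neq0.
Qed.

Lemma pcone_vanish p : vanish pcone p <-> vanish cone p.
Proof.
split=> H x; last by move=> [_]; apply: H.
move=> cx; case: (classic (nonzero x)) => [x0|nx]; first by apply: H.
have [y [y0 cy]] := pcone_exists.
have : 'X * components_poly p y = 0.
  apply: (poly_eval_eq0 Kclosed) => t; rewrite hornerM hornerX components_polyE.
  have [->|t0] := eqVneq t 0; first by rewrite mul0r.
  rewrite H ?mulr0 //; split; last exact: (cone_scale ok).
  by case: y0 => i yi; exists i; rewrite mulf_neq0.
move/eqP; rewrite mulf_eq0 polyX_eq0 /= => /eqP E.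
rewrite -[RHS](horner0 0) -E components_polyE; apply: meval_eq => i; rewrite mul0r.
by apply/eqP; apply: contra_notT nx => xi; exists i.
Qed.

Hypothesis pcone_closed : pclosed pcone.

Definition contract (P : pset {mpoly K[r.+1]}) : pset {mpoly K[N.+1]} := fun q => P (msubst psi q).

Lemma contract_prime P : is_prime P -> is_prime (contract P).
Proof.
move=> PP; split; first split.
- by rewrite /contract rmorph0; apply: (ideal0 PP).
- by move=> a b; rewrite /contract rmorphD; apply: (idealD PP).
- by move=> a b; rewrite /contract rmorphM; apply: (idealM PP).
- by rewrite /contract rmorph1; apply: prime_proper PP.
by move=> a b; rewrite /contract rmorphM; apply: (primeM PP).
Qed.

(* Incomparability of primes in the integral extension of the base ring. *)
Lemma contract_strict P P' u : is_prime P -> is_prime P' -> psubset (vanish cone) P ->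
  psubset P P' -> P' u -> ~ P u -> exists q, contract P' q /\ ~ contract P q.
Proof.
move=> PP PP' cP PP'sub P'u nPu.
have [g [gD gE]] := orbit_relation Kclosed ok Disc0 (M := cone) (fun x cx => cx)
  (cone_onto Kclosed ok) u.
set D := #|{perm 'I_r}| in gD gE.
(* Coefficients before [i0] lie in [P], so u^i0 cancels modulo [P]; what is left shows that the
   coefficient at [i0] lies in [P']. *)
have [|i0 gi0 i0min] := @nat_minimal (fun i => ~ P (msubst psi (g i))).
  by exists D; rewrite gD rmorph1; apply: prime_proper PP.
have i0D : (i0 <= D)%N by apply: i0min; rewrite gD rmorph1; apply: prime_proper PP.
exists (g i0); split=> //; rewrite /contract.
pose h' := \sum_(i < D - i0) msubst psi (g (i0 + i.+1)%N) * u ^+ i.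
have rel : P (\sum_(i < D.+1) msubst psi (g i) * u ^+ i).
  apply: cP => x cx; rewrite -[RHS](gE x cx) raddf_sum; apply: eq_bigr => i _.
  by rewrite /= mevalM rmorphXn /= -meval_mpt.
have relh : P (u ^+ i0 * (msubst psi (g i0) + u * h')).
  have <- : \sum_(i < D.+1) msubst psi (g i) * u ^+ i - \sum_(0 <= i < i0) msubst psi (g i) * u ^+ i =
      u ^+ i0 * (msubst psi (g i0) + u * h').
    rewrite -(big_mkord xpredT (fun i => msubst psi (g i) * u ^+ i)).
    rewrite (big_cat_nat (n := i0)) //=; last exact: leqW.
    rewrite addrAC subrr add0r -[X in \sum_(X <= _ < _) _]add0n big_addn subSn // big_mkord.
    rewrite big_ord_recl /= add0n mulrDr [X in _ = X + _]mulrC; congr (_ + _).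
    rewrite /h' mulrA mulr_sumr; apply: eq_bigr => i _.
    by rewrite /bump /= add1n addnC exprD exprS; ring.
  apply: (idealB PP) rel _; rewrite big_nat; apply: ideal_sum => [|i /andP[_ ii0]]; first exact: PP.
  rewrite mulrC; apply: (idealM PP); apply: NNPP => H.
  by have := i0min i H; rewrite leqNgt ii0.
have [H|H] := primeM PP relh; last first.
  have P'h := PP'sub _ H; rewrite -[msubst psi (g i0)](addrK (u * h')).
  by apply: (idealB PP') P'h _; rewrite mulrC; apply: (idealM PP').
case: nPu; elim: (i0) H => [|k IH]; first by rewrite expr0 => /(prime_proper PP).
by rewrite exprS => /(primeM PP)[//|/IH].
Qed.

Lemma pcone_irreducible (sqf : forall p, prime_elt p -> ~ divides (p ^+ 2) DiscB) :
  irreducible (@pclosed K r.+1) pcone.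
Proof.
apply: prime_pirreducible; [exact: pcone_exists|by move=> x []|].
move=> p q /pcone_vanish/(primeM (cone_prime Kclosed ok Disc0 sqf))[H|H]; [left|right]; exact/pcone_vanish.
Qed.

(** Strict inclusions survive contraction by [contract_strict]. The index is [l.+1] because the
    contracted ideal of the smallest set of the chain is still strictly inside the ideal of the
    origin. *)
Lemma chain_contract_trdeg (T : pset ('I_r.+1 -> K)) l : psubset T pcone ->
  has_chain (@pclosed K r.+1) T l ->
  exists Z, [/\ pclosed Z, irreducible (@pclosed K r.+1) Z, psubset Z T &
     trdeg_ge (contract (vanish Z)) l.+1].
Proof.
move=> Tc [Z [H1 H2]].
have ZP i : (i <= l)%N -> is_prime (vanish (Z i)).
  by move=> il; have [a b _] := H1 i il; apply: pirreducible_prime.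
have Zcone i : (i <= l)%N -> psubset (vanish cone) (vanish (Z i)).
  by move=> il p pv x Zx; have [_ _ c] := H1 i il; apply: pv; have [] := Tc x (c x Zx).
suff H i : (i <= l)%N -> trdeg_ge (contract (vanish (Z i))) i.+1.
  by have [a b c] := H1 l (leqnn l); exists (Z l); split=> //; apply: H.
elim: i => [|i IH] il.
  have [a [[x Zx] _] c] := H1 0%N isT.
  pose m : pset {mpoly K[N.+1]} := fun q => q.@[fun _ => 0] = 0.
  have mI : is_ideal m.
    split; rewrite /m; first by rewrite meval0.
      by move=> p q; rewrite mevalD => -> ->; rewrite addr0.
    by move=> p q; rewrite mevalM => ->; rewrite mulr0.
  have m1 : ~ m 1 by rewrite /m meval1 => /eqP; rewrite oner_eq0.
  have [x0 cx] := Tc x (c x Zx).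
  have [j xj] : exists j, psipt x j != 0.
    apply: NNPP => H; case: x0 => i; case/negP; apply/eqP; apply: (psipt_eq0 cx) => j.
    by apply/eqP; apply: contra_notT H => xj; exists j.
  apply: (@trdeg_geS _ _ _ m 'X_j); [exact: (contract_prime (ZP 0%N isT))|exact: mI| | | |].
  - move=> q qZ; rewrite /m.
    have /(vanish_components Kclosed _ a)/(_ x Zx) E := qZ.
    have := components_polyE (msubst psi q) x 0; rewrite E horner0 meval_msubst => E'.
    rewrite [RHS]E'; apply: meval_eq => i.
    have -> : (fun i0 => 0 * x i0) = fun _ => 0 by apply: functional_extensionality => k; rewrite mul0r.
    by rewrite -[RHS]/(psipt (fun _ => 0) i) psipt_at0.
  - by rewrite /m mevalXU.
  - by rewrite /contract msubstX => /(_ x Zx) E; rewrite -[_.@[x]]/(psipt x j) in E; rewrite E eqxx in xj.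
  - exact: trdeg_ge0.
have [a b c] := H1 _ il; have [a' b' c'] := H1 _ (ltnW il).
have [ZZ nZZ] := H2 i il.
have [x [Zx nZx]] : exists x, Z i.+1 x /\ ~ Z i x.
  by apply: NNPP => H; apply: nZZ => x Zx; apply: NNPP => nx; apply: H; exists x.
have [p [pZ _ px]] := pclosed_sep a' (pclosed_nonzero a Zx) nZx.
have sub : psubset (vanish (Z i.+1)) (vanish (Z i)) by move=> q qZ z /ZZ /qZ.
have [||q [qi nqi]] := contract_strict (ZP _ il) (ZP _ (ltnW il)) (Zcone _ il) sub (u := p).
- by [].
- by move/(_ x Zx) => E; rewrite E eqxx in px.
apply: (@trdeg_geS _ _ _ (contract (vanish (Z i))) q) => //.
- exact: (contract_prime (ZP _ il)).
- exact: (contract_prime (ZP _ (ltnW il))).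
- by move=> q' /sub.
- by apply: IH; apply: ltnW.
Qed.

Lemma pcone_chain_le l : has_chain (@pclosed K r.+1) pcone l -> (l <= N)%N.
Proof.
move=> /(chain_contract_trdeg (fun x H => H))[Z [Zc Zi _ H]].
by have := trdeg_ge_le (contract_prime (pirreducible_prime Kclosed Zc Zi)) H.
Qed.

(* No component of the branch divisor lies in [v = 0] or at infinity, so the
   second condition costs another dimension. *)
Lemma bad_chain_le (T : pset ('I_r.+1 -> K)) (v : {mpoly K[N.+1]}) l :
  (forall p, prime_elt p -> divides p DiscB -> ~ divides p v) ->
  ~ divides 'X_ord0 DiscB ->
  psubset T pcone ->
  (forall x, T x -> DiscB.@[psipt x] = 0 /\ (x ord0 = 0 \/ v.@[psipt x] = 0)) ->
  has_chain (@pclosed K r.+1) T l -> (l + 2 <= N)%N.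
Proof.
move=> Hv HX Tc Tbad /(chain_contract_trdeg Tc)[Z [Zc Zi ZT H]].
have qP := contract_prime (pirreducible_prime Kclosed Zc Zi).
set q0 := contract (vanish Z) in H qP.
have Dq : q0 DiscB by move=> x Zx; rewrite -meval_mpt; have [] := Tbad x (ZT x Zx).
(* The strict inclusions of (0) in (p) and of (p) in [q0] cost two dimensions. At infinity p is X_0
   and w is [DiscB]; elsewhere p is a factor of [DiscB] and w is [v]. *)
have [p [pP pq [w [wq nw]]]] : exists p, [/\ prime_elt p, q0 p & exists w, q0 w /\ ~ divides p w].
  case: (classic (q0 'X_ord0)) => [X0|nX0].
    by exists 'X_ord0; split=> //; [apply: mpolyX_prime|exists DiscB].
  have [p [pP pD qp]] := contains_prime_divisor qP Disc0 Dq.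
  exists p; split=> //; exists v; split; last exact: Hv.
  suff /(primeM qP)[] : q0 ('X_ord0 * v) by [].
  move=> x Zx; rewrite -meval_mpt mevalM mevalXU -/(psipt x) psipt0.
  by have [_ [->|->]] := Tbad x (ZT x Zx); rewrite ?mul0r ?mulr0.
have H1 : trdeg_ge (divides p) l.+2.
  apply: (trdeg_geS (principal_prime pP) qP _ wq nw H).
  by move=> q [c ->]; apply: (idealM qP).
have [p0 _ _] := pP.
have H2 : trdeg_ge (fun q : {mpoly K[N.+1]} => q = 0) l.+3.
  apply: (trdeg_geS (zero_is_prime _) (principal_prime pP) _ _ _ H1 (x := p)).
  - by move=> q ->; apply: divides0.
  - exact: divides_refl.
  - exact/eqP.
by have := trdeg_ge_le (zero_is_prime {mpoly K[N.+1]}) H2; rewrite addn2.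
Qed.

Definition linear_section (i : nat) (b : 'I_N.+1 -> K) :=
  nonzero b /\ forall j : 'I_N.+1, (i < j)%N -> b j = 0.

Lemma linear_section_prime i q1 q2 : vanish (linear_section i) (q1 * q2) ->
  vanish (linear_section i) q1 \/ vanish (linear_section i) q2.
Proof.
pose y (j : 'I_N.+1) : {mpoly K[N.+1]} := if (j <= i)%N then 'X_j else 0.
have V q : vanish (linear_section i) q <-> msubst y q = 0.
  split=> H; last first.
    move=> b [_ b0]; have -> : b = mpt y b.
      apply: functional_extensionality => j; rewrite /mpt /y.
      by case: leqP => ij; rewrite (mevalXU, meval0) // b0.
    by rewrite meval_mpt H meval0.
  suff /eqP : 'X_ord0 * msubst y q = 0.
    rewrite mulf_eq0 => /orP[/eqP X0|/eqP //].
    have := congr1 (meval (fun _ => 1)) X0; rewrite mevalXU meval0 => /eqP; by rewrite oner_eq0.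
  apply: (mpoly_eval_eq0 Kclosed) => z; rewrite mevalM mevalXU -meval_mpt.
  have [->|z0] := eqVneq (z ord0) 0; first by rewrite mul0r.
  rewrite H ?mulr0 //; split; first by exists ord0; rewrite /mpt /y /= mevalXU.
  by move=> j ij; rewrite /mpt /y leqNgt ij meval0.
by move/V/eqP; rewrite rmorphM mulf_eq0 => /orP[/eqP|/eqP] H; [left|right]; apply/V.
Qed.

Lemma linear_section_nonempty i : exists b, linear_section i b.
Proof.
exists (fun j => (j == ord0)%:R); split; first by exists ord0; rewrite eqxx oner_neq0.
by move=> j ij; rewrite -val_eqE gtn_eqF //; apply: leq_trans ij.
Qed.

(** The equation psi_i = 0 cuts from [Y] a set lying over the next smaller section. A minimal
    irreducible part of it carries a chain by induction, and [Y] is strictly larger since it has a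
    point over a coordinate vector. *)
Lemma chain_over_section i Y : (i <= N)%N -> pclosed Y -> irreducible (@pclosed K r.+1) Y ->
  psubset Y pcone -> (forall b, linear_section i b -> exists2 x, Y x & psipt x = b) ->
  has_chain (@pclosed K r.+1) Y i.
Proof.
elim: i Y => [|i IH] Y iN Yc Yi YS Yo; first exact: (has_chain0 Yc Yi (fun x H => H)).
pose ii := Ordinal (iN : (i.+1 < N.+1)%N).
pose S x := Y x /\ psipt x ii = 0.
have Sc : pclosed S.
  have c2 : pclosed (fun x => nonzero x /\ components_poly (psi ii) x = 0) := pclosed_components _.
  have := @pclosed_inter K r.+1 bool
    (fun b : bool => if b then Y else fun x => nonzero x /\ components_poly (psi ii) x = 0)
    (inhabits true).
  have -> : (fun x => forall b : bool, (if b then Y else fun x => nonzero x /\ components_poly (psi ii) x = 0) x) = S.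
    apply: functional_extensionality => x; apply: boolp.propext.
    have key : psipt x ii = 0 <-> components_poly (psi ii) x = 0.
      split=> [x0|c0].
        suff : 'X * components_poly (psi ii) x = 0.
          by move/eqP; rewrite mulf_eq0 polyX_eq0 => /eqP /=.
        apply: (poly_eval_eq0 Kclosed) => t; rewrite hornerM components_polyE.
        by rewrite -[_.@[_]]/(psipt (fun i => t * x i) ii) psipt_scale /base_scale x0 !mulr0.
      have := components_polyE (psi ii) x 1; rewrite c0 horner0 => E; rewrite /psipt /mpt [RHS]E.
      by apply: meval_eq => k; rewrite mul1r.
    split=> [H|[Yx x0] []]; last 2 first.
    - by [].
    - by split; [apply: (pclosed_nonzero Yc)|apply/key].
    split; [exact: (H true)|apply/key; by have [] := H false].
  by apply; case.
have iN' : (i <= N)%N by apply: ltnW.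
have [|||||||M [Mc Mi MS Mo]] := @irreducible_lift K ('I_r.+1 -> K) N.+1 (@pclosed K r.+1)
  psipt (linear_section i) S.
- exact: pclosed_inter.
- move=> b _; have [J [s sE]] := cone_fibres Kclosed ok b; exists J, s => x [Yx _] xb.
  by apply: sE => //; have [] := YS x Yx.
- exact: Sc.
- move=> b [b0 bi]; have [|x Yx xb] := Yo b.
    by split=> // j ij; apply: bi; apply: ltnW.
  by exists x => //; split=> //; rewrite xb bi.
- exact: linear_section_nonempty.
- exact: linear_section_prime.
- move=> A b Ac AS [b0 bi] nb; apply: (cone_separates_gen Kclosed ok Disc0).
    by move=> x /AS[/YS[]].
  move=> x cx xb; have [||p [pA _ px]] := pclosed_sep Ac (x := x).
  - by apply: nonzero_psipt; rewrite xb.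
  - by move=> Ax; apply: nb; exists x.
  by exists p.
have MY : psubset M Y by move=> x /MS[].
apply: (has_chainS (IH M iN' Mc Mi _ Mo) MY Yc Yi) => // [x /MY/YS //|YM].
have [|x Yx xb] := Yo (fun j => (j == ii)%:R).
  split; first by exists ii; rewrite eqxx oner_neq0.
  by move=> j ij; rewrite -val_eqE gtn_eqF.
by have [_] := MS x (YM x Yx); rewrite xb eqxx => /eqP; rewrite oner_eq0.
Qed.

Lemma pcone_chain (sqf : forall p, prime_elt p -> ~ divides (p ^+ 2) DiscB) :
  has_chain (@pclosed K r.+1) pcone N.
Proof.
apply: chain_over_section => // [|b [b0 _]]; first exact: pcone_irreducible.
have [x cx xb] := cone_onto Kclosed ok b; exists x => //; split=> //.
by apply: nonzero_psipt; rewrite xb.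
Qed.
End ConeDimension.

(** * Triangular systems *)

Definition pt (K : Type) n (t : K) (a : 'I_n -> K) : 'I_n.+1 -> K :=
  fun i => if unlift ord0 i is Some j then a j else t.

Section TriangularSystem.
Variables (K : fieldType) (n m N : nat).
Local Notation r := n.+2.
Variables (G : 'I_m -> {mpoly K[r]}) (w : 'I_m -> nat) (jj : 'I_m -> 'I_r) (e : 'I_N -> 'I_r).

(* The shape forced on the [G i] by the Jacobian condition of (H3) at the origin;
   it makes [W] the graph of a polynomial map in the free coefficients [a_(e l)]. *)
Record triangular : Prop := Triangular {
  tri_wt : forall i mon, mon \in msupp (G i) -> (mwt mon <= w i)%N;
  tri_lead : forall i, w i = (r - jj i)%N;
  tri_coef : forall i, (G i)@_(U_(jj i)) != 0;
  tri_lower : forall i mon, mon \in msupp (G i) -> mon != U_(jj i)%MM ->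
    forall j, mon j != 0%N -> (jj i < j)%N;
  tri_inj : injective jj;
  tri_e_inj : injective e;
  tri_cover : forall j, (exists i, j = jj i) \/ (exists l, j = e l);
  tri_disj : forall i l, jj i != e l }.

Hypothesis tri : triangular.

(** The weighted homogenization of [G i], with X_0 of weight 1: it gives back [G i] at X_0 = 1 and
    its part of top weight at X_0 = 0. *)
Definition Gh (i : 'I_m) : {mpoly K[r.+1]} :=
  \sum_(mon <- msupp (G i)) (G i)@_mon *:
    ('X_ord0 ^+ (w i - mwt mon) * \prod_j 'X_(lift ord0 j) ^+ mon j).

Definition gam_step (h : 'I_r -> {mpoly K[N.+1]}) (j : 'I_r) : {mpoly K[N.+1]} :=
  if [pick i | jj i == j] is Some i then
    - ((G i)@_(U_(jj i)))^-1 *: \sum_(mon <- msupp (G i) | mon != U_(jj i)%MM) (G i)@_mon *: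
      ('X_ord0 ^+ (w i - mwt mon) * \prod_j h j ^+ mon j)
  else if [pick l | e l == j] is Some l then 'X_(lift ord0 l) else 0.

(** The equations are solved for their leading variables in order of increasing weight r - j. After
    s rounds the coefficients of weight at most s are final, so r rounds suffice. *)
Fixpoint gam_iter (s : nat) : 'I_r -> {mpoly K[N.+1]} :=
  if s is s'.+1 then gam_step (gam_iter s') else fun _ => 0.

Definition gam := gam_iter r.

Lemma pick_jj i : [pick i' | jj i' == jj i] = Some i.
Proof. by case: pickP => [i' /eqP/(tri_inj tri) -> //|/(_ i)]; rewrite eqxx. Qed.

Lemma pick_jj_e l : [pick i | jj i == e l] = None.
Proof. by case: pickP => // i; rewrite (negbTE (tri_disj tri i l)). Qed.

Lemma gam_step_e h l : gam_step h (e l) = 'X_(lift ord0 l).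
Proof.
rewrite /gam_step pick_jj_e.
by case: pickP => [l' /eqP/(tri_e_inj tri) -> //|/(_ l)]; rewrite eqxx.
Qed.

Lemma gam_step_ext h h' (j : 'I_r) :
  (forall j' : 'I_r, (j < j')%N -> h j' = h' j') -> gam_step h j = gam_step h' j.
Proof.
move=> H; have [[i jE]|[l ->]] := tri_cover tri j; last by rewrite !gam_step_e.
rewrite jE in H *; rewrite /gam_step pick_jj; congr (_ *: _).
rewrite big_seq_cond [RHS]big_seq_cond; apply: eq_bigr => mon /andP[mG mU].
congr (_ *: (_ * _)); apply: eq_bigr => j' _.
have [->|mj] := eqVneq (mon j') 0%N; first by rewrite !expr0.
by rewrite H //; apply: tri_lower mj.
Qed.

Lemma gam_iter_stable s s' (j : 'I_r) : (r - j <= s)%N -> (r - j <= s')%N ->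
  gam_iter s j = gam_iter s' j.
Proof.
elim: s s' j => [|s IH] [|s'] j js js'.
- by [].
- by have := ltn_ord j; move: js; rewrite leqn0 subn_eq0 leqNgt => /negP.
- by have := ltn_ord j; move: js'; rewrite leqn0 subn_eq0 leqNgt => /negP.
apply: gam_step_ext => j' jj'; apply: IH.
  by rewrite -ltnS; apply: leq_trans js; rewrite ltn_sub2l.
by rewrite -ltnS; apply: leq_trans js'; rewrite ltn_sub2l.
Qed.

Lemma gamE j : gam j = gam_step gam j.
Proof.
rewrite {1}/gam (gam_iter_stable (s' := r.+1)) ?leq_subr //.
exact: leq_trans (leq_subr _ _) (leqnSn _).
Qed.

Lemma gam_free l : gam (e l) = 'X_(lift ord0 l).
Proof. by rewrite gamE gam_step_e. Qed.

Lemma meval_gam_dep i b : gampt gam b (jj i) =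
  - ((G i)@_(U_(jj i)))^-1 * \sum_(mon <- msupp (G i) | mon != U_(jj i)%MM)
     (G i)@_mon * (b ord0 ^+ (w i - mwt mon) * \prod_j gampt gam b j ^+ mon j).
Proof.
rewrite /gampt gamE /gam_step pick_jj mevalZ raddf_sum; congr (_ * _).
apply: eq_bigr => mon _; rewrite /= mevalZ mevalM rmorphXn /= mevalXU rmorph_prod.
by congr (_ * (_ * _)); apply: eq_bigr => j _; rewrite rmorphXn.
Qed.

Lemma mwt_U (j : 'I_r) : mwt U_(j)%MM = (r - j)%N.
Proof.
rewrite /mwt (bigD1 j) //= mnm1E eqxx muln1 big1 ?addn0 // => k kj.
by rewrite mnm1E eq_sym (negbTE kj) muln0.
Qed.

Lemma U_supp i : U_(jj i)%MM \in msupp (G i).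
Proof. by rewrite mcoeff_msupp; apply: tri_coef. Qed.

Lemma meval_Gh i t a : (Gh i).@[pt t a] =
  \sum_(mon <- msupp (G i)) (G i)@_mon * (t ^+ (w i - mwt mon) * \prod_j a j ^+ mon j).
Proof.
rewrite raddf_sum; apply: eq_bigr => mon _.
rewrite /= mevalZ mevalM rmorphXn /= mevalXU rmorph_prod {1}/pt unlift_none.
congr (_ * (_ * _)); apply: eq_bigr => j _.
by rewrite rmorphXn /= mevalXU /pt liftK.
Qed.

Lemma meval_Gh1 i a : (Gh i).@[pt 1 a] = (G i).@[a].
Proof. by rewrite meval_Gh mevalE; apply: eq_bigr => mon _; rewrite expr1n mul1r. Qed.

Lemma Gh_gam i b : (Gh i).@[pt (b ord0) (gampt gam b)] = 0.
Proof.
rewrite meval_Gh (bigD1_seq _ (U_supp i)) ?msupp_uniq //= mwt_U tri_lead // subnn expr0 mul1r.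
rewrite (bigD1 (jj i)) //= mnm1E eqxx expr1 big1 ?mulr1 => [|j ji]; last first.
  by rewrite mnm1E eq_sym (negbTE ji) expr0.
rewrite meval_gam_dep; set S := \sum_(_ <- _ | _) _; set S' := \sum_(_ <- _ | _) _.
have -> : S' = S by apply: eq_bigr => mon _; rewrite (tri_lead tri).
by rewrite mulrA mulrN mulfV ?mulN1r ?addNr; last exact: tri_coef.
Qed.

Lemma triangular_cone_ok : cone_ok e gam.
Proof.
split=> [l|t b j]; first exact: gam_free.
have [k] := ubnP (r - j); elim: k j => // k IH j /ltnSE jk.
have [[i jE]|[l ->]] := tri_cover tri j; last first.
  by rewrite /gampt gam_free !mevalXU /base_scale /base_weight liftK.
rewrite jE !meval_gam_dep mulrCA; congr (_ * _); rewrite mulr_sumr big_seq_cond [RHS]big_seq_cond.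
apply: eq_bigr => mon /andP[mG mU]; rewrite [RHS]mulrCA; congr (_ * _).
rewrite [X in _ * X](_ : _ =
    t ^+ mwt mon * \prod_j0 gampt gam b j0 ^+ mon j0); last first.
  rewrite /mwt expr_sum -big_split /=; apply: eq_bigr => j' _.
  have [->|mj] := eqVneq (mon j') 0%N; first by rewrite muln0 !expr0 mulr1.
  rewrite IH ?exprMn ?exprM //; apply: leq_trans jk; rewrite jE ltn_sub2l //.
  exact: (tri_lower tri mG mU mj).
rewrite {1}/base_scale /base_weight unlift_none expr1 exprMn -tri_lead // mulrACA -exprD.
by rewrite subnK ?mulrA // (tri_wt tri mG).
Qed.

Definition chi (i : 'I_r.+1) : {mpoly K[r.+1]} :=
  if unlift ord0 i is Some j then coefA j else 'X_ord0.

(** Lifting after weighted homogenization; [homogenize_symlift] identifies this with the ordinary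
    homogenization of the lift. *)
Definition Rh (i : 'I_m) : {mpoly K[r.+1]} := msubst chi (Gh i).

Lemma meval_Rh i x : (Rh i).@[x] = (Gh i).@[pt (x ord0) (coef_at x)].
Proof.
rewrite /Rh meval_msubst; apply: meval_eq => k; rewrite /chi /pt.
by case: unlift => [j|] //; rewrite mevalXU.
Qed.

Definition Rideal (p : {mpoly K[r.+1]}) := exists g : 'I_m -> {mpoly K[r.+1]}, p = \sum_i g i * Rh i.

Lemma Rideal_ideal : is_ideal Rideal.
Proof.
split=> [|_ _ [g ->] [h ->]|a _ [g ->]].
- by exists (fun _ => 0); rewrite big1 // => i _; rewrite mul0r.
- by exists (fun i => g i + h i); rewrite -big_split; apply: eq_bigr => i _; rewrite mulrDl.
- by exists (fun i => a * g i); rewrite mulr_sumr; apply: eq_bigr => i _; rewrite mulrA.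
Qed.

Lemma Rideal_gen i : Rideal (Rh i).
Proof.
exists (fun k => (k == i)%:R); rewrite (bigD1 i) //= eqxx mul1r big1 ?addr0 // => k /negbTE ->.
by rewrite mul0r.
Qed.

(** Induction on the weight: modulo [Rh i] the coefficient a_(jj i) satisfies the recursion that
    defines [gam], and that recursion involves only coefficients of smaller weight. *)
Lemma Rideal_coefA j : Rideal (coefA j - msubst (psi K e) (gam j)).
Proof.
have RI := Rideal_ideal.
have [k] := ubnP (r - j); elim: k j => // k IH j /ltnSE jk.
have [[i jE]|[l ->]] := tri_cover tri j; last first.
  by rewrite gam_free msubstX /psi liftK subrr; apply: ideal0.
pose c := (G i)@_(U_(jj i)).
have c0 : c != 0 := tri_coef tri i.
pose rest (x0 : {mpoly K[r.+1]}) (y : 'I_r -> {mpoly K[r.+1]}) :=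
  \sum_(mon <- msupp (G i) | mon != U_(jj i)%MM) (G i)@_mon *:
      (x0 ^+ (r - jj i - mwt mon) * \prod_j y j ^+ mon j) : {mpoly K[r.+1]}.
have E1 : c *: coefA (jj i) = Rh i - rest 'X_ord0 coefA.
  rewrite /Rh /Gh rmorph_sum /= (bigD1_seq _ (U_supp i)) ?msupp_uniq //=.
  rewrite msubstZ mwt_U tri_lead // subnn expr0 mul1r.
  rewrite (bigD1 (jj i)) //= mnm1E eqxx expr1 big1 ?mulr1 => [|j' ji]; last first.
    by rewrite mnm1E eq_sym (negbTE ji) expr0.
  rewrite msubstX {1}/chi liftK -/c -addrA [X in _ + X](_ : _ = 0) ?addr0 //.
  apply/eqP; rewrite subr_eq0; apply/eqP; apply: eq_bigr => mon _.
  rewrite msubstZ rmorphM rmorphXn /= msubstX {1}/chi unlift_none rmorph_prod /=.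
  by congr (_ *: (_ * _)); apply: eq_bigr => j' _; rewrite rmorphXn /= msubstX /chi liftK.
have E2 : c *: msubst (psi K e) (gam (jj i)) = - rest 'X_ord0 (fun j => msubst (psi K e) (gam j)).
  rewrite {1}gamE /gam_step pick_jj msubstZ scalerA mulrN mulfV // scaleN1r; congr (- _).
  rewrite rmorph_sum; apply: eq_bigr => mon _ /=; rewrite (tri_lead tri).
  rewrite msubstZ rmorphM rmorphXn /= msubstX {1}/psi unlift_none rmorph_prod /=.
  by congr (_ *: (_ * _)); apply: eq_bigr => j' _; rewrite rmorphXn.
have E3 : coefA j - msubst (psi K e) (gam j) =
    c^-1%:MP * (Rh i - (rest 'X_ord0 coefA - rest 'X_ord0 (fun j => msubst (psi K e) (gam j)))).
  have E4 : Rh i - (rest 'X_ord0 coefA - rest 'X_ord0 (fun j => msubst (psi K e) (gam j))) =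
      c *: (coefA (jj i) - msubst (psi K e) (gam (jj i))).
    by rewrite scalerBr E1 E2 opprK opprB addrA addrAC.
  by rewrite E4 mul_mpolyC scalerA mulVf // scale1r jE.
apply: (eq_ind_r Rideal _ E3); apply: (idealM RI); apply: (idealB RI); first exact: Rideal_gen.
rewrite /rest -sumrB big_seq_cond; apply: (big_ind Rideal (ideal0 RI) (idealD RI)) => mon /andP[mG mU].
rewrite -scalerBr -mulrBr -mul_mpolyC; apply: (idealM RI); apply: (idealM RI).
pose q : {mpoly K[r]} := 'X_[mon].
(* Variables absent from the monomial are replaced by their [gam] value, so that the congruence is
   required only where the induction hypothesis holds. *)
pose a' j' : {mpoly K[r.+1]} := if mon j' == 0%N then msubst (psi K e) (gam j') else coefA j'.
have -> : \prod_j' coefA j' ^+ mon j' = msubst a' q.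
  rewrite msubst_mon; apply: eq_bigr => j' _; rewrite /a'.
  by case: eqP => // ->; rewrite !expr0.
have -> : \prod_j' msubst (psi K e) (gam j') ^+ mon j' = msubst (fun j' => msubst (psi K e) (gam j')) q.
  by rewrite msubst_mon.
apply: (msubst_congr _ RI) => j'; rewrite /a'.
have [_|mj] := eqVneq; first by rewrite subrr; apply: (ideal0 RI).
apply: IH; apply: leq_trans jk; rewrite jE ltn_sub2l //.
exact: (tri_lower tri mG mU mj).
Qed.
Lemma Rh_vanish i : vanish (cone e gam) (Rh i).
Proof.
move=> x cx; rewrite meval_Rh -(psipt0 e x) -[RHS](Gh_gam i (psipt e x)).
by congr (_.@[pt _ _]).
Qed.

Lemma Rideal_vanish : psubset Rideal (vanish (cone e gam)).
Proof.
move=> _ [g ->] x cx; rewrite rmorph_sum /= big1 // => i _.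
by rewrite mevalM Rh_vanish // mulr0.
Qed.

Lemma Rh_cone x : (forall i, (Rh i).@[x] = 0) -> cone e gam x.
Proof.
move=> H; apply: functional_extensionality => j.
have [g E] := Rideal_coefA j.
apply/eqP; rewrite -subr_eq0; apply/eqP.
have -> : coef_at x j - gampt gam (psipt e x) j = (coefA j - msubst (psi K e) (gam j)).@[x].
  by rewrite mevalB -meval_mpt.
by rewrite E rmorph_sum big1 // => i _; rewrite rmorphM /= H mulr0.
Qed.

Lemma Gh_zeroE (Kclosed : alg_closed K) t a :
  (forall i, (Gh i).@[pt t a] = 0) <-> a = gampt gam (pt t (a \o e)).
Proof.
have [x <- <-] := coef_at_onto Kclosed a t.
have E : pt (x ord0) (coef_at x \o e) = psipt e x.
  apply: functional_extensionality => i; rewrite /pt; case: (unliftP ord0 i) => [l ->|->].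
    by rewrite psiptS.
  by rewrite psipt0.
rewrite E; split=> [H|cx i]; first by apply: Rh_cone => i; rewrite meval_Rh.
by rewrite -meval_Rh Rh_vanish.
Qed.

Lemma msubst_homog a b (y : 'I_a -> {mpoly K[b]}) p d : (forall i, y i \is 1.-homog) ->
  p \is d.-homog -> msubst y p \is d.-homog.
Proof.
move=> yh /dhomogP ph; rewrite (mpolyE p) rmorph_sum big_seq; apply: rpred_sum => mon /ph <- /=.
rewrite msubstZ; apply: rpredZ; rewrite msubst_mon mdegE.
apply: (big_rec2 (fun d (p : {mpoly K[b]}) => p \is d.-homog)) => [|j u q _ IH].
  exact: dhomog1.
by apply: dhomogM IH; rewrite -[X in X.-homog]mul1n; apply: dhomogMn.
Qed.

Lemma coefA_homog (j : 'I_r) : (coefA j : {mpoly K[r.+1]}) \is (r - j).-homog.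
Proof.
rewrite /coefA -signr_odd rpredZsign; apply: msubst_homog; last exact: dhomog_mesym.
by move=> i; rewrite dhomogX /= mdeg1.
Qed.

Lemma Rh_homog i : Rh i \is (w i).-homog.
Proof.
rewrite /Rh /Gh rmorph_sum big_seq; apply: rpred_sum => mon mG /=.
rewrite msubstZ; apply: rpredZ; rewrite rmorphM rmorphXn /= msubstX {1}/chi unlift_none.
have -> : msubst chi (\prod_j 'X_(lift ord0 j) ^+ mon j) = \prod_(j < r) coefA j ^+ mon j.
  by rewrite rmorph_prod; apply: eq_bigr => j _; rewrite rmorphXn /= msubstX /chi liftK.
rewrite -(subnK (tri_wt tri mG)) addnK; apply: dhomogM.
  by rewrite -[X in X.-homog]mul1n; apply: dhomogMn; rewrite dhomogX /= mdeg1.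
rewrite /mwt; apply: (big_rec2 (fun d (p : {mpoly K[r.+1]}) => p \is d.-homog)) => [|j d p _ IH].
  exact: dhomog1.
by apply: dhomogM IH; apply/dhomogMn/coefA_homog.
Qed.

Lemma pcone_Rh x : pcone e gam x <-> nonzero x /\ forall i, (Rh i).@[x] = 0.
Proof.
split=> [[x0 cx]|[x0 H]]; first by split=> // i; apply: Rh_vanish.
by split=> //; apply: Rh_cone.
Qed.

Lemma pclosed_pcone : pclosed (pcone e gam).
Proof.
exists (fun p => exists i, p = Rh i); split=> [_ [i ->]|x]; first by exists (w i); apply: Rh_homog.
rewrite pcone_Rh; split=> -[x0 H]; split=> //; first by move=> _ [i ->].
by move=> i; apply: H; exists i.
Qed.

End TriangularSystem.

(** * The discriminant under (H4)-(H6) *)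

Lemma meval_msubst_pt (K : fieldType) n N (t : K) (b : 'I_n -> {mpoly K[N]}) p y :
  (msubst (pt t%:MP b) p).@[y] = p.@[pt t (fun l => (b l).@[y])].
Proof.
rewrite meval_msubst; apply: meval_eq => i; rewrite /pt.
by case: unlift => // ; rewrite mevalC.
Qed.

Lemma meval_mmap_poly (K : fieldType) n (h : 'I_n -> {poly K}) p t :
  (mmap polyC h p).[t] = p.@[fun i => (h i).[t]].
Proof.
rewrite /mmap mevalE horner_sum; apply: eq_bigr => mon _.
rewrite hornerM hornerC /mmap1; congr (_ * _).
by rewrite horner_prod; apply: eq_bigr => i _; rewrite horner_exp.
Qed.

Lemma nonconst_chain_pred (K : fieldType) (Kclosed : alg_closed K) n (p : {mpoly K[n]}) :
  ~ (exists c, p = c%:MP) ->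
  (0 < n)%N /\ has_chain (@aclosed K n) (fun x => p.@[x] = 0) n.-1.
Proof.
case: n p => [|n] p pc; last by split=> //; apply: nonconst_chain.
by case: pc; exists (p@_0%MM); rewrite {1}[p]nvar0_mpolyC.
Qed.

Section Codimension.
Variables (K : fieldType) (n N : nat) (e : 'I_N -> 'I_n.+2) (gam : 'I_n.+2 -> {mpoly K[N.+1]}).
Local Notation r := n.+2.
Hypothesis Kclosed : alg_closed K.
Hypothesis ok : cone_ok e gam.
Local Notation DiscB := (DiscB gam).
Local Notation SubdiscB := (SubdiscB gam).

(** The member of the family at X_0 = t: W for t = 1 and the zero set of the weighted parts for t =
    0. *)
Definition fibre (t : K) : pset ('I_r -> K) := fun a => a = gampt gam (pt t (a \o e)).

Definition section_map (t : K) (j : 'I_r) : {mpoly K[N]} := msubst (pt t%:MP (fun l => 'X_l)) (gam j).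
Definition free_coords (l : 'I_N) : {mpoly K[r]} := 'X_(e l).

Lemma mpt_section_map t y : mpt (section_map t) y = gampt gam (pt t y).
Proof.
apply: functional_extensionality => j; rewrite /mpt meval_msubst_pt /gampt.
by apply: meval_eq => i; rewrite /pt; case: unlift => [l|//]; rewrite mevalXU.
Qed.

Lemma mpt_free_coords a : mpt free_coords a = a \o e.
Proof. by apply: functional_extensionality => l; rewrite /mpt mevalXU. Qed.

Lemma gampt_free b l : gampt gam b (e l) = b (lift ord0 l).
Proof. by rewrite /gampt (cone_free ok) mevalXU. Qed.

Lemma section_mapK t y : mpt free_coords (mpt (section_map t) y) = y.
Proof.
rewrite mpt_free_coords mpt_section_map; apply: functional_extensionality => l /=.
by rewrite gampt_free /pt liftK.
Qed.

Lemma fibre_section t y : fibre t (gampt gam (pt t y)).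
Proof.
rewrite /fibre; congr (gampt _ (pt _ _)); apply: functional_extensionality => l /=.
by rewrite gampt_free /pt liftK.
Qed.

Lemma fibre_chain_image t C (S : pset ('I_r -> K)) l :
  (forall y, C y -> S (gampt gam (pt t y))) ->
  has_chain (@aclosed K N) C l -> has_chain (@aclosed K r) S l.
Proof.
move=> CS /(chain_graph_image (section_mapK t)); apply: has_chain_mono => a [].
by rewrite mpt_section_map mpt_free_coords => /CS H ->.
Qed.

Lemma fibre_chain_preimage t (S : pset ('I_r -> K)) l : psubset S (fibre t) ->
  has_chain (@aclosed K r) S l -> has_chain (@aclosed K N) (fun y => S (gampt gam (pt t y))) l.
Proof.
move=> Sf /(chain_preimage (section_mapK t)) H; apply: has_chain_mono (H _).
  by move=> y; rewrite mpt_section_map.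
by move=> a /Sf; rewrite mpt_section_map mpt_free_coords.
Qed.

(** If the discriminant vanished on the whole fibre, a chain of length N in it would force one of
    length N + 1, but the fibre is a graph over affine N-space. *)
Lemma codim_Disc_nonzero t :
  codim_ge (@aclosed K r) (Dlocus (fibre t)) (fibre t) 1 -> exists y, DiscB.@[pt t y] != 0.
Proof.
move=> H; apply: NNPP => N0.
have D0 y : DiscB.@[pt t y] = 0 by apply/eqP; apply: contra_notT N0 => y0; exists y.
have /H : has_chain (@aclosed K r) (Dlocus (fibre t)) N.
  apply: (fibre_chain_image (C := fun _ => True) (t := t)); last exact: affine_space_chain.
  by move=> y _; split; [exact: fibre_section|rewrite -meval_DiscB D0].
by move=> /(fibre_chain_preimage (fun a h => h))/chain_le; rewrite addn1 ltnn.
Qed.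

(** The weight is read off on the roots, where the discriminant is the squared Vandermonde
    product. *)
Lemma Disc_weighted : exists w, forall t b, DiscB.@[base_scale (n := n) e t b] = t ^+ w * DiscB.@[b].
Proof.
have [w vE] : exists w, forall t (x : 'I_r -> K), vdm (fun i => t * x i) = t ^+ w * vdm x.
  exists (\sum_(i < r) \sum_(j < r | (i < j)%N) 1)%N => t x.
  rewrite expr_sum -big_split /=; apply: eq_bigr => i _.
  by rewrite expr_sum -big_split /=; apply: eq_bigr => j _; rewrite expr1 mulrBr.
exists (w * 2)%N => t b; have [x cx <-] := cone_onto Kclosed ok b.
rewrite -psipt_scale (cone_Disc cx) (cone_Disc (cone_scale ok t cx)).
by rewrite -[rpt (fun i => t * x i)]/(fun i => t * rpt x i) vE exprMn exprM mulrCA.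
Qed.

Hypothesis Disc0 : exists y, DiscB.@[pt 0 y] != 0.
Hypothesis Disc1 : exists y, DiscB.@[pt 1 y] != 0.

Lemma DiscB_neq0 : DiscB != 0.
Proof. by have [y] := Disc1; apply: contraNneq => ->; rewrite meval0. Qed.

Lemma X0_ndvd_DiscB : ~ divides 'X_ord0 DiscB.
Proof.
by case=> q E; have [y] := Disc0; rewrite E mevalM mevalXU /pt unlift_none mulr0 eqxx.
Qed.

(** Along a scaling orbit [DiscB] is a monomial in s, so its divisor [p] is c s^a, where c is the
    value of [p] on X_0 = 1. Hence p = c X_0^a, which cannot be a prime factor of [DiscB]. *)
Lemma Disc_divisor_nonconst p : prime_elt p -> divides p DiscB ->
  ~ exists c, msubst (pt 1%:MP (fun l => 'X_l)) p = c%:MP_[N].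
Proof.
move=> pP [q DE] [c pc].
have pc1 b : b ord0 = 1 -> p.@[b] = c.
  move=> b0; have := congr1 (meval (fun l => b (lift ord0 l))) pc.
  rewrite mevalC meval_msubst_pt => <-; apply: meval_eq => i; rewrite /pt.
  by case: (unliftP ord0 i) => [l ->|->] //; rewrite mevalXU.
have [w Dw] := Disc_weighted.
have pa b : b ord0 = 1 -> DiscB.@[b] != 0 ->
    exists2 a : 'I_w.+1, True & forall s, p.@[base_scale (n := n) e s b] = c * s ^+ a.
  move=> b1 Db.
  pose h i : {poly K} := (b i)%:P * 'X^(base_weight e i).
  have hE s (u : {mpoly K[N.+1]}) : (mmap polyC h u).[s] = u.@[base_scale (n := n) e s b].
    rewrite meval_mmap_poly; apply: meval_eq => i.
    by rewrite /h hornerM hornerC hornerXn /base_scale mulrC.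
  have hD : mmap polyC h DiscB = DiscB.@[b] *: 'X^w.
    apply/eqP; rewrite -subr_eq0; apply/eqP; apply: (poly_eval_eq0 Kclosed) => s.
    by rewrite hornerD hornerN hE Dw hornerZ hornerXn mulrC subrr.
  have : mmap polyC h p %| 'X^w.
    rewrite -(dvdpZr _ _ Db) -hD DE; apply/dvdpP; exists (mmap polyC h q).
    apply/eqP; rewrite -subr_eq0; apply/eqP; apply: (poly_eval_eq0 Kclosed) => s.
    by rewrite hornerD hornerN hornerM !hE mevalM subrr.
  rewrite -['X]subr0 => /dvdp_exp_XsubCP[a aw].
  rewrite subr0 => /eqpP[[u v] /= /andP[u0 v0] E].
  have hp : mmap polyC h p = (u^-1 * v) *: 'X^a by rewrite -scalerA -E scalerA mulVf // scale1r.
  have ps s : p.@[base_scale (n := n) e s b] = u^-1 * v * s ^+ a by rewrite -hE hp hornerZ hornerXn.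
  have cE : c = u^-1 * v.
    rewrite -(pc1 b b1) -[RHS]mulr1 -(expr1n _ a) -ps; apply: meval_eq => i.
    by rewrite /base_scale expr1n mul1r.
  by exists (Ordinal (aw : (a < w.+1)%N)) => // s; rewrite ps cE.
(* The exponent a may depend on the orbit; the product over its finitely many values vanishes
   everywhere, hence one factor is zero. *)
have prod0 : 'X_ord0 * DiscB * \prod_(a < w.+1) (p - c *: 'X_ord0 ^+ a) = 0.
  apply: (mpoly_eval_eq0 Kclosed) => b; rewrite !mevalM mevalXU.
  have [->|b0] := eqVneq (b ord0) 0; first by rewrite !mul0r.
  have [->|Db] := eqVneq DiscB.@[b] 0; first by rewrite mulr0 mul0r.
  pose b' := base_scale (n := n) e (b ord0)^-1 b.
  have bE : base_scale (n := n) e (b ord0) b' = b.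
    apply: functional_extensionality => i.
    by rewrite /b' /base_scale mulrA -exprMn mulfV // expr1n mul1r.
  have [||a _ H] := pa b'.
  - by rewrite /b' /base_scale /base_weight unlift_none expr1 mulVf.
  - by rewrite Dw mulf_neq0 // expf_neq0 // invr_eq0.
  rewrite rmorph_prod (bigD1 a) //= mevalB mevalZ rmorphXn /= mevalXU -[in p.@[_]]bE H subrr.
  by rewrite mul0r mulr0.
have [p0 pu _] := pP.
have X0 : 'X_ord0 != 0 :> {mpoly K[N.+1]} by have [] := mpolyX_prime (n := N) K ord0.
move/eqP: prod0; rewrite !mulf_eq0 (negbTE X0) (negbTE DiscB_neq0) /= => /prodf_eq0[a _].
rewrite subr_eq0 => /eqP pE.
have c0 : c != 0 by apply: contraNneq p0 => c0; rewrite pE c0 scale0r.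
case: (posnP a) => [a0|a0].
  case/negP: pu; rewrite pE a0 expr0 -mul_mpolyC mulr1; exact: mpoly_const_unit.
apply: X0_ndvd_DiscB; apply: divides_trans (_ : divides p DiscB); last by exists q.
by exists (c *: 'X_ord0 ^+ a.-1); rewrite pE -scalerAl -exprSr prednK.
Qed.

Definition bad : pset ('I_r -> K) :=
  fun a => (Dlocus (fibre 1) a /\ exists j : 'I_r, nat_of_ord j = 0%N /\ a j = 0) \/ S1locus (fibre 1) a.

Hypothesis H5 : codim_ge (@aclosed K r) bad (Dlocus (fibre 1)) 1.

(** Otherwise the bad set contains a hypersurface of the graph, of dimension N - 1, and (H5) gives
    the discriminant locus a chain of length N, although the discriminant is not identically zero
    there. *)
Lemma Disc_divisor_not_bad p : prime_elt p -> divides p DiscB ->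
  ~ (forall y, p.@[pt 1 y] = 0 -> bad (gampt gam (pt 1 y))).
Proof.
move=> pP pD pbad; have := Disc_divisor_nonconst pP pD.
set q := msubst _ p => qc.
have qE y : q.@[y] = p.@[pt 1 y].
  by rewrite meval_msubst_pt; apply: meval_eq => i; rewrite /pt; case: unlift => // l; rewrite mevalXU.
have [N0 /(fibre_chain_image (t := 1) (S := bad))] := nonconst_chain_pred Kclosed qc.
have qb y : q.@[y] = 0 -> bad (gampt gam (pt 1 y)) by rewrite qE; apply: pbad.
move=> /(_ qb)/H5; rewrite addn1 prednK // => HD'.
have HD := fibre_chain_preimage (t := 1) (fun a (H : Dlocus (fibre 1) a) => proj1 H) HD'.
have ptE y : pt 1 (fun l => ('X_l : {mpoly K[N]}).@[y]) = pt 1 y.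
  by apply: functional_extensionality => i; rewrite /pt; case: unlift => // l; rewrite mevalXU.
have Dv : msubst (pt 1%:MP (fun l => 'X_l)) DiscB != 0 :> {mpoly K[N]}.
  have [y] := Disc1; apply: contraNneq => E.
  by rewrite -ptE -meval_msubst_pt E meval0.
suff : (N < N)%N by rewrite ltnn.
apply: (hypersurface_chain_lt Dv _ HD).
by move=> y [_ Dy]; rewrite meval_msubst_pt ptE meval_DiscB.
Qed.

Lemma gam0_Subdisc_coprime p : prime_elt p -> divides p DiscB -> ~ divides p (gam ord0 * SubdiscB).
Proof.
move=> pP pD pv; apply: (Disc_divisor_not_bad pP pD) => y py.
have Z u : divides p u -> u.@[pt 1 y] = 0 by case=> c ->; rewrite mevalM py mulr0.
have D : Dlocus (fibre 1) (gampt gam (pt 1 y)).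
  by split; [exact: fibre_section|rewrite -meval_DiscB; apply: Z].
have [_ _ pM] := pP; have [/Z g0|/Z s0] := pM _ _ pv; [left|right]; split=> //.
  by exists ord0.
by rewrite -meval_SubdiscB.
Qed.

Variable kl : 'I_N.
Hypothesis indep : forall b b' : 'I_N.+1 -> K, (forall i, i != lift ord0 kl -> b i = b' i) ->
  forall j, j != e kl -> gampt gam b j = gampt gam b' j.

(** At a zero of [p] outside the bad set the polynomial has a nonzero double root t, and f / (T - t)
    and f' / (T - t) are coprime. Moving a_k alone stays in the family by [indep]; along this line
    the discriminant has a simple zero, while p^2 would contribute a double one. *)
Lemma DiscB_sqfree p : prime_elt p -> ~ divides (p ^+ 2) DiscB.
Proof.
move=> pP p2D; have pD : divides p DiscB.
  by apply: divides_trans p2D; exists p; rewrite expr2.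
apply: (Disc_divisor_not_bad pP pD) => y; set b := pt 1 y => pb.
set a := gampt gam b.
have Da : Disc a = 0.
  by rewrite -meval_DiscB; case: pD => q ->; rewrite mevalM pb mulr0.
have aD : Dlocus (fibre 1) a by split=> //; apply: fibre_section.
apply: NNPP => nbad.
have a0 : a ord0 != 0.
  by apply: contra_notN nbad => /eqP a0; left; split=> //; exists ord0.
have Sa : Subdisc a != 0 by apply: contra_notN nbad => /eqP Sa; right.
have [x fx] := alg_closed_split Kclosed (fpoly_monic a) (size_fpoly _).
have [i [j [ij xij]]] : exists i j, i != j /\ x i = x j.
  apply: NNPP => H; move: Da; rewrite (Disc_vdm fx) => /eqP.
  rewrite mulf_eq0 signr_eq0 expf_eq0 /=; apply/negP; apply: vdm_neq0 => i j xij.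
  by apply/eqP; apply: contra_notT H => ij; exists i, j.
pose t := x i; pose h := \prod_(l | (l != i) && (l != j)) ('X - (x l)%:P).
have fE : fpoly a = h * ('X - t%:P) * ('X - t%:P).
  by rewrite fx (bigD1 i) //= (bigD1 j) /= 1?eq_sym // -xij -/t mulrA mulrC mulrA.
have dfE : (fpoly a)^`() = (h^`() * ('X - t%:P) + h *+ 2) * ('X - t%:P).
  rewrite fE !derivM derivB derivX derivC subr0 !mulr1 mulrDl mulrDl mulr2n.
  ring.
have f1t : (h * ('X - t%:P)).[t] = 0 by rewrite hornerM hornerXsubC subrr mulr0.
have t0 : t != 0.
  apply: contraNneq a0 => t0; rewrite -(fpoly_coef a) fE t0 subr0.
  by rewrite coefMX.
(* A common root would complete T - t to a common factor of degree 2 of f and f', and the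
   subdiscriminant would vanish. *)
have cop : coprimep (h * ('X - t%:P)) (h^`() * ('X - t%:P) + h *+ 2).
  apply/negPn/negP => ncop; case/eqP: Sa.
  have [s] := Kclosed (ncop : size (gcdp _ _) != 1%N); rewrite root_gcd => /andP[/factor_theorem[u uE] /factor_theorem[v vE]].
  apply: (@Subdisc_common_factor _ _ _ (('X - s%:P) * ('X - t%:P))).
  - by rewrite size_Mmonic ?polyXsubC_eq0 ?monicXsubC // !size_XsubC.
  - by rewrite fE uE -mulrA dvdp_mull.
  - by rewrite dfE vE -mulrA dvdp_mull.
case: (Disc_line_simple (k := e kl) fE dfE f1t t0 cop).
pose g i := (b i)%:P + (if i == lift ord0 kl then 'X else 0) : {poly K}.
have gE s u : (mmap polyC g u).[s] = u.@[fun i => b i + (if i == lift ord0 kl then s else 0)].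
  rewrite meval_mmap_poly; apply: meval_eq => l; rewrite /g hornerD hornerC.
  by case: eqP; rewrite ?hornerX ?horner0.
have gD : mmap polyC g DiscB = Disc (line_coef a (e kl)).
  rewrite /DiscB (map_Disc (mmap polyC g)); congr Disc; apply: functional_extensionality => l /=.
  apply/eqP; rewrite -subr_eq0; apply/eqP; apply: (poly_eval_eq0 Kclosed) => s.
  rewrite hornerD hornerN gE /line_coef hornerD hornerC.
  have [->|lk] := eqVneq l (e kl).
    by rewrite (cone_free ok) mevalXU eqxx hornerX /a gampt_free subrr.
  rewrite horner0 addr0; apply/eqP; rewrite subr_eq0; apply/eqP; apply: indep => // q /negbTE E.
  by rewrite /= E; apply: addr0.
case: p2D => q DE; rewrite -gD DE.
have : divides 'X (mmap polyC g p).
  have /factor_theorem[u] : root (mmap polyC g p) 0.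
    rewrite /root gE; apply/eqP; rewrite -[RHS]pb; apply: meval_eq => l.
    by case: ifP => _; apply: addr0.
  by rewrite subr0 => ->; exists u.
case=> u uE; exists (mmap polyC g q * u ^+ 2).
by rewrite rmorphM rmorphXn /= uE exprMn mulrA.
Qed.

End Codimension.

(** * Singular points *)

(** First-order expansion along the arc [h], the form of the chain rule used for the Jacobian of the
    lifts. *)
Lemma tangent (K : fieldType) n (h : 'I_n -> {poly K}) p :
  (mmap polyC h p)`_0 = p.@[fun i => (h i)`_0] /\
  (mmap polyC h p)`_1 = \sum_j (h j)`_1 * (p^`M(j)).@[fun i => (h i)`_0].
Proof.
move: p; apply: mpoly_subring_full => [|c|i]; last 2 first.
- rewrite mmapC mevalC !coefC; split=> //.
  by rewrite big1 // => j _; rewrite mderivC meval0 mulr0.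
- rewrite mmapX mmap1U mevalXU; split=> //.
  rewrite (bigD1 i) //= mderivX mnm1E eqxx.
  rewrite big1 ?addr0 => [|j ji].
    rewrite scale1r (_ : (U_(i) - U_(i))%MM = 0%MM) ?mpolyX0 ?meval1 ?mulr1 //.
    by apply/mnmP => l; rewrite mnmBE mnm0E subnn.
  by rewrite mderivX mnm1E eq_sym (negbTE ji) scale0r meval0 mulr0.
split=> [|p q [p0 p1] [q0 q1]|p q [p0 p1] [q0 q1]].
- rewrite rmorph1 meval1 !coef1; split=> //.
  by rewrite big1 // => j _; rewrite -mpolyC1 mderivC meval0 mulr0.
- rewrite rmorphB mevalB !coefB p0 p1 q0 q1 -sumrB; split=> //.
  by apply: eq_bigr => j _; rewrite mderivB mevalB mulrBr.
- rewrite rmorphM mevalM !coefM !big_ord_recl !big_ord0 /= !addr0 !subn0 p0 p1 q0 q1; split=> //.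
  rewrite mulr_sumr mulr_suml -big_split; apply: eq_bigr => j _ /=.
  rewrite mderivM mevalD !mevalM; ring.
Qed.

Lemma lagrange_span (K : fieldType) (I : finType) (A : {set I}) (y : I -> K) (q : {poly K}) :
  {in A &, injective y} -> (size q <= #|A|)%N ->
  exists c, q = \sum_(l in A) c l *: \prod_(i in A | i != l) ('X - (y i)%:P).
Proof.
move=> yi sq; pose H l := \prod_(i in A | i != l) ('X - (y i)%:P).
have H0 l l' : l \in A -> l' \in A -> l != l' -> (H l').[y l] = 0.
  move=> lA l'A ll'; rewrite /H (bigD1 l) /=; last by rewrite lA ll'.
  by rewrite hornerM hornerXsubC subrr mul0r.
have H1 l : l \in A -> (H l).[y l] != 0.
  move=> lA; rewrite horner_prod; apply/prodf_neq0 => i /andP[iA il].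
  by rewrite hornerXsubC subr_eq0; apply: contra il => /eqP/(yi _ _ lA iA) ->.
exists (fun l => q.[y l] / (H l).[y l]); apply/eqP; rewrite -subr_eq0; apply/eqP.
set d := q - _; apply: (@roots_geq_poly_eq0 _ d [seq y l | l <- enum A]).
- apply/allP => z /mapP[l]; rewrite mem_enum => lA {z}->; rewrite /root /d hornerD hornerN horner_sum.
  rewrite (bigD1 l) //= hornerZ divfK ?H1 // big1 ?addr0 ?subrr // => l' /andP[l'A l'l].
  by rewrite hornerZ (H0 l l') ?mulr0 //; rewrite eq_sym.
- by rewrite map_inj_in_uniq ?enum_uniq // => i j; rewrite !mem_enum; apply: yi.
- rewrite size_map -cardE; apply: leq_trans (size_polyD _ _) _; rewrite geq_max sq size_polyN.
  apply: leq_trans (size_sum _ _ _) _; apply/bigmax_leqP => l lA.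
  apply: leq_trans (size_scale_leq _ _) _.
  rewrite size_prod => [|i _]; last by rewrite polyXsubC_eq0.
  rewrite (eq_bigr (fun _ => 2%N)) => [|i _]; last by rewrite size_XsubC.
  rewrite sum_nat_const.
  have -> : #|[pred i in A | i != l]| = #|A|.-1.
    by rewrite (cardsD1 l A) lA /= ; apply: eq_card => i; rewrite !inE andbC.
  have : (0 < #|A|)%N by rewrite card_gt0; apply/set0Pn; exists l.
  by case: #|A| => // a _; rewrite /= muln2 -addnn subSn ?leq_addr // addnK.
Qed.

Section RootFunctional.
Variables (K : fieldType) (n : nat) (x a mu : 'I_n.+2 -> K) (k : 'I_n.+2).
Local Notation r := n.+2.
Local Notation H l := (\prod_(i < r | i != l) ('X - (x i)%:P)).
Hypothesis fx : fpoly a = \prod_i ('X - (x i)%:P).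
Hypothesis mu_k : mu k = 0.
Hypothesis mu_H : forall l, \sum_(j < r) (H l)`_j * mu j = 0.

Let ell (p : {poly K}) := \sum_(j < r) p`_j * mu j.

Let ellD p q : ell (p + q) = ell p + ell q.
Proof. by rewrite -big_split; apply: eq_bigr => j _; rewrite coefD mulrDl. Qed.

Let ellZ c p : ell (c *: p) = c * ell p.
Proof. by rewrite mulr_sumr; apply: eq_bigr => j _; rewrite coefZ mulrA. Qed.

Let ellX (j : 'I_r) : ell 'X^j = mu j.
Proof.
rewrite /ell (bigD1 j) //= coefXn eqxx mul1r big1 ?addr0 // => i ij.
by rewrite coefXn val_eqE (negbTE ij) mul0r.
Qed.

Let ell_span (A : {set 'I_r}) (c : 'I_r -> K) (F : 'I_r -> {poly K}) :
  (forall l, l \in A -> ell (F l) = 0) -> ell (\sum_(l in A) c l *: F l) = 0.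
Proof.
move=> HF; apply: (big_ind (fun p => ell p = 0)) => [|p q p0 q0|l /HF Fl].
- by rewrite -(scale0r 0) ellZ mul0r.
- by rewrite ellD p0 q0 addr0.
- by rewrite ellZ Fl mulr0.
Qed.

Let roots_distinct_mu0 : injective x -> forall j, mu j = 0.
Proof.
move=> xi j; have sX : (size ('X^j : {poly K}) <= #|[set: 'I_r]|)%N by rewrite size_polyXn cardsT card_ord.
have [c cE] := lagrange_span (in2W xi) sX.
rewrite -ellX cE; apply: ell_span => l _.
rewrite [X in ell X](_ : _ = H l) ?mu_H //; first exact: mu_H.
by apply: eq_bigl => i'; rewrite inE.
Qed.

Lemma mu_neq0_Disc : (exists j, mu j != 0) -> Disc a = 0.
Proof.
case=> j muj; have [/injectiveP xi|/injectivePn[i [l il xil]]] := boolP (injectiveb x).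
  by rewrite roots_distinct_mu0 // eqxx in muj.
rewrite (Disc_vdm fx) -prod_diff_vdm (bigD1 i) //= (bigD1 l) /= 1?eq_sym //.
by rewrite xil subrr !mul0r.
Qed.

(** Suppose both factors are nonzero. Then one root t is double and nonzero, and the others are
    simple. For j < r - 1 the polynomial (T - t) T^j is a combination of the products killed by
    [ell], so mu_(j+1) = t mu_j. Thus mu_j = t^j mu_0, and mu_k = 0 gives mu = 0. *)
Lemma mu_neq0_Subdisc : (exists j, mu j != 0) -> a ord0 * Subdisc a = 0.
Proof.
case=> j0 mu0; apply/eqP; rewrite mulf_eq0; apply: contraNT mu0; rewrite negb_or => /andP[a0 Sa].
apply/eqP; move: j0.
have [/injectiveP xi|/injectivePn[i [i' ii' xii']]] := boolP (injectiveb x).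
  exact: roots_distinct_mu0.
pose t := x i'; pose A := [set~ i']; pose f1 := \prod_(l in A) ('X - (x l)%:P).
have fE : fpoly a = f1 * ('X - t%:P).
  by rewrite fx (bigD1 i') //= mulrC; congr (_ * _); apply: eq_bigl => l; rewrite !inE.
have t0 : t != 0.
  apply: contraNneq a0 => t0; rewrite -(fpoly_coef a) fE t0 subr0.
  by rewrite coefMX.
have iA : i \in A by rewrite !inE.
have f1t : f1.[t] = 0.
  by rewrite /f1 (bigD1 i) //= hornerM hornerXsubC xii' subrr mul0r.
have xA : {in A &, injective x}.
  move=> i1 i2 i1A i2A x12; apply/eqP; apply: contraNT Sa => i12.
  pose s := x i1; pose u := \prod_(l in A | (l != i1) && (l != i2)) ('X - (x l)%:P).
  have f1E : f1 = u * ('X - s%:P) * ('X - s%:P).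
    rewrite /f1 (bigD1 i1) //= (bigD1 i2) /=; last by rewrite i2A eq_sym.
    rewrite -x12 -/s mulrA mulrC mulrA; congr (_ * _ * _).
    by apply: eq_bigl => l; rewrite andbA.
  have : (u * ('X - s%:P)).[t] == 0.
    move: f1t; rewrite f1E !hornerM !hornerXsubC => /eqP.
    by rewrite -mulrA mulf_eq0 mulf_eq0 orbb -mulf_eq0.
  move=> /factor_theorem[v vE].
  apply/eqP/(@Subdisc_common_factor _ _ _ (('X - s%:P) * ('X - t%:P))).
  - by rewrite size_Mmonic ?polyXsubC_eq0 ?monicXsubC // !size_XsubC.
  - by rewrite fE f1E -mulrA dvdp_mull.
  - have -> : (fpoly a)^`() = (v + u *+ 2 + ('X - s%:P) * u^`()) * (('X - s%:P) * ('X - t%:P)).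
      rewrite fE derivM f1E vE derivM -vE derivM !derivB !derivX !derivC !subr0 !mulr1.
      rewrite [in X in _ + X = _]vE.
      ring.
    by rewrite dvdp_mull.
have step (j : nat) (jr : (j.+1 < r)%N) : mu (Ordinal jr) = t * mu (Ordinal (ltnW jr)).
  have sX : (size ('X^j : {poly K}) <= #|A|)%N by rewrite size_polyXn cardsC1 card_ord.
  have [c cE] := lagrange_span xA sX.
  apply/eqP; rewrite -subr_eq0 -!ellX /= -mulNr -ellZ -ellD; apply/eqP.
  have -> : ('X^(j.+1) + (- t) *: 'X^j : {poly K}) = \sum_(l in A) c l *: H l.
    rewrite scaleNr -mul_polyC exprS -mulrBl {1}cE mulr_sumr; apply: eq_bigr => l lA.
    rewrite -scalerAr; congr (_ *: _); rewrite [RHS](bigD1 i') /=; last by rewrite eq_sym; rewrite !inE in lA.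
    by congr (_ * _); apply: eq_bigl => l'; rewrite !inE andbC.
  by apply: ell_span => l _; apply: mu_H.
have muE : forall j (jr : (j < r)%N), mu (Ordinal jr) = t ^+ j * mu ord0.
  elim=> [|j IH] jr; first by rewrite mul1r; congr mu; apply: val_inj.
  by rewrite step IH exprS mulrA.
have mu0 : mu ord0 = 0.
  move: mu_k; case: k => k' k'r; rewrite muE => /eqP.
  by rewrite mulf_eq0 expf_eq0 (negbTE t0) andbF => /eqP.
by case=> j jr; rewrite muE mu0 mulr0.
Qed.
End RootFunctional.

Lemma rank_deficient (K : fieldType) m n (A : 'M[K]_(m, n)) : (\rank A < m)%N ->
  exists lam : 'I_m -> K, (exists i, lam i != 0) /\ forall j, \sum_i lam i * A i j = 0.
Proof.
move=> rA; have : kermx A != 0.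
  by rewrite -mxrank_eq0 mxrank_ker subn_eq0 -ltnNge.
case/rowV0Pn => v /sub_kermxP vA v0; exists (fun i => v 0 i); split.
  apply: NNPP => H; case/eqP: v0; apply/rowP => i; rewrite mxE.
  by apply/eqP; apply: contra_notT H => vi; exists i.
by move=> j; have /matrixP/(_ 0 j) := vA; rewrite !mxE.
Qed.

Lemma mderiv_subring (K : fieldType) n (i : 'I_n) :
  is_subring (fun p : {mpoly K[n]} => p^`M(i) = 0).
Proof.
split=> [|p q p0 q0|p q p0 q0]; first by rewrite -mpolyC1 mderivC.
  by rewrite mderivB p0 q0 subr0.
by rewrite mderivM p0 q0 mul0r mulr0 addr0.
Qed.

Section SingularLocus.
Variables (K : fieldType) (n m N : nat).
Local Notation r := n.+2.
Variables (G : 'I_m -> {mpoly K[r]}) (w : 'I_m -> nat) (jj : 'I_m -> 'I_r) (e : 'I_N -> 'I_r).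
Hypothesis Kclosed : alg_closed K.
Hypothesis tri : triangular G w jj e.
Local Notation gam := (gam G w jj e).
Local Notation Gh := (Gh G w).
Local Notation Rh := (Rh G w).

Definition Gterm i (mon : 'X_{1..r}) : {mpoly K[r.+1]} :=
  'X_ord0 ^+ (w i - mwt mon) * \prod_j 'X_(lift ord0 j) ^+ mon j.

Lemma mderivX_neq a (i j : 'I_a) : i != j -> ('X_i : {mpoly K[a]})^`M(j) = 0.
Proof. by move=> ij; rewrite mderivX mnm1E (negbTE ij) scale0r. Qed.

Lemma Gterm_deriv i (mon : 'X_{1..r}) (j : 'I_r) : mon j = 0%N -> (Gterm i mon)^`M(lift ord0 j) = 0.
Proof.
have S := mderiv_subring K (lift ord0 j); move=> mj; apply: (subringM S).
  by apply: (subringX S); apply: mderivX_neq.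
apply: (subring_prod S) => j' _.
have [->|jj'] := eqVneq j' j; first by rewrite mj expr0; apply: (subring1 S).
by apply: (subringX S); apply: mderivX_neq; rewrite (inj_eq lift_inj).
Qed.

Lemma Gh_deriv_free i (j : 'I_r) : (forall mon, mon \in msupp (G i) -> mon j = 0%N) ->
  (Gh i)^`M(lift ord0 j) = 0.
Proof.
move=> H; rewrite /Gh raddf_sum big_seq big1 // => mon mG /=.
by rewrite mderivZ -/(Gterm i mon) (@Gterm_deriv i mon) ?scaler0 // H.
Qed.

Lemma Gh_deriv_lead i : (Gh i)^`M(lift ord0 (jj i)) = ((G i)@_(U_(jj i)%MM))%:MP.
Proof.
rewrite /Gh raddf_sum (bigD1_seq _ (U_supp tri i)) ?msupp_uniq //= [X in _ + X](_ : _ = 0).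
  rewrite addr0 mderivZ mwt_U (tri_lead tri) subnn expr0 mul1r (bigD1 (jj i)) //= mnm1E eqxx expr1.
  rewrite big1 => [|j ji]; last by rewrite mnm1E eq_sym (negbTE ji) expr0.
  rewrite mulr1 mderivX mnm1E eqxx scale1r (_ : (U_(lift ord0 (jj i)) - U_(lift ord0 (jj i)))%MM = 0%MM).
    by rewrite mpolyX0 -mul_mpolyC mulr1.
  by apply/mnmP => l; rewrite mnmBE mnm0E subnn.
rewrite big_seq_cond big1 // => mon /andP[mG mU].
rewrite mderivZ -/(Gterm i mon) (@Gterm_deriv i mon) ?scaler0 //.
by apply/eqP; apply: contraT => /(tri_lower tri mG mU); rewrite ltnn.
Qed.

Lemma Gh_deriv_below i (j : 'I_r) : (j < jj i)%N -> (Gh i)^`M(lift ord0 j) = 0.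
Proof.
move=> ji; apply: Gh_deriv_free => mon mG; have [->|mU] := eqVneq mon U_(jj i)%MM.
  by rewrite mnm1E -val_eqE /= gtn_eqF.
by apply/eqP; apply: contraT => /(tri_lower tri mG mU); rewrite ltnNge (ltnW ji).
Qed.

(* The derivative of [prod_i (T - x_i)] along [x_l] is [- prod_(i != l) (T - x_i)]. *)
Lemma Rh_deriv i (l : 'I_r) x : ((Rh i)^`M(lift ord0 l)).@[x] =
  - \sum_(j < r) (\prod_(i' < r | i' != l) ('X - (rpt x i')%:P))`_j *
      ((Gh i)^`M(lift ord0 j)).@[pt (x ord0) (coef_at x)].
Proof.
pose h i' : {poly K} := (x i')%:P + (if i' == lift ord0 l then 'X else 0).
have h0 : (fun i => (h i)`_0) = x.
  apply: functional_extensionality => i'; rewrite coefD coefC /=.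
  by case: eqP => _; rewrite ?coefX ?coef0 addr0.
have h1 i' : (h i')`_1 = (i' == lift ord0 l)%:R.
  by rewrite coefD coefC add0r; case: eqP => _; rewrite ?coefX ?coef0.
have D p : (mmap polyC h p)`_1 = (p^`M(lift ord0 l)).@[x].
  rewrite (proj2 (tangent h p)) h0 (bigD1 (lift ord0 l)) //= h1 eqxx mul1r big1 ?addr0 // => j jl.
  by rewrite h1 (negbTE jl) mul0r.
have Z p : (mmap polyC h p)`_0 = p.@[x] by rewrite (proj1 (tangent h p)) h0.
pose h' (k : 'I_r.+1) := mmap polyC h (chi K k).
have RE : mmap polyC h (Rh i) = mmap polyC h' (Gh i).
  rewrite /Rh; move: (Gh i); apply: mpoly_subring_full => [|c|k].
  - split=> [|p q p0 q0|p q p0 q0]; first by rewrite !rmorph1.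
      by rewrite !rmorphB /= p0 q0.
    by rewrite !rmorphM /= p0 q0.
  - by rewrite msubstC !mmapC.
  - by rewrite msubstX [RHS]mmapX mmap1U.
rewrite -D RE (proj2 (tangent h' (Gh i))).
have -> : (fun i => (h' i)`_0) = pt (x ord0) (coef_at x).
  apply: functional_extensionality => k; rewrite /h' Z /chi /pt.
  by case: unlift => // ; rewrite mevalXU.
rewrite big_ord_recl [X in X + _](_ : _ = 0) ?add0r; last first.
  by rewrite /h' D /chi unlift_none mderivX_neq ?meval0 ?mul0r.
rewrite -sumrN; apply: eq_bigr => j _; rewrite -mulNr; congr (_ * _).
rewrite /h' /chi liftK.
set H := \prod_(_ < r | _) _.
suff -> : mmap polyC h (coefA j) = ((H * ('X - (rpt x l)%:P))`_j)%:P - H`_j *: 'X.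
  by rewrite coefB coefC coefZ coefX mulr1 sub0r.
apply/eqP; rewrite -subr_eq0; apply/eqP; apply: (poly_eval_eq0 Kclosed) => s.
rewrite hornerD hornerN hornerD hornerN hornerC hornerZ hornerX meval_mmap_poly.
set y := fun i => _; rewrite -[_.@[y]]/(coef_at y j) -[coef_at y j]fpoly_coef fpoly_coef_at.
have yE i' : rpt y i' = rpt x i' + (i' == l)%:R * s.
  rewrite /rpt /y /h hornerD hornerC (inj_eq lift_inj).
  by case: eqP => _; rewrite ?hornerX ?horner0 ?mul1r ?mul0r.
have -> : \prod_i ('X - (rpt y i)%:P) = H * ('X - (rpt x l)%:P) - s *: H.
  rewrite (bigD1 l) //= yE eqxx mul1r mulrC.
  have -> : \prod_(i < r | i != l) ('X - (rpt y i)%:P) = H.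
    by apply: eq_bigr => i' /negbTE il; rewrite yE il mul0r addr0.
  by rewrite polyCD opprD addrA mulrBr -[s *: H]mul_polyC [s%:P * H]mulrC.
by rewrite coefB coefZ [s * _]mulrC subrr.
Qed.

(** The dependency is pulled back to the coefficients: [mu] combines the gradients of the [Gh i]. By
    [Rh_deriv] it kills the products omitting one root, and it kills T^k because no [G i] involves
    a_k. *)
Lemma singular_point (k : 'I_r) x (lam : 'I_m -> K) : (forall i, indep_of k (G i)) ->
  cone e gam x -> (exists i, lam i != 0) ->
  (forall j, \sum_i lam i * ((Rh i)^`M(j)).@[x] = 0) ->
  (DiscB gam).@[psipt e x] = 0 /\ (gam ord0 * SubdiscB gam).@[psipt e x] = 0.
Proof.
move=> Gk cx lam0 HJ.
pose mu j := \sum_i lam i * ((Gh i)^`M(lift ord0 j)).@[pt (x ord0) (coef_at x)].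
have muk : mu k = 0.
  by rewrite /mu big1 // => i _; rewrite Gh_deriv_free ?meval0 ?mulr0 //; apply: Gk.
have muH l : \sum_(j < r) (\prod_(i' < r | i' != l) ('X - (rpt x i')%:P))`_j * mu j = 0.
  apply/eqP; rewrite -oppr_eq0; apply/eqP; rewrite -[RHS](HJ (lift ord0 l)).
  under eq_bigr => j _ do rewrite /mu mulr_sumr.
  rewrite exchange_big -sumrN; apply: eq_bigr => i _ /=; rewrite Rh_deriv mulrN mulr_sumr; congr (- _).
  by apply: eq_bigr => j _; rewrite mulrCA.
have mu0 : exists j, mu j != 0.
  have [i0 li0] := lam0.
  (* Among the equations that occur, the one whose leading variable has the largest weight is the
     only one involving that variable, so [mu] is nonzero there. *)
  case: (@arg_minnP _ i0 (fun i => lam i != 0) (fun i => val (jj i)) li0) => i li imin.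
  exists (jj i); rewrite /mu (bigD1 i) //= Gh_deriv_lead mevalC big1 => [|i' i'i].
    by rewrite addr0 mulf_neq0 // (tri_coef tri).
  have [->|li'] := eqVneq (lam i') 0; first by rewrite mul0r.
  rewrite Gh_deriv_below ?meval0 ?mulr0 // ltn_neqAle imin // andbT.
  by apply: contra i'i => /eqP/val_inj/(tri_inj tri) ->.
have fx := fpoly_coef_at x; rewrite cx in fx.
split; first by rewrite meval_DiscB; apply: (mu_neq0_Disc fx muH mu0).
by rewrite mevalM meval_SubdiscB; apply: (mu_neq0_Subdisc fx muk muH mu0).
Qed.
End SingularLocus.

(** * Weights and leading variables *)

Lemma mderiv_at0 (K : fieldType) n (p : {mpoly K[n]}) (j : 'I_n) a : (forall i, a i = 0) ->
  (p^`M(j)).@[a] = p@_(U_(j)).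
Proof.
move=> a0; have E q : q.@[a] = q@_0%MM :> K.
  elim/mpolyind: q => [|c mon q _ _ IH]; first by rewrite meval0 mcoeff0.
  rewrite mevalD mcoeffD IH mevalZ mcoeffZ mevalX mcoeffX; congr (_ * _ + _).
  have [->|mon0] := eqVneq mon 0%MM; first by rewrite big1 // => i _; rewrite mnm0E.
  have [i mi] : exists i, mon i != 0%N.
    apply: NNPP => H; case/eqP: mon0; apply/mnmP => i; rewrite mnm0E; apply/eqP.
    by apply: contra_notT H => mi; exists i.
  by rewrite (bigD1 i) //= a0 expr0n (negbTE mi) mul0r.
by rewrite E mcoeff_mderiv add0m mnm0E.
Qed.

Lemma mwt_ge r (mon : 'X_{1..r}) (j : 'I_r) : ((r - j) * mon j <= mwt mon)%N.
Proof. by rewrite /mwt (bigD1 j) //= leq_addr. Qed.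

Lemma mwt_eq0 r (mon : 'X_{1..r}) : mwt mon = 0%N -> mon = 0%MM.
Proof.
move=> w0; apply/mnmP => j; rewrite mnm0E; apply/eqP; rewrite -leqn0.
have := mwt_ge mon j; rewrite w0 leqn0 muln_eq0 subn_eq0 leqNgt ltn_ord /= => /eqP -> //.
Qed.

Lemma mwt0 r : mwt (0%MM : 'X_{1..r}) = 0%N.
Proof. by rewrite /mwt big1 // => j _; rewrite mnm0E muln0. Qed.

(** A variable of weight at least r - j already uses up the whole weight allowed. *)
Lemma mwt_leU r (mon : 'X_{1..r}) (j j' : 'I_r) : (mwt mon <= r - j)%N -> mon j' != 0%N ->
  (j' <= j)%N -> mon = U_(j)%MM.
Proof.
move=> wj mj' j'j; have m1 : (0 < mon j')%N by rewrite lt0n.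
have jE : j' = j.
  apply/val_inj/eqP; rewrite eqn_leq j'j leqNgt; apply/negP => lt.
  have := leq_trans (mwt_ge mon j') wj; rewrite leqNgt => /negP; apply.
  by apply: (@leq_trans (r - j')); rewrite ?ltn_sub2l // leq_pmulr.
subst j'; have rj : (0 < r - j)%N by rewrite subn_gt0.
move: wj; rewrite /mwt (bigD1 j) //= => wj.
have [m1' rest0] : mon j = 1%N /\ (\sum_(i < r | i != j) (r - i) * mon i = 0)%N.
  move: wj; set s := (\sum_(_ < _ | _) _)%N => wj.
  have : ((r - j) * mon j <= (r - j) * 1)%N by rewrite muln1; apply: leq_trans wj; rewrite leq_addr.
  rewrite leq_pmul2l // => mj1; have E : mon j = 1%N by apply/eqP; rewrite eqn_leq mj1.
  by split=> //; apply/eqP; rewrite -leqn0 -(leq_add2l (r - j)) addn0 -{1}[(r - j)%N]muln1 -{1}E.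
apply/mnmP => i; rewrite mnm1E; have [<-|ji] := eqVneq j i; first by rewrite m1'.
move/eqP: rest0; rewrite sum_nat_eq0 => /forallP/(_ i); rewrite eq_sym ji /= muln_eq0 subn_eq0.
by rewrite leqNgt ltn_ord => /eqP.
Qed.

Section LeadingTerms.
Variables (F K : fieldType) (iota : {rmorphism F -> K}) (n m : nat).
Local Notation r := n.+2.
Variables (k : 'I_r) (G : 'I_m -> {mpoly F[r]}).
Hypothesis H3r : regular_seq_k k (fun i => wtpart (G i)).
Hypothesis H3j : jacobian_full iota k (fun i => wtpart (G i)) (zeroset iota (fun i => wtpart (G i))).

Lemma mwt_le_wt i mon : mon \in msupp (G i) -> (mwt mon <= wt (G i))%N.
Proof. by move=> mG; rewrite /wt; apply: leq_bigmax_seq. Qed.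

Lemma mcoeff_wtpart i mon : (wtpart (G i))@_mon = if mwt mon == wt (G i) then (G i)@_mon else 0.
Proof.
rewrite /wtpart raddf_sum /=.
under eq_bigr => mon' _ do rewrite mcoeffZ mcoeffX.
have [mG|mG] := boolP (mon \in msupp (G i)); last first.
  rewrite big_seq_cond big1 => [|mon' /andP[mG' _]].
    by rewrite (memN_msupp_eq0 mG) if_same.
  by rewrite (_ : mon' == mon = false) ?mulr0 //; apply: contraNF mG => /eqP <-.
have [E|E] := eqVneq (mwt mon) (wt (G i)).
  rewrite big_mkcond (bigD1_seq mon) ?msupp_uniq //= E !eqxx mulr1 big1 ?addr0 // => mon' /negbTE ->.
  by rewrite mulr0 if_same.
rewrite big1 // => mon' /eqP E'; rewrite (_ : mon' == mon = false) ?mulr0 //.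
by apply: contraNF E => /eqP <-; rewrite E'.
Qed.

Lemma in_ideal_k_mono i i' p : (i <= i')%N -> in_ideal_k k (fun i => wtpart (G i)) i p ->
  in_ideal_k k (fun i => wtpart (G i)) i' p.
Proof.
move=> ii' [g [gk ->]]; exists (fun j : 'I_m => if (j < i)%N then g j else 0); split.
  by move=> j; case: ifP => // _ mon; rewrite msupp0.
rewrite big_mkcond [RHS]big_mkcond; apply: eq_bigr => j _.
case: ltnP => ji; last by rewrite mul0r if_same.
by rewrite (leq_trans ji ii').
Qed.

Lemma indep_const c : indep_of k (c%:MP_[r] : {mpoly F[r]}).
Proof.
move=> mon; rewrite msuppC; case: eqP => // _; rewrite inE => /eqP ->; exact: mnm0E.
Qed.

(** In weight 0 the weighted part is a constant. If nonzero it generates the unit ideal; if zero,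
    regularity puts 1 in the ideal of its predecessors. *)
Lemma wt_gt0 i : (0 < wt (G i))%N.
Proof.
rewrite lt0n; apply/negP => /eqP w0; have [H1 H2] := H3r.
have GE : wtpart (G i) = ((wtpart (G i))@_0%MM)%:MP.
  apply/mpolyP => mon; rewrite mcoeffC; case: eqVneq => [<-|m0]; first by rewrite mulr1.
  by rewrite mulr0 mcoeff_wtpart w0; case: eqP => // /mwt_eq0 E; rewrite E eqxx in m0.
case: (eqVneq (wtpart (G i))@_0%MM 0) => c0.
  apply: H2; apply: (@in_ideal_k_mono i); first exact: ltnW.
  apply: (H1 i 1); first by rewrite -mpolyC1; apply: indep_const.
  exists (fun _ => 0); split=> [j mon|]; first by rewrite msupp0.
  by rewrite big1 => [|j _]; rewrite ?mul0r // mul1r GE c0 mpolyC0.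
apply: H2; exists (fun j => if j == i then ((wtpart (G i))@_0%MM)^-1%:MP else 0); split=> [j|].
  by case: eqP => _; [apply: indep_const|move=> mon; rewrite msupp0].
rewrite (bigD1 i) //= eqxx {2}GE -mpolyCM mulVf // big1 ?addr0 // => j /andP[_ /negbTE ->].
by rewrite mul0r.
Qed.

Let a0 : 'I_r -> K := fun _ => 0.

Lemma lead_row i j : (map_mpoly iota ((wtpart (G i))^`M(j))).@[a0] = iota ((wtpart (G i))@_(U_(j))).
Proof.
have -> : map_mpoly iota ((wtpart (G i))^`M(j)) = (map_mpoly iota (wtpart (G i)))^`M(j).
  by apply/mpolyP => mon; rewrite mcoeff_map_mpoly !mcoeff_mderiv raddfMn mcoeff_map_mpoly.
by rewrite mderiv_at0 // mcoeff_map_mpoly.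
Qed.

Lemma a0_zero : zeroset iota (fun i => wtpart (G i)) a0.
Proof.
move=> i; rewrite mevalE big_seq big1 // => mon mG.
have [j mj] : exists j, mon j != 0%N.
  apply: NNPP => H; have m0 : mon = 0%MM.
    by apply/mnmP => j; rewrite mnm0E; apply/eqP; apply: contra_notT H => mj; exists j.
  move: mG; rewrite mcoeff_msupp mcoeff_map_mpoly mcoeff_wtpart m0 mwt0 ltn_eqF ?wt_gt0 //=.
  by rewrite rmorph0 eqxx.
by rewrite (bigD1 j) //= expr0n (negbTE mj) mul0r mulr0.
Qed.

(** The Jacobian matrix of (H3) at the origin, where only linear terms contribute. *)
Definition lead_mx := \matrix_(i < m, j < r) (if j == k then 0 else iota ((wtpart (G i))@_(U_(j)))).

Lemma lead_mx_free (lam : 'I_m -> K) :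
  (forall j, \sum_i lam i * lead_mx i j = 0) -> forall i, lam i = 0.
Proof.
move=> H i; have := H3j a0_zero.
under eq_mx => i' j do rewrite lead_row.
move=> /eqP; rewrite -/(row_free _) => /row_free_inj/(_ (\row_i lam i) 0).
rewrite mul0mx => E.
have /E/rowP/(_ i) : (\row_i lam i) *m lead_mx = 0.
  by apply/rowP => j; rewrite !mxE -[RHS](H j); apply: eq_bigr => i' _; rewrite mxE.
by rewrite !mxE.
Qed.

Lemma lead_exists i : exists j : 'I_r, [/\ j != k, wt (G i) = (r - j)%N & (G i)@_(U_(j)) != 0].
Proof.
apply: NNPP => H.
have Z j : lead_mx i j = 0.
  rewrite mxE; case: eqVneq => // jk; rewrite mcoeff_wtpart; case: eqP => [E|]; last by rewrite rmorph0.
  apply/eqP; rewrite fmorph_eq0; apply: contra_notT H => Gj; exists j; split=> //.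
  by rewrite -E mwt_U.
have L j : \sum_i' (i' == i)%:R * lead_mx i' j = 0.
  by rewrite (bigD1 i) //= Z mulr0 big1 ?addr0 // => i' /negbTE ->; rewrite mul0r.
by have /(_ i)/eqP := lead_mx_free L; rewrite eqxx oner_eq0.
Qed.

Lemma lead_index : exists jj : 'I_m -> 'I_r, forall i,
  [/\ jj i != k, wt (G i) = (r - jj i)%N & (G i)@_(U_(jj i)) != 0].
Proof. by have [jj H] := fin_all_exists lead_exists; exists jj. Qed.
End LeadingTerms.

Lemma complement_enum (I : finType) m (jj : 'I_m -> I) : injective jj ->
  exists e : 'I_(#|I| - m) -> I, [/\ injective e,
    forall j, (exists i, j = jj i) \/ (exists l, j = e l) & forall i l, jj i != e l].
Proof.
move=> jji; pose A : {set I} := ~: (jj @: 'I_m).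
have cA : #|A| = (#|I| - m)%N by rewrite cardsCs setCK card_imset // card_ord.
exists (fun l => enum_val (cast_ord (esym cA) l)); split.
- by move=> l l' /enum_val_inj/cast_ord_inj.
- move=> j; have [jA|] := boolP (j \in A).
    right; exists (cast_ord cA (enum_rank_in jA j)).
    by rewrite cast_ordK enum_rankK_in.
  by rewrite inE negbK => /imsetP[i _ ->]; left; exists i.
- move=> i l; apply/eqP => E; have := enum_valP (cast_ord (esym cA) l).
  by rewrite -E inE imset_f.
Qed.

Section LeadingVariables.
Variables (F K : fieldType) (iota : {rmorphism F -> K}) (n m : nat).
Local Notation r := n.+2.
Variables (k : 'I_r) (G : 'I_m -> {mpoly F[r]}).
Hypothesis H3r : regular_seq_k k (fun i => wtpart (G i)).
Hypothesis H3j : jacobian_full iota k (fun i => wtpart (G i)) (zeroset iota (fun i => wtpart (G i))).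
Variable jj : 'I_m -> 'I_r.
Hypothesis jjP : forall i, [/\ jj i != k, wt (G i) = (r - jj i)%N & (G i)@_(U_(jj i)) != 0].

Definition Gk i : {mpoly K[r]} := map_mpoly iota (G i).

Lemma msupp_Gk i : msupp (Gk i) =i msupp (G i).
Proof. exact/perm_mem/msupp_map_mpoly/fmorph_inj. Qed.

(** The weights r - j are distinct, so each row of the Jacobian at the origin has one nonzero entry;
    two rows with that entry in the same column would be dependent. *)
Lemma jj_inj : injective jj.
Proof.
move=> i i' jE; apply/eqP; apply: contraT => ii'.
pose c i := iota ((wtpart (G i))@_(U_(jj i))).
have c0 i0 : c i0 != 0.
  by have [_ w c0] := jjP i0; rewrite /c fmorph_eq0 mcoeff_wtpart mwt_U w eqxx.
have Z i0 j : j != jj i0 -> lead_mx iota k G i0 j = 0.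
  move=> jj0; rewrite mxE; case: eqP => // _; have [_ w _] := jjP i0.
  rewrite mcoeff_wtpart mwt_U w; case: eqP => [E|]; last by rewrite rmorph0.
  case/eqP: jj0; apply/val_inj; move: E (ltn_ord j) (ltn_ord (jj i0)) => /=.
  by move: (nat_of_ord j) (nat_of_ord (jj i0)) => a b; lia.
have C i0 : lead_mx iota k G i0 (jj i0) = c i0.
  by have [jk _ _] := jjP i0; rewrite mxE (negbTE jk).
have L j : \sum_i0 (c i' *+ (i0 == i) - c i *+ (i0 == i')) * lead_mx iota k G i0 j = 0.
  rewrite (bigD1 i) //= (bigD1 i') /=; last by rewrite eq_sym.
  rewrite big1 ?addr0 => [|i0 /andP[/negbTE -> /negbTE ->]]; last by rewrite !mulr0n subr0 mul0r.
  rewrite !eqxx (negbTE ii') eq_sym (negbTE ii') !mulr0n !mulr1n subr0 sub0r.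
  have [->|ji] := eqVneq j (jj i); last by rewrite !Z ?mulr0 ?addr0 // -jE.
  by rewrite {2}jE !C mulNr mulrC subrr.
have /(_ i)/eqP := lead_mx_free H3r H3j L.
by rewrite eqxx (negbTE ii') mulr0n subr0 mulr1n (negbTE (c0 i')).
Qed.

Lemma Gk_triangular N (e : 'I_N -> 'I_r) : injective e ->
  (forall j, (exists i, j = jj i) \/ (exists l, j = e l)) -> (forall i l, jj i != e l) ->
  triangular Gk (fun i => wt (G i)) jj e.
Proof.
move=> ei ec ed; split=> //; last exact: jj_inj.
- by move=> i mon; rewrite msupp_Gk; apply: mwt_le_wt.
- by move=> i; have [] := jjP i.
- by move=> i; rewrite mcoeff_map_mpoly fmorph_eq0; have [] := jjP i.
- move=> i mon; rewrite msupp_Gk => /mwt_le_wt; have [_ -> _] := jjP i => wm mU j mj.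
  by rewrite ltnNge; apply: contra mU => ji; apply/eqP/(mwt_leU wm mj ji).
Qed.
End LeadingVariables.

Section TriangularIndependence.
Variables (K : fieldType) (n m N : nat).
Local Notation r := n.+2.
Variables (G : 'I_m -> {mpoly K[r]}) (w : 'I_m -> nat) (jj : 'I_m -> 'I_r) (e : 'I_N -> 'I_r).
Hypothesis tri : triangular G w jj e.

Lemma gam_indep kl : (forall i, indep_of (e kl) (G i)) ->
  forall b b' : 'I_N.+1 -> K, (forall i, i != lift ord0 kl -> b i = b' i) ->
  forall j, j != e kl -> gampt (gam G w jj e) b j = gampt (gam G w jj e) b' j.
Proof.
move=> Gk b b' bb' j; have [s] := ubnP (r - j); elim: s j => // s IH j /ltnSE js jk.
have [[i jE]|[l jE]] := tri_cover tri j; last first.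
  rewrite jE /gampt (gam_free tri) !mevalXU bb' // (inj_eq lift_inj).
  by apply: contraNneq jk => <-; rewrite jE.
rewrite jE !(meval_gam_dep tri); congr (_ * _); rewrite big_seq_cond [RHS]big_seq_cond.
apply: eq_bigr => mon /andP[mG mU]; congr (_ * (_ * _)).
  by rewrite bb' // neq_lift.
apply: eq_bigr => j' _; have [->|mj] := eqVneq (mon j') 0%N; first by rewrite !expr0.
rewrite IH //; last by apply: contraNneq mj => ->; rewrite (Gk i).
by apply: leq_trans js; rewrite jE ltn_sub2l //; apply: (tri_lower tri mG mU mj).
Qed.

Definition hom_at d (p : {mpoly K[r]}) : {mpoly K[r.+1]} :=
  \sum_(mon <- msupp p) p@_mon *:
    ('X_ord0 ^+ (d - mdeg mon) * msubst (fun i => 'X_(lift ord0 i)) 'X_[mon]).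

Lemma meval_hom_at d p x : (hom_at d p).@[x] =
  \sum_(mon <- msupp p) p@_mon * (x ord0 ^+ (d - mdeg mon) * \prod_j rpt x j ^+ mon j).
Proof.
rewrite raddf_sum; apply: eq_bigr => mon _; rewrite /= mevalZ mevalM rmorphXn /= mevalXU.
congr (_ * (_ * _)); rewrite meval_msubst mevalX; apply: eq_bigr => j _.
by rewrite mevalXU.
Qed.

Definition dehom : {mpoly K[r.+1]} -> {mpoly K[r]} := msubst (pt 1 (fun j => 'X_j)).

Lemma meval_dehom p y : (dehom p).@[y] = p.@[pt 1 y].
Proof.
rewrite meval_msubst; apply: meval_eq => i; rewrite /pt.
by case: unlift => [j|]; rewrite ?mevalXU ?meval1.
Qed.

Lemma msize_dehom d p : p \is d.-homog -> (msize (dehom p) <= d.+1)%N.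
Proof.
move=> ph; rewrite (mpolyE p) /dehom rmorph_sum big_seq; apply: (big_ind (fun q : {mpoly K[r]} => (msize q <= d.+1)%N)).
- by rewrite msize0.
- by move=> a b a1 b1; apply: leq_trans (msizeD_le _ _) _; rewrite geq_max a1.
move=> mon mp; rewrite /= msubstZ; apply: leq_trans (msizeZ_le _ _) _.
rewrite msubst_mon big_ord_recl /pt unlift_none expr1n mul1r.
under eq_bigr => j _ do rewrite liftK.
have E : mdeg mon = d := dhomog_mf ph mp.
rewrite -E [X in (_ <= X.+1)%N]mdegE [X in (_ <= X.+1)%N]big_ord_recl.
rewrite [X in msize X](_ : _ = 'X_[[multinom mon (lift ord0 j) | j < r]]); last first.
  by rewrite [RHS]mpolyXE_id; apply: eq_bigr => j _; rewrite mnmE.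
rewrite msizeX ltnS mdegE; under eq_bigr => j _ do rewrite mnmE.
exact: leq_addl.
Qed.

Lemma homog_hom_at (Kclosed : alg_closed K) d p : p \is d.-homog -> p = hom_at d (dehom p).
Proof.
move=> ph; apply/eqP; rewrite -subr_eq0; apply/eqP.
suff /eqP : 'X_ord0 * (p - hom_at d (dehom p)) = 0.
  by have [X0 _ _] := mpolyX_prime (n := r) K ord0; rewrite mulf_eq0 (negbTE X0) => /eqP.
apply: (mpoly_eval_eq0 Kclosed) => x; rewrite mevalM mevalXU mevalB.
have [->|x0] := eqVneq (x ord0) 0; first by rewrite mul0r.
have -> : p.@[x] = x ord0 ^+ d * (dehom p).@[fun j => (x ord0)^-1 * rpt x j].
  rewrite meval_dehom -meval_scale //; apply: meval_eq => i; rewrite /pt.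
  by case: (unliftP ord0 i) => [j ->|->]; rewrite ?mulr1 // mulrA mulfV ?mul1r.
rewrite meval_hom_at mevalE mulr_sumr big_seq [X in _ - X]big_seq.
rewrite [X in X - _](_ : _ = \sum_(mon <- msupp (dehom p) | mon \in msupp (dehom p)) (dehom p)@_mon *
   (x ord0 ^+ (d - mdeg mon) * \prod_j rpt x j ^+ mon j)) ?subrr ?mulr0 //.
apply: eq_bigr => mon mp; rewrite mulrCA; congr (_ * _).
under eq_bigr => j _ do rewrite exprMn.
rewrite big_split /= -expr_sum -mdegE mulrA exprVn; congr (_ * _).
have md : (mdeg mon <= d)%N by rewrite -ltnS; apply: leq_trans (msize_mdeg_lt mp) (msize_dehom ph).
by rewrite -{1}(subnK md) exprD mulfK // expf_neq0.
Qed.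

Hypothesis w_gt0 : forall i, (0 < w i)%N.

Lemma Gh_nonzero_at_infinity i : exists a, (Gh G w i).@[pt 0 a] != 0.
Proof.
exists (fun j => (j == jj i)%:R); rewrite meval_Gh (bigD1_seq _ (U_supp tri i)) ?msupp_uniq //=.
rewrite mwt_U (tri_lead tri) subnn expr0 mul1r (bigD1 (jj i)) //= mnm1E !eqxx expr1 mul1r.
rewrite big1 => [|j ji]; last by rewrite mnm1E [jj i == j]eq_sym (negbTE ji) expr0.
rewrite mulr1 [X in _ + X](_ : _ = 0) ?addr0 ?(tri_coef tri) //.
rewrite big_seq_cond big1 // => mon /andP[mG mU].
have [mon0|[j mj]] : mon = 0%MM \/ exists j, mon j != 0%N.
- case: (classic (exists j, mon j != 0%N)) => [|H]; [by right|left].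
  by apply/mnmP => j; rewrite mnm0E; apply/eqP; apply: contra_notT H => mj; exists j.
- by rewrite mon0 mwt0 subn0 -(tri_lead tri) expr0n eqn0Ngt w_gt0 mul0r mulr0.
have := tri_lower tri mG mU mj; rewrite (bigD1 j) //= => jl.
have -> : (j == jj i) = false by rewrite -val_eqE /= gtn_eqF.
by rewrite [_ ^+ mon j]expr0n (negbTE mj) mul0r !mulr0.
Qed.

(** If the degree dropped, the homogeneous [Rh i] would vanish wherever X_0 = 0. It does not,
    because at the unit vector of a_(jj i) only the linear term of [Gh i] survives. *)
Lemma msize_dehom_Rh (Kclosed : alg_closed K) i : msize (dehom (Rh G w i)) = (w i).+1.
Proof.
have Rhom := Rh_homog tri i; apply/eqP; rewrite eqn_leq msize_dehom //= ltnNge; apply/negP => le.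
have [a] := Gh_nonzero_at_infinity i; have [x <- x0] := coef_at_onto Kclosed a 0.
rewrite -{1}x0 -meval_Rh (homog_hom_at Kclosed Rhom) meval_hom_at big_seq big1 ?eqxx // => mon mp.
rewrite x0 expr0n subn_eq0 leqNgt (leq_trans (msize_mdeg_lt mp) le) /= mul0r mulr0 //.
Qed.
End TriangularIndependence.

(** * Hilbert function *)

Lemma hilb_basis (K : fieldType) n (S : pset ('I_n -> K)) t (J : finType) (B : J -> {mpoly K[n]}) :
  (forall j, B j \is t.-homog) ->
  (forall c : J -> K, vanish S (\sum_j c j *: B j) -> forall j, c j = 0) ->
  (forall p, p \is t.-homog -> exists c : J -> K, vanish S (p - \sum_j c j *: B j)) ->
  hilb S t #|J|.
Proof.
move=> Bh Bi Bs; split.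
  exists (fun i => B (enum_val i)); split=> [i|c cS i]; first exact: Bh.
  rewrite -(enum_valK i); apply: (Bi (fun j => c (enum_rank j))).
  rewrite (_ : \sum_j _ = \sum_(i < #|J|) c i *: B (enum_val i)) //.
  rewrite (reindex (@enum_val J J)) /=; last exact: (onW_bij _ (enum_val_bij J)).
  by apply: eq_bigr => i' _; rewrite enum_valK.
case=> f [fh fi].
have [a aE] := fin_all_exists (fun i => Bs (f i) (fh i)).
have cJ : (#|J| < #|'I_#|J|.+1|)%N by rewrite card_ord.
have [v [[i vi] vE]] := linear_dependence a cJ.
case/eqP: vi; apply: fi => x Sx; rewrite raddf_sum /=.
have fE i' : (f i').@[x] = \sum_j a i' j * (B j).@[x].
  have /eqP := aE i' x Sx; rewrite mevalB subr_eq0 => /eqP ->; rewrite raddf_sum.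
  by apply: eq_bigr => j _; rewrite /= mevalZ.
under eq_bigr => i' _ do rewrite mevalZ fE mulr_sumr.
rewrite exchange_big big1 // => j _ /=.
under eq_bigr => i' _ do rewrite mulrA.
by rewrite -mulr_suml vE mul0r.
Qed.

Section HilbertFunction.
Variables (K : fieldType) (n N : nat) (e : 'I_N -> 'I_n.+2) (gam : 'I_n.+2 -> {mpoly K[N.+1]}).
Local Notation r := n.+2.
Hypothesis Kclosed : alg_closed K.
Hypothesis ok : cone_ok e gam.
Local Notation cone := (cone e gam).
Local Notation psi := (psi K e).
Hypothesis Disc0 : DiscB gam != 0.

Definition bmon (a : {ffun 'I_r -> 'I_r}) (u : 'X_{1..N.+1}) : {mpoly K[r.+1]} :=
  msubst psi 'X_[u] * artin_mon (@rootX K r) a.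

Definition bdeg (a : {ffun 'I_r -> 'I_r}) (u : 'X_{1..N.+1}) : nat :=
  (\sum_i base_weight (n := n) e i * u i + \sum_i a i)%N.

Lemma bmon_homog a u : bmon a u \is (bdeg a u).-homog.
Proof.
have pw (I : finType) (F : I -> {mpoly K[r.+1]}) (d k : I -> nat) :
    (forall i, F i \is (d i).-homog) -> \prod_i F i ^+ k i \is (\sum_i d i * k i)%N.-homog.
  move=> H; apply: (big_rec2 (fun d (p : {mpoly K[r.+1]}) => p \is d.-homog)) => [|i s p _ IH].
    exact: dhomog1.
  by apply: dhomogM IH; apply: dhomogMn.
apply: dhomogM.
  rewrite msubst_mon; apply: pw => i; rewrite /psi /base_weight.
  by case: unlift => [l|]; [exact: coefA_homog|rewrite dhomogX /= mdeg1].
rewrite /artin_mon (_ : (\sum_i a i = \sum_i 1 * a i)%N).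
  by apply: pw => i; rewrite /rootX dhomogX /= mdeg1.
by apply: eq_bigr => i _; rewrite mul1n.
Qed.

Lemma meval_bmon a u x : (bmon a u).@[x] = 'X_[u].@[psipt e x] * artin_mon (rpt x) a.
Proof. by rewrite mevalM -meval_mpt meval_artin_mon1. Qed.

Variables (t : nat) (J : finType) (al : J -> {ffun 'I_r -> 'I_r}) (mo : J -> 'X_{1..N.+1}).
Hypothesis al_artin : forall j, artin (al j).
Hypothesis al_deg : forall j, bdeg (al j) (mo j) = t.
Hypothesis almo_inj : forall j j', al j = al j' -> mo j = mo j' -> j = j'.
Hypothesis almo_onto : forall a u, artin a -> bdeg a u = t -> exists j, al j = a /\ mo j = u.

Let sum_by_al (c : J -> K) x :
  \sum_(a | artin a) (\sum_(j | al j == a) c j *: 'X_[mo j]).@[psipt e x] * artin_mon (rpt x) a =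
  \sum_j c j * (bmon (al j) (mo j)).@[x].
Proof.
rewrite [RHS](partition_big al (@artin r)) //=; apply: eq_bigr => a _.
rewrite raddf_sum mulr_suml; apply: eq_bigr => j /eqP <- /=.
by rewrite mevalZ meval_bmon mulrA.
Qed.

Lemma hilb_pcone : hilb (pcone e gam) t #|J|.
Proof.
apply: (hilb_basis (B := fun j => bmon (al j) (mo j))) => [j|c /(pcone_vanish Kclosed ok) cS j|p ph].
- by rewrite -(al_deg j); apply: bmon_homog.
- have H x : cone x -> \sum_(a | artin a) (\sum_(j | al j == a) c j *: 'X_[mo j]).@[psipt e x] *
      artin_mon (rpt x) a = 0.
    move=> /cS cx; rewrite sum_by_al -[RHS]cx raddf_sum; apply: eq_bigr => j' _ /=.
    by rewrite mevalZ.
  have := cone_independent Kclosed ok Disc0 H (al_artin j) => /(congr1 (mcoeff (mo j))).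
  rewrite mcoeff0 raddf_sum (bigD1 j) //= mcoeffZ mcoeffX eqxx mulr1 big1 ?addr0 //.
  move=> j' /andP[/eqP aE j'j]; rewrite mcoeffZ mcoeffX; case: eqP => [mE|]; last by rewrite mulr0.
  by rewrite (almo_inj aE mE) eqxx in j'j.
have [c cE] := cone_spanning_pt e gam Kclosed p.
exists (fun j => (c (al j))@_(mo j)); apply/(pcone_vanish Kclosed ok) => x cx.
rewrite mevalB; apply/eqP; rewrite subr_eq0 raddf_sum /=.
under [X in _ == X]eq_bigr => j _ do rewrite mevalZ.
have pE : p.@[x] = \sum_(a | artin a) \sum_(u <- msupp (c a) | bdeg a u == t) (c a)@_u * (bmon a u).@[x].
  (* Evaluating the expansion along the line s x separates its terms by degree; since [p] is
     homogeneous, only those of degree [t] count. *)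
  pose P : {poly K} := \sum_(a | artin a) \sum_(u <- msupp (c a)) ((c a)@_u * (bmon a u).@[x]) *: 'X^(bdeg a u).
  have PE : P = p.@[x] *: 'X^t.
    apply/eqP; rewrite -subr_eq0; apply/eqP; apply: (poly_eval_eq0 Kclosed) => s.
    rewrite hornerD hornerN hornerZ hornerXn mulrC -(meval_scale x s ph) (cE _ (cone_scale ok s cx)).
    apply/eqP; rewrite subr_eq0 horner_sum; apply/eqP; apply: eq_bigr => a aa.
    rewrite (mpolyE (c a)) raddf_sum mulr_suml horner_sum -mpolyE; apply: eq_bigr => u _ /=.
    rewrite hornerZ hornerXn mevalZ -mulrA -[RHS]mulrA -meval_bmon.
    by rewrite (meval_scale x s (bmon_homog a u)) [_ * s ^+ _]mulrC.
  have := congr1 (fun q : {poly K} => q`_t) PE; rewrite coefZ coefXn eqxx mulr1 => <-.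
  rewrite coef_sum; apply: eq_bigr => a _; rewrite coef_sum [RHS]big_mkcond; apply: eq_bigr => u _.
  by rewrite coefZ coefXn eq_sym; case: eqP; rewrite ?mulr1 ?mulr0.
rewrite pE (partition_big al (@artin r)) //=; apply/eqP/eq_bigr => a aa.
pose F u := (c a)@_u * (bmon a u).@[x].
rewrite [RHS](_ : _ = \sum_(u <- [seq mo j | j <- enum [pred j | al j == a]]) F u); last first.
  by rewrite big_map big_enum; apply: eq_bigr => j /eqP ->.
rewrite [RHS](bigID (fun u => u \in msupp (c a))) /= [X in _ + X]big1 ?addr0 => [|u um]; last first.
  by rewrite /F memN_msupp_eq0 ?mul0r.
rewrite -big_filter -[RHS]big_filter; apply: perm_big; apply: uniq_perm.
- by rewrite filter_uniq ?msupp_uniq.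
- rewrite filter_uniq // map_inj_in_uniq ?enum_uniq // => j j'.
  by rewrite !mem_enum !inE => /eqP aj /eqP aj'; apply: almo_inj; rewrite aj.
move=> u; rewrite !mem_filter andbC; have [um|] //= := boolP (u \in msupp (c a)).
apply/eqP/mapP => [/(almo_onto aa)[j [aj mj]]|[j]].
  by exists j => //; rewrite mem_enum inE aj.
by rewrite mem_enum inE => /eqP <- ->.
Qed.
End HilbertFunction.

(** The polynomial t |-> C(N + t - s, N), that is, the Hilbert polynomial of projective N-space
    shifted by s. *)
Definition binpoly (N s : nat) : {poly rat} :=
  (N`!%:R)^-1 *: \prod_(i < N) ('X - (s%:R - i.+1%:R)%:P).

Lemma binpoly_eval N s t : (s <= t)%N -> (binpoly N s).[t%:R] = 'C(N + (t - s), N)%:R.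
Proof.
move=> st; have F : \prod_(i < N) (t%:R - (s%:R - i.+1%:R)) * (t - s)`!%:R = ((N + (t - s))`!)%:R :> rat.
  elim: N => [|N IH]; first by rewrite big_ord0 mul1r.
  rewrite big_ord_recr /= mulrAC IH addSn factS natrM mulrC; congr (_ * _).
  by rewrite opprB addrCA -natrB // -natrD addSn.
have f0 a : a`!%:R != 0 :> rat by rewrite pnatr_eq0 -lt0n fact_gt0.
rewrite /binpoly hornerZ horner_prod; apply: (mulfI (f0 N)); apply: (mulIf (f0 (t - s)%N)).
rewrite mulrA mulfV // mul1r.
under eq_bigr => i _ do rewrite hornerXsubC.
rewrite F -!natrM; congr _%:R.
by rewrite -(bin_fact (leq_addr (t - s) N)) addKn mulnA (mulnC (factorial N)).
Qed.

Lemma size_binpoly N s : (size (binpoly N s) <= N.+1)%N.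
Proof.
apply: leq_trans (size_scale_leq _ _) _.
by rewrite size_prod_XsubC /index_enum -enumT size_enum_ord.
Qed.

Lemma binpoly_lead N s : (binpoly N s)`_N = (N`!%:R)^-1.
Proof.
rewrite coefZ; have /monicP : \prod_(i < N) ('X - (s%:R - i.+1%:R)%:P : {poly rat}) \is monic.
  by apply: rpred_prod => i _; apply: monicXsubC.
by rewrite lead_coefE size_prod_XsubC /index_enum -enumT size_enum_ord => ->; rewrite mulr1.
Qed.

Section Degree.
Variables (K : fieldType) (n m N : nat).
Local Notation r := n.+2.
Variables (G : 'I_m -> {mpoly K[r]}) (w : 'I_m -> nat) (jj : 'I_m -> 'I_r) (e : 'I_N -> 'I_r).
Hypothesis tri : triangular G w jj e.

Lemma sum_split_coords (f : 'I_r -> nat) :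
  (\sum_j f j = \sum_i f (jj i) + \sum_l f (e l))%N.
Proof.
have D : [disjoint jj @: 'I_m & e @: 'I_N].
  apply/pred0P => j /=; apply/negP => /andP[/imsetP[i _ ->] /imsetP[l _ E]].
  by have := tri_disj tri i l; rewrite E eqxx.
rewrite -(big_imset f (h := jj)) /=; last by move=> i i' _ _; apply: (tri_inj tri).
rewrite -(big_imset f (h := e)) /=; last by move=> l l' _ _; apply: (tri_e_inj tri).
rewrite -bigU //=; apply: eq_bigl => j; rewrite inE; apply/esym.
by have [[i ->]|[l ->]] := tri_cover tri j; rewrite imset_f // orbT.
Qed.

Implicit Types (g : 'I_m -> nat) (nu : 'I_N.+1 -> nat).

(** Euclidean division by r - e_l splits nu_l into an Artin exponent at e_l and an exponent of y_l,
    which has weight r - e_l. Thus the weighted count of basis elements becomes a count of ordinary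
    monomials in N + 1 variables, one copy for each choice of exponents g_i < w_i at the leading
    variables. *)
Let aval g nu (j : 'I_r) : nat :=
  if [pick i | jj i == j] is Some i then g i
  else if [pick l | e l == j] is Some l then nu (lift ord0 l) %% (r - e l) else 0.

Definition dec_alpha g nu : {ffun 'I_r -> 'I_r} := [ffun j => inord (aval g nu j)].

Definition dec_beta nu : 'X_{1..N.+1} :=
  [multinom (if unlift ord0 i is Some l then nu (lift ord0 l) %/ (r - e l) else nu ord0)%N | i < N.+1].

Lemma rsub_gt0 (j : 'I_r) : (0 < r - j)%N. Proof. by rewrite subn_gt0. Qed.

Lemma dec_alpha_jj g nu i : (g i < w i)%N -> dec_alpha g nu (jj i) = g i :> nat.
Proof.
rewrite (tri_lead tri) => gi; rewrite ffunE /aval (pick_jj tri) inordK //.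
exact: leq_trans gi (leq_subr _ _).
Qed.

Lemma dec_alpha_e g nu l : dec_alpha g nu (e l) = (nu (lift ord0 l) %% (r - e l))%N :> nat.
Proof.
have E : [pick l' | e l' == e l] = Some l.
  by case: pickP => [l' /eqP/(tri_e_inj tri) -> //|/(_ l)]; rewrite eqxx.
rewrite ffunE /aval (pick_jj_e tri) E inordK //.
exact: leq_trans (ltn_pmod _ (rsub_gt0 _)) (leq_subr _ _).
Qed.

Lemma dec_beta0 nu : dec_beta nu ord0 = nu ord0.
Proof. by rewrite mnmE unlift_none. Qed.

Lemma dec_betaS nu l : dec_beta nu (lift ord0 l) = (nu (lift ord0 l) %/ (r - e l))%N.
Proof. by rewrite mnmE liftK. Qed.

Lemma dec_artin g nu : (forall i, g i < w i)%N -> artin (dec_alpha g nu).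
Proof.
move=> gw; apply/forallP => j; rewrite addnC -ltn_subRL.
have [[i ->]|[l ->]] := tri_cover tri j; first by rewrite dec_alpha_jj // -(tri_lead tri).
by rewrite dec_alpha_e ltn_pmod // rsub_gt0.
Qed.

Lemma dec_deg g nu : (forall i, g i < w i)%N ->
  bdeg e (dec_alpha g nu) (dec_beta nu) = (\sum_i g i + \sum_i nu i)%N.
Proof.
move=> gw; rewrite /bdeg.
have -> : (\sum_i base_weight (n := n) e i * dec_beta nu i =
    nu ord0 + \sum_l (r - e l) * (nu (lift ord0 l) %/ (r - e l)))%N.
  rewrite big_ord_recl {1}/base_weight unlift_none mul1n dec_beta0; congr addn.
  by apply: eq_bigr => l _; rewrite /base_weight liftK dec_betaS.
have -> : (\sum_j dec_alpha g nu j = \sum_i g i + \sum_l nu (lift ord0 l) %% (r - e l))%N.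
  rewrite sum_split_coords; congr addn; apply: eq_bigr => i _; first exact: dec_alpha_jj.
  exact: dec_alpha_e.
have -> : (\sum_i nu i = nu ord0 + (\sum_l (r - e l) * (nu (lift ord0 l) %/ (r - e l)) +
    \sum_l nu (lift ord0 l) %% (r - e l)))%N.
  rewrite big_ord_recl; congr addn; rewrite -big_split; apply: eq_bigr => l _.
  by rewrite /= mulnC -divn_eq.
lia.
Qed.

Lemma dec_inj g nu g' nu' : (forall i, g i < w i)%N -> (forall i, g' i < w i)%N ->
  dec_alpha g nu = dec_alpha g' nu' -> dec_beta nu = dec_beta nu' ->
  g =1 g' /\ nu =1 nu'.
Proof.
move=> gw gw' aE bE; split=> [i|i].
  by rewrite -(dec_alpha_jj nu (gw i)) aE dec_alpha_jj.
case: (unliftP ord0 i) => [l ->|->]; last by rewrite -(dec_beta0 nu) -(dec_beta0 nu') bE.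
rewrite (divn_eq (nu _) (r - e l)) (divn_eq (nu' _) (r - e l)).
by rewrite -(dec_betaS nu) -(dec_betaS nu') bE -(dec_alpha_e g) aE dec_alpha_e.
Qed.

Lemma dec_onto a u : artin a -> exists g nu,
  [/\ forall i, (g i < w i)%N, dec_alpha g nu = a & dec_beta nu = u].
Proof.
move=> /forallP aa; have al j : (a j < r - j)%N by rewrite ltn_subRL addnC.
pose nu (i : 'I_N.+1) := if unlift ord0 i is Some l then (u i * (r - e l) + a (e l))%N else u ord0.
exists (fun i => val (a (jj i))), nu; split=> [i||].
- by rewrite (tri_lead tri); apply: al.
- apply/ffunP => j; apply: val_inj; have [[i ->]|[l ->]] := tri_cover tri j.
    by rewrite /= dec_alpha_jj // (tri_lead tri); apply: al.
  by rewrite /= dec_alpha_e /nu liftK modnMDl modn_small //; apply: al.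
apply/mnmP => i; case: (unliftP ord0 i) => [l ->|->]; last by rewrite dec_beta0 /nu unlift_none.
by rewrite dec_betaS /nu liftK divnMDl ?rsub_gt0 // divn_small ?addn0 //; apply: al.
Qed.

Definition Gam := {dffun forall i : 'I_m, 'I_(w i)}.
Definition gsum (g : Gam) : nat := (\sum_i g i)%N.
Definition Jpart (t : nat) (g : Gam) :=
  {u : N.+1.-tuple 'I_(t - gsum g).+1 | u \in [set u : N.+1.-tuple 'I_(t - gsum g).+1 | (\sum_(i <- u) i == t - gsum g)%N]}.
Definition Jidx (t : nat) := {g : Gam & Jpart t g}.

Lemma card_Jidx t : #|{: Jidx t}| = (\sum_(g : Gam) 'C(N + (t - gsum g), N))%N.
Proof.
rewrite card_tagged sumnE big_map big_enum; apply: eq_bigr => g _.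
by rewrite card_sig -card_ord_partitions; apply: eq_card => u; rewrite !inE.
Qed.

Lemma card_Gam : #|{: Gam}| = (\prod_i w i)%N.
Proof.
rewrite card_dep_ffun foldrE big_map big_enum; apply: eq_bigr => i _.
by rewrite card_ord.
Qed.

Lemma gsum_le (g : Gam) : (gsum g <= \sum_i w i)%N.
Proof. by apply: leq_sum => i _; apply: ltnW. Qed.

Hypothesis Kclosed : alg_closed K.
Hypothesis Disc0 : DiscB (gam G w jj e) != 0.

Lemma hilb_count t : (\sum_i w i <= t)%N ->
  hilb (pcone e (gam G w jj e)) t (\sum_(g : Gam) 'C(N + (t - gsum g), N)).
Proof.
move=> wt; rewrite -card_Jidx.
pose gof (j : Jidx t) (i : 'I_m) := nat_of_ord (tag j i).
pose nuof (j : Jidx t) (i : 'I_N.+1) := nat_of_ord (tnth (val (tagged j)) i).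
have gw j i : (gof j i < w i)%N by apply: ltn_ord.
have nusum j : (\sum_i nuof j i = t - gsum (tag j))%N.
  have := valP (tagged j); rewrite inE => /eqP <-.
  by rewrite big_tuple.
apply: (hilb_pcone Kclosed (triangular_cone_ok tri) Disc0
  (al := fun j => dec_alpha (gof j) (nuof j)) (mo := fun j => dec_beta (nuof j))) => [j|j|j j'|a u aa ad].
- exact: dec_artin.
- by rewrite dec_deg // nusum subnKC //; apply: leq_trans (gsum_le _) wt.
- move=> aE bE; have [gE nE] := dec_inj (gw j) (gw j') aE bE.
  case: j j' {aE bE} gE nE => [g x] [g' x'] gE nE.
  have E : g = g' by apply/ffunP => i; apply: val_inj; apply: gE.
  subst g'; congr Tagged; apply: val_inj; apply: eq_from_tnth => i; apply: val_inj; exact: nE.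
have [g [nu [gl aE uE]]] := dec_onto u aa.
pose g0 : Gam := [ffun i => Ordinal (gl i)].
have g0E i : g0 i = g i :> nat by rewrite ffunE.
have g0sum : gsum g0 = (\sum_i g i)%N by apply: eq_bigr => i _; apply: g0E.
have nu_sum : (\sum_i nu i = t - gsum g0)%N by rewrite -ad -aE -uE dec_deg // g0sum addKn.
have nu_lt i : (nu i < (t - gsum g0).+1)%N by rewrite ltnS -nu_sum (bigD1 i) //= leq_addr.
pose x := [tuple Ordinal (nu_lt i) | i < N.+1].
have xP : x \in [set u : N.+1.-tuple 'I_(t - gsum g0).+1 | (\sum_(i <- u) i == t - gsum g0)%N].
  rewrite inE big_tuple; apply/eqP; rewrite -[RHS]nu_sum; apply: eq_bigr => i _.
  by rewrite tnth_mktuple.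
exists (Tagged (Jpart t) (exist _ x xP : Jpart t g0)).
have -> : gof (Tagged (Jpart t) (exist _ x xP : Jpart t g0)) = g.
  by apply: functional_extensionality => i; rewrite /gof /= g0E.
have -> : nuof (Tagged (Jpart t) (exist _ x xP : Jpart t g0)) = nu.
  by apply: functional_extensionality => i; rewrite /nuof /= tnth_mktuple.
by [].
Qed.

(** The Hilbert polynomial is a sum of prod w_i shifted binomials, each with leading coefficient 1 /
    N!. *)
Lemma pcone_pdegree : pdegree (pcone e (gam G w jj e)) N (\prod_i w i).
Proof.
pose P : {poly rat} := \sum_(g : Gam) binpoly N (gsum g).
have PN : P`_N = (\prod_i w i)%:R / (N`!)%:R.
  rewrite coef_sum (eq_bigr _ (fun c _ => binpoly_lead N (gsum c))) sumr_const -card_Gam.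
  by rewrite mulr_natl.
have w0 : (0 < \prod_i w i)%N.
  by rewrite prodn_gt0 // => i; rewrite (tri_lead tri) rsub_gt0.
have sP : size P = N.+1.
  apply/eqP; rewrite eqn_leq; apply/andP; split.
    by apply: leq_trans (size_sum _ _ _) _; apply/bigmax_leqP => g _; apply: size_binpoly.
  rewrite ltnNge; apply/negP => /leq_sizeP/(_ N (leqnn N))/eqP.
  by rewrite PN mulf_eq0 invr_eq0 !pnatr_eq0 (gtn_eqF w0) (gtn_eqF (fact_gt0 N)).
exists P; split=> //; first by rewrite lead_coefE sP PN.
exists (\sum_i w i)%N => t wt; eexists; split; first exact: hilb_count.
rewrite horner_sum natr_sum; apply: eq_bigr => g _.
by rewrite binpoly_eval //; apply: leq_trans (gsum_le _) wt.
Qed.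
End Degree.

(** * Projective closure *)

Lemma pset_ext (T : Type) (A B : pset T) : (forall x, A x <-> B x) -> A = B.
Proof. by move=> H; apply: functional_extensionality => x; apply: boolp.propext. Qed.

Section BaseChange.
Variables (F K : fieldType) (iota : {rmorphism F -> K}) (n m : nat).
Local Notation r := n.+2.

Lemma map_homogenize (p : {mpoly F[r]}) :
  map_mpoly iota (homogenize p) = hom_at (msize p).-1 (map_mpoly iota p).
Proof.
rewrite /homogenize /hom_at (perm_big _ (msupp_map_mpoly p (fmorph_inj iota))) raddf_sum.
apply: eq_bigr => mon _ /=; rewrite map_mpolyZ mcoeff_map_mpoly rmorphM rmorphXn /= map_mpolyX.
congr (_ *: (_ * _)); rewrite comp_mpolyX msubst_mon rmorph_prod; apply: eq_bigr => j _.
by rewrite rmorphXn /= tnth_mktuple map_mpolyX.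
Qed.

Lemma msize_map_mpoly (p : {mpoly F[r]}) : msize (map_mpoly iota p) = msize p.
Proof. by rewrite !mmeasureE (perm_big _ (msupp_map_mpoly p (fmorph_inj iota))). Qed.

Lemma map_mesym k : map_mpoly iota (mesym r F k) = mesym r K k.
Proof. by rewrite !mesymE raddf_sum; apply: eq_bigr => h _; rewrite /= map_mpolyX. Qed.

Variable G : 'I_m -> {mpoly F[r]}.
Local Notation w := (fun i => wt (G i)).
Local Notation Gk := (Gk iota G).

Lemma meval_wtpart i a (H : forall mon, mon \in msupp (G i) -> (mwt mon <= wt (G i))%N) :
  (map_mpoly iota (wtpart (G i))).@[a] = (Gh Gk w i).@[pt 0 a].
Proof.
rewrite meval_Gh (perm_big _ (msupp_map_mpoly (G i) (fmorph_inj iota))).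
have -> : map_mpoly iota (wtpart (G i)) = \sum_(mon <- msupp (G i) | mwt mon == wt (G i))
    iota (G i)@_mon *: 'X_[mon].
  by rewrite /wtpart (raddf_sum (map_mpoly iota)); apply: eq_bigr => mon _; rewrite /= map_mpolyZ map_mpolyX.
rewrite (raddf_sum (meval a)).
rewrite [LHS]big_mkcond [LHS]big_seq [RHS]big_seq; apply: eq_bigr => mon /H; rewrite leq_eqVlt.
case/orP => [/eqP ->|lt].
  by rewrite eqxx subnn expr0 mul1r /= mevalZ mevalX mcoeff_map_mpoly.
by rewrite ltn_eqF // expr0n subn_eq0 leqNgt lt mul0r mulr0.
Qed.

Hypothesis Kclosed : alg_closed K.

Lemma map_symlift i : map_mpoly iota (symlift (G i)) = dehom (Rh Gk w i).
Proof.
apply: (mpoly_eval_inj Kclosed) => y; rewrite meval_dehom meval_Rh.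
have -> : pt 1 y ord0 = 1 by rewrite /pt unlift_none.
rewrite meval_Gh1 /symlift map_mpoly_comp ?comp_mpoly_meval; last exact: fmorph_inj.
apply: meval_eq => j; rewrite tnth_map tnth_mktuple map_mpolyZ mevalZ map_mesym coef_at_mesym.
rewrite rmorphXn /= rmorphN1; congr (_ * _); apply: meval_eq => i'.
by rewrite /rpt /pt liftK.
Qed.
End BaseChange.

Section ProjectiveClosure.
Variables (F K : fieldType) (iota : {rmorphism F -> K}) (n m N : nat).
Local Notation r := n.+2.
Variables (G : 'I_m -> {mpoly F[r]}) (jj : 'I_m -> 'I_r) (e : 'I_N -> 'I_r).
Local Notation w := (fun i => wt (G i)).
Local Notation Gk := (Gk iota G).
Local Notation gam := (gam Gk w jj e).
Hypothesis Kclosed : alg_closed K.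
Hypothesis tri : triangular Gk w jj e.
Hypothesis w_gt0 : forall i, (0 < wt (G i))%N.

Lemma msize_symlift i : msize (symlift (G i)) = (wt (G i)).+1.
Proof. by rewrite -(msize_map_mpoly iota) map_symlift // (msize_dehom_Rh tri). Qed.

Lemma homogenize_symlift i : map_mpoly iota (homogenize (symlift (G i))) = Rh Gk w i.
Proof.
rewrite map_homogenize msize_symlift map_symlift //=.
by rewrite -(homog_hom_at Kclosed (Rh_homog tri i)).
Qed.

Lemma zeroset_symlift x : zeroset iota (fun i => symlift (G i)) x <-> cone e gam (pt 1 x).
Proof.
rewrite /zeroset; split=> [H|cx i].
  by apply: (Rh_cone tri) => i; rewrite -meval_dehom -map_symlift.
by rewrite map_symlift // meval_dehom (Rh_vanish tri).
Qed.

Lemma zeroset_fibre1 : zeroset iota G = fibre e gam 1.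
Proof.
apply: pset_ext => a; rewrite /fibre -(Gh_zeroE tri Kclosed).
by split=> H i; have := H i; rewrite meval_Gh1.
Qed.

Lemma zeroset_fibre0 : zeroset iota (fun i => wtpart (G i)) = fibre e gam 0.
Proof.
apply: pset_ext => a; rewrite /fibre -(Gh_zeroE tri Kclosed).
by split=> H i; have := H i; rewrite meval_wtpart //; apply: mwt_le_wt.
Qed.

Hypothesis Disc0 : DiscB gam != 0.
Hypothesis sqf : forall p, prime_elt p -> ~ divides (p ^+ 2) (DiscB gam).

(** A homogeneous [p] vanishing on the affine part makes X_0 p vanish on the cone; the cone is
    irreducible and not contained in X_0 = 0, so [p] vanishes on all of it, including the points at
    infinity. *)
Lemma pcl_symlift : pcl (zeroset iota (fun i => symlift (G i))) = pcone e gam.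
Proof.
have ok := triangular_cone_ok tri.
apply: pset_ext => y; split=> [[y0 H]|[y0 cy]]; split=> //.
  apply: (Rh_cone tri) => i; apply: H; first by exists (wt (G i)); apply: (Rh_homog tri).
  by move=> x /zeroset_symlift; apply: (Rh_vanish tri).
move=> p [d ph] Hp; suff pv : vanish (cone e gam) p by apply: pv.
have : vanish (cone e gam) ('X_ord0 * p).
  move=> x cx; rewrite mevalM mevalXU; have [->|x0] := eqVneq (x ord0) 0; first by rewrite mul0r.
  pose z j := (x ord0)^-1 * rpt x j.
  have zE : pt 1 z = fun i => (x ord0)^-1 * x i.
    apply: functional_extensionality => i; rewrite /pt.
    by case: (unliftP ord0 i) => [j ->|->]; rewrite ?mulVf.
  have xE : x = fun i => x ord0 * pt 1 z i.
    by rewrite zE; apply: functional_extensionality => i; rewrite mulrA mulfV ?mul1r.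
  rewrite xE (meval_scale _ _ ph) Hp ?mulr0 //; apply/zeroset_symlift.
  by rewrite zE; apply: (cone_scale ok).
case/(primeM (cone_prime Kclosed ok Disc0 sqf)) => // X0v.
have [x cx xb] := cone_onto Kclosed ok (fun _ => 1).
by have /eqP := X0v x cx; rewrite mevalXU -(psipt0 e) xb oner_eq0.
Qed.
End ProjectiveClosure.

Section SingularCodimension.
Variables (K : fieldType) (n m N : nat).
Local Notation r := n.+2.
Variables (G : 'I_m -> {mpoly K[r]}) (w : 'I_m -> nat) (jj : 'I_m -> 'I_r) (e : 'I_N -> 'I_r).
Hypothesis Kclosed : alg_closed K.
Hypothesis tri : triangular G w jj e.
Local Notation gam := (gam G w jj e).

Lemma singular_pcone (k : 'I_r) x : (r - N)%N = m -> (forall i, indep_of k (G i)) ->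
  singular (pcone e gam) N x ->
  (DiscB gam).@[psipt e x] = 0 /\ (gam ord0 * SubdiscB gam).@[psipt e x] = 0.
Proof.
rewrite /singular; move: (r - N)%N => m' -> Gk [[x0 cx] H].
have Rv i : vanish (pcone e gam) (Rh G w i) by move=> y [_]; apply: (Rh_vanish tri).
have [lam [lam0 L]] := rank_deficient (H _ Rv).
apply: (singular_point Kclosed tri Gk cx lam0) => j; rewrite -[RHS](L j).
by apply: eq_bigr => i _; rewrite mxE.
Qed.
End SingularCodimension.

Theorem mainTheorem12
  (F : finFieldType) (K : closedFieldType) (iota : {rmorphism F -> K})
  (K_alg : forall x : K, exists p : {poly F}, p != 0 /\ root (map_poly iota p) x)
  (r m : nat) (m_gt0 : (0 < m)%N) (m_lt_r : (m < r)%N) (k : 'I_r)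
  (G : 'I_m -> {mpoly F[r]})
  (G_in_Ak : forall i, indep_of k (G i))
  (H1 : regular_seq_k k G)
  (H2 : jacobian_full iota k G (zeroset iota G))
  (H3 : regular_seq_k k (fun i => wtpart (G i)) /\
        jacobian_full iota k (fun i => wtpart (G i))
                      (zeroset iota (fun i => wtpart (G i))))
  (H4 : codim_ge (@aclosed K r) (Dlocus (zeroset iota G)) (zeroset iota G) 1)
  (H5 : codim_ge (@aclosed K r)
          (fun a => (Dlocus (zeroset iota G) a /\
                     exists j : 'I_r, nat_of_ord j = 0%N /\ a j = 0)
                    \/ S1locus (zeroset iota G) a)
          (Dlocus (zeroset iota G)) 1)
  (H6 : codim_ge (@aclosed K r)
          (Dlocus (zeroset iota (fun i => wtpart (G i))))
          (zeroset iota (fun i => wtpart (G i))) 1) :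
  let R := fun i => symlift (G i) in
  let V := zeroset iota R in
  let Rh := fun i => map_mpoly iota (homogenize (R i)) in
  (forall i, (msize (R i)).-1 = wt (G i)) /\
  [/\ forall y, pcl V y <-> (nonzero y /\ forall i, (Rh i).@[y] = 0),
      normal_complete_intersection (pcl V) Rh,
      irreducible (@pclosed K r.+1) (pcl V),
      dim_eq (@pclosed K r.+1) (pcl V) (r - m) &
      pdegree (pcl V) (r - m) (\prod_(i < m) (msize (R i)).-1)%N].
Proof.
have Kclosed : alg_closed K by move=> p /closed_rootP.
(* From 0 < m < r it follows that r is at least 2. *)
case: r m_lt_r k G G_in_Ak H1 H2 H3 H4 H5 H6 => [|[|n]] mr; first by [].
  by exfalso; lia.
move=> k G G_in_Ak _ _ [H3r H3j] H4 H5 H6 R V Rh0.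
have w_gt0 i : (0 < wt (G i))%N := wt_gt0 H3r i.
have [jj jjP] := lead_index H3r H3j.
have := complement_enum (jj_inj H3r H3j jjP); rewrite card_ord => -[e [e_inj e_cover e_disj]].
have tri := Gk_triangular H3r H3j jjP e_inj e_cover e_disj.
have ok := triangular_cone_ok tri.
set gam := gam _ _ _ _ in ok.
rewrite (zeroset_fibre1 Kclosed tri) in H4 H5; rewrite (zeroset_fibre0 Kclosed tri) in H6.
have D1 := codim_Disc_nonzero Kclosed ok H4.
have D0 := codim_Disc_nonzero Kclosed ok H6.
have Disc0 := DiscB_neq0 D1.
have Gkk i : indep_of k (Gk iota G i) by move=> mon; rewrite msupp_Gk; apply: G_in_Ak.
(* The Jacobian leaves out column k, so k is never a leading index and a_k is one of the free
   coordinates. *)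
have [kl klE] : exists kl, k = e kl.
  have [[i ki]|//] := e_cover k.
  by have [/eqP ik _ _] := jjP i; rewrite -ki in ik.
rewrite klE in Gkk.
have sqf := DiscB_sqfree Kclosed ok D0 D1 H5 (gam_indep tri Gkk).
have pclE : pcl V = pcone e gam := pcl_symlift Kclosed tri Disc0 sqf.
have RhE : Rh0 = Rh (Gk iota G) (fun i => wt (G i)).
  by apply: functional_extensionality => i; apply: (homogenize_symlift Kclosed tri w_gt0).
have sR i : (msize (R i)).-1 = wt (G i) by rewrite /R (msize_symlift Kclosed tri w_gt0).
have closed := pclosed_pcone tri.
have chain := pcone_chain Kclosed ok Disc0 closed sqf.
have dimE : dim_eq (@pclosed K n.+3) (pcone e gam) (n.+2 - m).
  by split=> // /(pcone_chain_le Kclosed ok Disc0); rewrite ltnn.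
split=> //; rewrite pclE RhE; split.
- exact: pcone_Rh.
- split; first split=> //.
  + by move=> i; exists (wt (G i)); apply: (Rh_homog tri).
  + exact: pcone_Rh.
  + move=> p /(pcone_vanish Kclosed ok); apply: (cone_radical (I := Rideal (Gk iota G) (fun i => wt (G i))) Kclosed ok Disc0).
    * exact: Rideal_ideal.
    * exact: (Rideal_coefA tri).
    * exact: (Rideal_vanish tri).
  (* The cone already has a chain of length r - m, so it suffices to bound l + 2 by r - m. *)
  + move=> l Hl; apply: has_chain_le chain.
    apply: (bad_chain_le Kclosed ok Disc0 _ (X0_ndvd_DiscB D0) _ _ Hl).
    * exact: (gam0_Subdisc_coprime Kclosed ok D0 D1 H5).
    * by move=> x [].
    move=> x /(singular_pcone Kclosed tri (subKn (ltnW mr)) Gkk)[? ?].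
    by split=> //; right.
- exact: (pcone_irreducible Kclosed ok Disc0 sqf).
- exact: dimE.
rewrite (eq_bigr _ (fun i _ => sR i)); exact: (pcone_pdegree tri Kclosed Disc0).
Qed.
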